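(* Let $F_{ij}$ ($0\le i\le m$, $0\le j\le n$) be a dual-convex $m\times n$ net in $I^3$ whose faces $p_{kl}$ ($0\le k<m$, $0\le l<n$) lie in pairwise non-parallel planes. Then the net is flexible in $I^3$ if and only if at least one of the following conditions holds: (i) for each $0\le k\le m-3$ the $n$ lines $p_{k,0}\cap p_{k+2,0},\ldots,p_{k,n-1}\cap p_{k+2,n-1}$ lie in one isotropic plane, or for each $0\le l\le n-3$ the $m$ lines $p_{0,l}\cap p_{0,l+2},\ldots,p_{m-1,l}\cap p_{m-1,l+2}$ lie in one isotropic plane; (ii) any two non-boundary vertices joined by an edge have equal opposite ratios with respect to that edge.
   Context: $I^3$ is $\mathbb{R}^3$ with coordinates $(x,y,z)$. A vector, line or plane is isotropic if it is parallel to the $z$-axis. The top view $\overline{P}$ of $P=(x,y,z)$ is $(x,y)$. Isotropic congruences are the maps $\mathbf{x}\mapsto A\mathbf{x}+\mathbf{b}$ with $\mathbf b\in\mathbb R^3$ and $A=\begin{pmatrix}\cos\phi&-\sin\phi&0\\ \sin\phi&\cos\phi&0\\ c_1&c_2&1\end{pmatrix}$, $\phi,c_1,c_2\in\mathbb R$. Metric duality: a point $P=(P^1,P^2,P^3)$ corresponds to the non-isotropic plane $P^*\colon z=P^1x+P^2y-P^3$, and a non-isotropic plane $p$ to the point $p^*$ with $(p^* )^*=p$. The isotropic angle $\angle(p,q)$ between non-isotropic planes $z=a_1x+b_1y+c_1$ and $z=a_2x+b_2y+c_2$ is $\sqrt{(a_1-a_2)^2+(b_1-b_2)^2}$. An $m\times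 n$ net ($m,n\ge1$) is a collection of points $F_{ij}\in I^3$, $0\le i\le m$, $0\le j\le n$, such that for all $0\le i<m$, $0\le j<n$ the points $F_{ij},F_{i+1,j},F_{i+1,j+1},F_{i,j+1}$ are consecutive vertices of a convex planar quadrilateral, the face $p_{ij}$ (its plane is also denoted $p_{ij}$); edges are the sides of faces. A vertex $F_{ij}$ with $i\in\{0,m\}$ or $j\in\{0,n\}$ is a boundary vertex; the four consecutive faces around a non-boundary vertex $F_{ij}$ are $p_{i-1,j-1},p_{i,j-1},p_{ij},p_{i-1,j}$. For a convex quadrilateral in a plane and a point $O$ off that plane, the union of rays from $O$ meeting the quadrilateral is a convex 4-hedral angle with vertex $O$; the union of rays from $O$ meeting one side is a flat angle. It is admissible if the isotropic line through $O$ meets its interior. An $m\times n$ net is dual-convex if $m,n\ge2$ and for each non-boundary vertex the planes of its four consecutive faces are the planes of four consecutive flat angles of some admissible convex 4-hedral angle. Curvature: if $p_1,\dots,p_4$ are the consecutive faces around a non-boundary vertex $F_{ij}$ (with non-isotropic planes), $\Omega(F_{ij})=\frac12\sum_{k=1}^4\det(\overline{p_k^*},\overline{p_{k+1}^*})$ with $p_5=p_1$. An isotropic isometric deformation of a dual-convex $m\times n$ net $F_{ij}$ is a continuous family of $m\times n$ nets $F_{ij}(t)$, $t\in[0,1]$, $F_{ij}(0)=F_{ij}$, such that corresponding faces of all $F_{ij}(t)$ are isotropically congruent and corresponding non-boundary vertices of all $F_{ij}(t)$ have the same curvature $\Omega$. It is trivial if for each $t$ there is an isotropic congruence $C_t$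 with $F_{ij}(t)=C_t(F_{ij})$ for all $i,j$. A dual-convex net is flexible in $I^3$ if it has a nontrivial isotropic isometric deformation. Opposite ratio: let $F_{ij}$ be a non-boundary vertex and $e$ an edge emanating from it; enumerate the consecutive faces around $F_{ij}$ as $p_1,p_2,p_3,p_4$ so that $p_1\cap p_4=e$, and let $p$ be the plane spanned by the lines $p_1\cap p_3$ and $p_2\cap p_4$. The opposite ratio of $F_{ij}$ with respect to $e$ is $\frac{\angle(p_1,p)}{\angle(p_3,p)}\cdot\frac{\angle(p_4,p)}{\angle(p_2,p)}$. *)

(* Defs.v *)
From Stdlib Require Import Reals Lra Lia.
Open Scope R_scope.

Record pt := mkpt { px : R; py : R; pz : R }.

Definition vsub (P Q : pt) : pt := mkpt (px P - px Q) (py P - py Q) (pz P - pz Q).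
Definition vadd (P Q : pt) : pt := mkpt (px P + px Q) (py P + py Q) (pz P + pz Q).
Definition vscale (s : R) (P : pt) : pt := mkpt (s * px P) (s * py P) (s * pz P).
Definition cross (u v : pt) : pt :=
  mkpt (py u * pz v - pz u * py v) (pz u * px v - px u * pz v) (px u * py v - py u * px v).
Definition dot (u v : pt) : R := px u * px v + py u * py v + pz u * pz v.
Definition det3 (u v w : pt) : R := dot u (cross v w).
Definition e3 : pt := mkpt 0 0 1.
Definition is_zero (u : pt) : Prop := px u = 0 /\ py u = 0 /\ pz u = 0.

Definition pos_parallel (u v : pt) : Prop := is_zero (cross u v) /\ dot u v > 0.

(** A, B, C, D are consecutive vertices of a (non-degenerate) convex planar
    quadrilateral: coplanar, and all four turns are nonzero and in the same
    direction. *)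
Definition convex_quad (A B C D : pt) : Prop :=
  det3 (vsub B A) (vsub C A) (vsub D A) = 0 /\
  let n1 := cross (vsub B A) (vsub C B) in
  let n2 := cross (vsub C B) (vsub D C) in
  let n3 := cross (vsub D C) (vsub A D) in
  let n4 := cross (vsub A D) (vsub B A) in
  ~ is_zero n1 /\ pos_parallel n1 n2 /\ pos_parallel n1 n3 /\ pos_parallel n1 n4.

(** * Non-isotropic planes z = a x + b y + c *)
Record plane := mkpl { pa : R; pb : R; pc : R }.
Definition on_plane (p : plane) (X : pt) : Prop := pz X = pa p * px X + pb p * py X + pc p.

Definition dual_plane (P : pt) : plane := mkpl (px P) (py P) (- pz P).
Definition dual_point (p : plane) : pt := mkpt (pa p) (pb p) (- pc p).
Definition top (P : pt) : R * R := (px P, py P).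
Definition det2 (u v : R * R) : R := fst u * snd v - snd u * fst v.

Definition iso_angle (p q : plane) : R :=
  sqrt ((pa p - pa q) ^ 2 + (pb p - pb q) ^ 2).

(** The plane through three points, as a non-isotropic plane
    (meaningful when the points are non-collinear and span a non-isotropic plane). *)
Definition plane_through (P0 P1 P2 : pt) : plane :=
  let nv := cross (vsub P1 P0) (vsub P2 P0) in
  let a := - px nv / pz nv in
  let b := - py nv / pz nv in
  mkpl a b (pz P0 - a * px P0 - b * py P0).

(** An isotropic plane: a x + b y = c with (a,b) <> (0,0) *)
Definition in_iso_plane (a b c : R) (X : pt) : Prop := a * px X + b * py X = c.

Definition iso_cong (phi c1 c2 : R) (b : pt) (X : pt) : pt :=
  mkpt (cos phi * px X - sin phi * py X + px b)
       (sin phi * px X + cos phi * py X + py b)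
       (c1 * px X + c2 * py X + pz X + pz b).

Definition net := nat -> nat -> pt.

Definition is_net (m n : nat) (F : net) : Prop :=
  (1 <= m)%nat /\ (1 <= n)%nat /\
  forall i j, (i < m)%nat -> (j < n)%nat ->
    convex_quad (F i j) (F (S i) j) (F (S i) (S j)) (F i (S j)).

Definition face_vertex (F : net) (k l : nat) (r : nat) : pt :=
  match r with
  | 0%nat => F k l
  | 1%nat => F (S k) l
  | 2%nat => F (S k) (S l)
  | _ => F k (S l)
  end.

Definition face_plane (F : net) (k l : nat) : plane :=
  plane_through (F k l) (F (S k) l) (F k (S l)).

Definition face_normal (F : net) (k l : nat) : pt :=
  cross (vsub (F (S k) l) (F k l)) (vsub (F k (S l)) (F k l)).

Definition around (i j r : nat) : nat * nat :=
  match r with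
  | 0%nat => (i - 1, j - 1)%nat
  | 1%nat => (i, j - 1)%nat
  | 2%nat => (i, j)%nat
  | _ => (i - 1, j)%nat
  end.

Definition around_plane (F : net) (i j r : nat) : plane :=
  face_plane F (fst (around i j r)) (snd (around i j r)).

Definition non_boundary (m n i j : nat) : Prop :=
  (1 <= i)%nat /\ (i <= m - 1)%nat /\ (1 <= j)%nat /\ (j <= n - 1)%nat.

(** The four face planes around F_ij are the planes of four consecutive flat
    angles O V0 V1, O V1 V2, O V2 V3, O V3 V0 of an admissible convex 4-hedral
    angle with vertex O over the convex quadrilateral V0 V1 V2 V3. *)
Definition dual_convex_at (F : net) (i j : nat) : Prop :=
  exists (O : pt) (V : nat -> pt),
    convex_quad (V 0%nat) (V 1%nat) (V 2%nat) (V 3%nat) /\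
    det3 (vsub (V 0%nat) O) (vsub (V 1%nat) O) (vsub (V 2%nat) O) <> 0 /\
    (* admissible: the isotropic line through O meets the interior *)
    (exists s l0 l1 l2 l3, 0 < l0 /\ 0 < l1 /\ 0 < l2 /\ 0 < l3 /\
        l0 + l1 + l2 + l3 = 1 /\
        vadd O (vscale s e3) =
        vadd (vadd (vscale l0 (V 0%nat)) (vscale l1 (V 1%nat)))
             (vadd (vscale l2 (V 2%nat)) (vscale l3 (V 3%nat)))) /\
    (forall r, (r < 4)%nat ->
      exists p : plane,
        (forall q, (q < 4)%nat ->
           on_plane p (face_vertex F (fst (around i j r)) (snd (around i j r)) q)) /\
        on_plane p O /\ on_plane p (V r) /\ on_plane p (V (S r mod 4)%nat)).

Definition dual_convex (m n : nat) (F : net) : Prop :=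
  (2 <= m)%nat /\ (2 <= n)%nat /\ is_net m n F /\
  forall i j, non_boundary m n i j -> dual_convex_at F i j.

Definition curvature (F : net) (i j : nat) : R :=
  / 2 * (det2 (top (dual_point (around_plane F i j 0))) (top (dual_point (around_plane F i j 1)))
       + det2 (top (dual_point (around_plane F i j 1))) (top (dual_point (around_plane F i j 2)))
       + det2 (top (dual_point (around_plane F i j 2))) (top (dual_point (around_plane F i j 3)))
       + det2 (top (dual_point (around_plane F i j 3))) (top (dual_point (around_plane F i j 0)))).

Definition in01 (t : R) : Prop := 0 <= t <= 1.

Definition continuous01 (f : R -> pt) : Prop :=
  forall t, in01 t -> forall eps, eps > 0 -> exists delta, delta > 0 /\
    forall s, in01 s -> Rabs (s - t) < delta ->
      Rabs (px (f s) - px (f t)) + Rabs (py (f s) - py (f t)) + Rabs (pz (f s) - pz (f t)) < eps.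

Definition iso_deformation (m n : nat) (F : net) (G : R -> net) : Prop :=
  (forall i j, (i <= m)%nat -> (j <= n)%nat -> G 0 i j = F i j) /\
  (forall i j, (i <= m)%nat -> (j <= n)%nat -> continuous01 (fun t => G t i j)) /\
  (forall t, in01 t -> is_net m n (G t)) /\
  (forall t, in01 t -> forall k l, (k < m)%nat -> (l < n)%nat ->
     exists phi c1 c2 b, forall q, (q < 4)%nat ->
       face_vertex (G t) k l q = iso_cong phi c1 c2 b (face_vertex F k l q)) /\
  (forall t, in01 t -> forall i j, non_boundary m n i j ->
     curvature (G t) i j = curvature F i j).

Definition trivial_deformation (m n : nat) (F : net) (G : R -> net) : Prop :=
  forall t, in01 t -> exists phi c1 c2 b,
    forall i j, (i <= m)%nat -> (j <= n)%nat -> G t i j = iso_cong phi c1 c2 b (F i j).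

Definition flexible (m n : nat) (F : net) : Prop :=
  exists G, iso_deformation m n F G /\ ~ trivial_deformation m n F G.

(** r is the opposite ratio for consecutive faces p1..p4 (with p1 ∩ p4 = e):
    p is the plane spanned by the lines p1 ∩ p3 and p2 ∩ p4. *)
Definition opp_ratio_is (p1 p2 p3 p4 : plane) (r : R) : Prop :=
  exists p : plane,
    (forall X, on_plane p1 X -> on_plane p3 X -> on_plane p X) /\
    (forall X, on_plane p2 X -> on_plane p4 X -> on_plane p X) /\
    r = iso_angle p1 p / iso_angle p3 p * (iso_angle p4 p / iso_angle p2 p).

(** Opposite ratio of F_ij w.r.t. the edge lying between the faces around
    (s+3) mod 4 and s mod 4 (so p1 = around s, p4 = around (s+3)):
    s = 2 : edge to F_{i+1,j};  s = 3 : edge to F_{i,j+1};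
    s = 0 : edge to F_{i-1,j};  s = 1 : edge to F_{i,j-1}. *)
Definition opp_ratio_at (F : net) (i j s : nat) (r : R) : Prop :=
  opp_ratio_is (around_plane F i j (s mod 4)) (around_plane F i j ((s + 1) mod 4))
               (around_plane F i j ((s + 2) mod 4)) (around_plane F i j ((s + 3) mod 4)) r.

(* Main.v *)
(** Let [g_kl] be the gradient of the face plane [p_kl], that is, the top view of the dual point. Neighbouring faces agree
    along an edge, so an isotropic isometric deformation moves the top view of the net by Euclidean congruences, while
    the net [g] is replaced by nets with parallel edges whose faces, one for each non-boundary vertex of the original
    net, keep their signed areas. By dual-convexity the faces of [g] are convex quadrilaterals. The parallel
    quadrilaterals with the same area form a hyperbola [s^2 - u^2 = 1]: the edges are multiplied by [s + p u], [s - q u],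
    [s + u / p], [s - u / q], where the [u]-part is the Christoffel dual quadrilateral, and [p^2], [q^2] and their
    inverses are the opposite ratios.

    Flexibility is thus the compatibility of a grid of hyperbolas with common edge factors. For the four quadrilaterals
    around a face, writing [s + u = w] makes the factors in one of them rational, and those in its two neighbours
    involve square roots of quadratics in [w^2]. As these roots are rationally independent, either the opposite ratios
    agree along the common edges, or two pairs of adjacent quadrilaterals are mirror images with equal factors. The second
    alternative spreads to all strips in one direction and gives (i); if it never occurs, (ii) holds. *)

(* The algebra needs relations only at points accumulating at the rest position, so a deformation
   enters only through its configurations with arbitrarily small parameters. The obstacle is that a
   merely continuous path may pause, turn back or leave some vertices at rest. The intermediate
   value theorem for the sum of the absolute values of all parameters, combined with local
   injectivity of the edge factors, yields small configurations in which no vertex is at rest.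

   The hyperbolas are parametrized by [x = sinh u], so that a single square root [ch x] occurs, and
   the rational parameter is [z = (ch x + x)^2], equal to 1 at rest. Polynomials are real functions
   with a degree bound; divisibility and degree comparison are derived from their values.

   The radicands become squares exactly when a parameter is 1 or two parameters agree. In these
   exceptional cases the neighbouring quadrilateral is rational as well, or the reflected block is
   used; they are where the mirror images come from, while the generic case is contradictory. *)
Require Import Defs.
From Stdlib Require Import Reals Lra Lia Psatz Classical.
Open Scope R_scope.

(** * Polynomial functions and square roots of quadratics *)

(** Polynomial functions of degree less than [n] *)
Fixpoint ispoly (n : nat) (P : R -> R) : Prop :=
  match n with
  | O => forall z, P z = 0
  | S n => exists c Q, ispoly n Q /\ forall z, P z = c + z * Q z
  end.

Lemma ispoly_ext n P Q : ispoly n P -> (forall z, P z = Q z) -> ispoly n Q.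
Proof.
  destruct n as [|n]; simpl.
  - intros HP E z. rewrite <- E. apply HP.
  - intros (c & P' & HP & e) E. exists c, P'. split; [assumption|].
    intro z. rewrite <- E. apply e.
Qed.

Lemma ispoly_S n : forall P, ispoly n P -> ispoly (S n) P.
Proof.
  induction n as [|n IH]; intros P HP.
  - exists 0, (fun _ => 0). simpl in *. split; [reflexivity|]. intro z. rewrite HP. ring.
  - destruct HP as (c & Q & HQ & e). exists c, Q. split; [apply IH, HQ | exact e].
Qed.

Lemma ispoly_le n m P : (n <= m)%nat -> ispoly n P -> ispoly m P.
Proof. induction 1; auto using ispoly_S. Qed.

Lemma ispoly_add n : forall P Q, ispoly n P -> ispoly n Q -> ispoly n (fun z => P z + Q z).
Proof.
  induction n as [|n IH]; simpl.
  - intros P Q HP HQ z. rewrite HP, HQ. ring.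
  - intros P Q (c & P' & HP & e) (d & Q' & HQ & e').
    exists (c + d), (fun z => P' z + Q' z). split; [apply IH; assumption|].
    intro z. rewrite e, e'. ring.
Qed.

Lemma ispoly_scale n k : forall P, ispoly n P -> ispoly n (fun z => k * P z).
Proof.
  induction n as [|n IH]; simpl.
  - intros P HP z. rewrite HP. ring.
  - intros P (c & Q & HQ & e). exists (k * c), (fun z => k * Q z).
    split; [apply IH, HQ|]. intro z. rewrite e. ring.
Qed.

Lemma ispoly_mul n m : forall P Q, ispoly n P -> ispoly m Q -> ispoly (n + m) (fun z => P z * Q z).
Proof.
  induction n as [|n IH]; intros P Q HP HQ.
  - apply ispoly_le with (n := O); [lia|]. intro z. rewrite (HP z). ring.
  - destruct HP as (c & P' & HP & e).
    apply ispoly_ext with (fun z => c * Q z + z * (P' z * Q z)); [|intro z; rewrite e; ring].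
    apply ispoly_add.
    + apply ispoly_le with m; [lia|]. apply ispoly_scale, HQ.
    + exists 0, (fun z => P' z * Q z). split; [apply IH; assumption|]. intro; ring.
Qed.

Definition poly (P : R -> R) : Prop := exists n, ispoly n P.

Lemma poly_const c : poly (fun _ => c).
Proof. exists 1%nat, c, (fun _ => 0). split; [intro; reflexivity | intro; ring]. Qed.

Lemma poly_id : poly (fun z => z).
Proof.
  exists 2%nat, 0, (fun _ => 1). split; [|intro; ring].
  exists 1, (fun _ => 0). split; [intro; reflexivity | intro; ring].
Qed.

Lemma poly_add P Q : poly P -> poly Q -> poly (fun z => P z + Q z).
Proof.
  intros [n HP] [m HQ]. exists (n + m)%nat.
  apply ispoly_add; eapply ispoly_le; try eassumption; lia.
Qed.

Lemma poly_mul P Q : poly P -> poly Q -> poly (fun z => P z * Q z).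
Proof. intros [n HP] [m HQ]. exists (n + m)%nat. apply ispoly_mul; assumption. Qed.

Lemma poly_sub P Q : poly P -> poly Q -> poly (fun z => P z - Q z).
Proof.
  intros HP [m HQ]. apply (poly_add P (fun z => - Q z)); [assumption|].
  exists m. apply ispoly_ext with (fun z => (-1) * Q z); [apply ispoly_scale, HQ | intro; ring].
Qed.

Lemma poly_pow P n : poly P -> poly (fun z => P z ^ n).
Proof. intro HP. induction n as [|n IH]; simpl; [apply poly_const | apply poly_mul; assumption]. Qed.

Ltac poly_tac :=
  repeat first [ assumption | apply poly_const | apply poly_id | apply poly_sub | apply poly_add
               | apply poly_mul | apply poly_pow ].

Lemma ispoly_factor n r : forall P, ispoly (S n) P ->
  exists Q, ispoly n Q /\ forall z, P z = P r + (z - r) * Q z.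
Proof.
  induction n as [|n IH]; intros P (c & P' & HP & e).
  - exists (fun _ => 0). split; [intro; reflexivity|]. intro z.
    simpl in HP. rewrite !e, !HP. ring.
  - destruct (IH P' HP) as (Q & HQ & eQ).
    exists (fun z => P' r + z * Q z). split.
    + exists (P' r), Q. split; [assumption | reflexivity].
    + intro z. rewrite (e z), (e r), (eQ z). ring.
Qed.

(** Stands in for an infinite zero set. The point 1 is excluded because it is the rest position,
    where every relation holds trivially. *)
Definition near1 (P : R -> Prop) : Prop :=
  forall eps, 0 < eps -> exists z, z <> 1 /\ Rabs (z - 1) < eps /\ P z.

Lemma near1_mono (P Q : R -> Prop) d : 0 < d ->
  (forall z, z <> 1 -> Rabs (z - 1) < d -> P z -> Q z) -> near1 P -> near1 Q.
Proof.
  intros d0 H HP eps e0.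
  destruct (HP (Rmin eps d)) as (z & z1 & zd & Pz); [apply Rmin_pos; assumption|].
  exists z. repeat split; try assumption.
  - eapply Rlt_le_trans; [exact zd | apply Rmin_l].
  - apply H; try assumption. eapply Rlt_le_trans; [exact zd | apply Rmin_r].
Qed.

Lemma ispoly_bounded n : forall P, ispoly n P ->
  exists K, 0 < K /\ forall z, Rabs (z - 1) <= 1 -> Rabs (P z) <= K.
Proof.
  induction n as [|n IH]; intros P HP.
  - exists 1. split; [lra|]. intros z _. rewrite (HP z), Rabs_R0. lra.
  - destruct HP as (c & Q & HQ & e). destruct (IH Q HQ) as (K & K0 & HK).
    exists (Rabs c + 2 * K). split; [pose proof (Rabs_pos c); lra|].
    intros z Hz. rewrite e. eapply Rle_trans; [apply Rabs_triang|].
    apply Rplus_le_compat_l. rewrite Rabs_mult. specialize (HK z Hz).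
    assert (Rabs z <= 2). { replace z with ((z - 1) + 1) by ring.
      eapply Rle_trans; [apply Rabs_triang|]. rewrite Rabs_R1. lra. }
    apply Rmult_le_compat; try apply Rabs_pos; assumption.
Qed.

Lemma poly_near1_pos P : poly P -> P 1 <> 0 ->
  exists d, 0 < d /\ forall z, Rabs (z - 1) < d -> P z <> 0.
Proof.
  intros [n HP] H1.
  destruct (ispoly_factor n 1 P (ispoly_S _ _ HP)) as (Q & HQ & e).
  destruct (ispoly_bounded _ _ HQ) as (K & K0 & HK).
  assert (A1 := Rabs_pos_lt _ H1).
  exists (Rmin 1 (Rabs (P 1) / K)). split; [apply Rmin_pos; [lra|]; apply Rdiv_lt_0_compat; assumption|].
  intros z Hz E. assert (z1 := Rmin_l 1 (Rabs (P 1) / K)). assert (z2 := Rmin_r 1 (Rabs (P 1) / K)).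
  assert (HQz : Rabs (Q z) <= K) by (apply HK; lra).
  rewrite e in E. assert (E' : P 1 = - ((z - 1) * Q z)) by lra.
  assert (Rabs (P 1) = Rabs (z - 1) * Rabs (Q z)) by (rewrite E', Rabs_Ropp, Rabs_mult; reflexivity).
  assert (Rabs (z - 1) * Rabs (Q z) <= Rabs (z - 1) * K)
    by (apply Rmult_le_compat_l; [apply Rabs_pos | assumption]).
  assert (Rabs (z - 1) * K < Rabs (P 1) / K * K) by (apply Rmult_lt_compat_r; lra).
  assert (Rabs (P 1) / K * K = Rabs (P 1)) by (field; lra). lra.
Qed.

(** Induction on the degree: zeros accumulating at 1 force a zero at 1 by continuity, and after
    division by [z - 1] the same points remain zeros since they differ from 1. *)
Lemma poly_identity P : poly P -> near1 (fun z => P z = 0) -> forall z, P z = 0.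
Proof.
  intros [n HP]; revert P HP. induction n as [|n IH]; intros P HP HZ; [exact HP|].
  assert (P1 : P 1 = 0).
  { apply NNPP. intro H1. destruct (poly_near1_pos P (ex_intro _ (S n) HP) H1) as (d & d0 & Hd).
    destruct (HZ d d0) as (z & _ & zd & Pz). exact (Hd z zd Pz). }
  destruct (ispoly_factor n 1 P HP) as (Q & HQ & e). rewrite P1 in e.
  assert (HQ0 : forall z, Q z = 0).
  { apply IH; [assumption|]. apply (near1_mono _ _ 1) with (3 := HZ); [lra|].
    intros z z1 _ Pz. rewrite e in Pz.
    apply Rmult_eq_reg_l with (z - 1); lra. }
  intro z. rewrite e, HQ0. ring.
Qed.

(** If the zeros of [P] do not accumulate at 1, then [P] has none in a punctured neighbourhood of 1,
    so [Q] vanishes there and [poly_identity] applies to it. *)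
Lemma poly_domain P Q : poly P -> poly Q -> (forall z, P z * Q z = 0) ->
  (forall z, P z = 0) \/ (forall z, Q z = 0).
Proof.
  intros HP HQ H. destruct (classic (near1 (fun z => P z = 0))) as [N|N].
  - left. apply poly_identity; assumption.
  - right. apply poly_identity; [assumption|]. intros eps e0.
    apply not_all_ex_not in N. destruct N as [d N].
    apply imply_to_and in N. destruct N as [d0 N].
    set (z := 1 + Rmin eps d / 2). assert (0 < Rmin eps d) by (apply Rmin_pos; assumption).
    assert (zz : z - 1 = Rmin eps d / 2) by (unfold z; lra).
    assert (m1 := Rmin_l eps d). assert (m2 := Rmin_r eps d).
    assert (za : Rabs (z - 1) = Rmin eps d / 2) by (rewrite zz; apply Rabs_pos_eq; lra).
    exists z. repeat split; [lra | lra |].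
    destruct (Rmult_integral _ _ (H z)) as [E|E]; [|assumption].
    exfalso. apply N. exists z. repeat split; [lra | lra | assumption].
Qed.

(** * Irrationality of square roots of quadratic polynomials *)

Definition quad2 (f2 f1 f0 z : R) : R := f2 * z ^ 2 + f1 * z + f0.

Lemma poly_quad2 f2 f1 f0 : poly (quad2 f2 f1 f0).
Proof. unfold quad2. poly_tac. Qed.

Lemma quad2_division f2 f1 f0 : f2 <> 0 -> forall n P, ispoly (S (S n)) P ->
  exists Q r1 r0, ispoly n Q /\ forall z, P z = quad2 f2 f1 f0 z * Q z + r1 * z + r0.
Proof.
  intros H2. induction n as [|n IH]; intros P (c & P' & HP & e).
  - destruct HP as (c' & P'' & HP & e'). simpl in HP.
    exists (fun _ => 0), c', c. split; [intro; reflexivity|].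
    intro z. rewrite e, e', HP. ring.
  - destruct (IH P' HP) as (Q & r1 & r0 & HQ & eQ).
    exists (fun z => r1 / f2 + z * Q z), (r0 - r1 * f1 / f2), (c - r1 * f0 / f2). split.
    + exists (r1 / f2), Q. split; [assumption | reflexivity].
    + intro z. rewrite e, eQ. unfold quad2. field. assumption.
Qed.

(** A degree comparison by growth at infinity, since functions carry no degree: a quadratic times a
    nonzero polynomial cannot be bounded by a linear function. *)
Lemma quad2_growth f2 f1 f0 n : f2 <> 0 -> forall Y C, ispoly n Y ->
  (forall z, 1 <= z -> Rabs (quad2 f2 f1 f0 z * Y z) <= C * z) -> forall z, Y z = 0.
Proof.
  intros H2. induction n as [|n IH]; intros Y C HY HC; [exact HY|].
  destruct HY as (c & Q & HQ & e).
  assert (HF : forall z, 1 <= z -> Rabs (quad2 f2 f1 f0 z) <= (Rabs f2 + Rabs f1 + Rabs f0) * z ^ 2).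
  { intros z Hz. unfold quad2. assert (a2 := Rabs_pos f2). assert (a1 := Rabs_pos f1). assert (a0 := Rabs_pos f0).
    eapply Rle_trans; [apply Rabs_triang|]. eapply Rle_trans; [apply Rplus_le_compat_r, Rabs_triang|].
    rewrite !Rabs_mult, (Rabs_pos_eq (z ^ 2)), (Rabs_pos_eq z) by nra.
    assert (z <= z ^ 2) by nra. assert (1 <= z ^ 2) by nra. nra. }
  assert (HQ0 : forall z, Q z = 0).
  { apply (IH Q (C + Rabs c * (Rabs f2 + Rabs f1 + Rabs f0)) HQ). intros z Hz.
    specialize (HF z Hz). specialize (HC z Hz). rewrite e in HC.
    apply Rmult_le_reg_l with z; [lra|].
    replace (z * Rabs (quad2 f2 f1 f0 z * Q z)) with
      (Rabs (quad2 f2 f1 f0 z * (c + z * Q z) + - (c * quad2 f2 f1 f0 z))).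
    2:{ transitivity (Rabs (z * (quad2 f2 f1 f0 z * Q z))); [f_equal; ring|].
      rewrite Rabs_mult, (Rabs_pos_eq z) by lra. reflexivity. }
    eapply Rle_trans; [apply Rabs_triang|]. rewrite Rabs_Ropp, (Rabs_mult c).
    assert (H := Rabs_pos c).
    assert (Rabs c * Rabs (quad2 f2 f1 f0 z) <= Rabs c * ((Rabs f2 + Rabs f1 + Rabs f0) * z ^ 2))
      by (apply Rmult_le_compat_l; assumption).
    assert (0 <= C) by (pose proof (Rabs_pos (quad2 f2 f1 f0 z * (c + z * Q z))); nra).
    assert (0 <= C * z * (z - 1)) by (repeat apply Rmult_le_pos; lra). lra. }
  assert (c = 0).
  { apply NNPP. intro Hc. assert (Hc' := Rabs_pos_lt _ Hc). assert (H2' := Rabs_pos_lt _ H2).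
    assert (a1 := Rabs_pos f1). assert (a0 := Rabs_pos f0).
    assert (H1 : 0 <= C).
    { specialize (HC 1 ltac:(lra)). pose proof (Rabs_pos (quad2 f2 f1 f0 1 * Y 1)). lra. }
    (* The constant is chosen so that at the [z] below [Rabs f2 * z = Rabs f2 + K] exceeds the sum
       of all lower-order bounds, which contradicts the linear bound. *)
    set (K := C / Rabs c + Rabs f1 + Rabs f0).
    assert (HK : 0 <= K). { unfold K. assert (0 <= C / Rabs c) by (apply Rle_mult_inv_pos; lra). lra. }
    set (z := 1 + K / Rabs f2).
    assert (0 <= K / Rabs f2) by (apply Rle_mult_inv_pos; lra).
    assert (Hz : 1 <= z) by (unfold z; lra).
    specialize (HC z Hz). rewrite e, HQ0 in HC.
    replace (c + z * 0) with c in HC by ring. rewrite Rabs_mult in HC.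
    assert (E1 : Rabs (quad2 f2 f1 f0 z) <= C / Rabs c * z).
    { apply Rmult_le_reg_r with (Rabs c); [assumption|].
      replace (C / Rabs c * z * Rabs c) with (C * z) by (field; lra). assumption. }
    assert (E2 : Rabs f2 * z ^ 2 <= Rabs (quad2 f2 f1 f0 z) + Rabs f1 * z + Rabs f0).
    { replace (Rabs f2 * z ^ 2) with (Rabs (quad2 f2 f1 f0 z + - (f1 * z) + - f0)).
      2:{ transitivity (Rabs (f2 * z ^ 2)); [f_equal; unfold quad2; ring|].
        rewrite Rabs_mult, (Rabs_pos_eq (z ^ 2)) by nra. reflexivity. }
      eapply Rle_trans; [apply Rabs_triang|]. rewrite Rabs_Ropp. apply Rplus_le_compat_r.
      eapply Rle_trans; [apply Rabs_triang|]. rewrite Rabs_Ropp, Rabs_mult, (Rabs_pos_eq z) by lra. lra. }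
    assert (E3 : Rabs f2 * z = Rabs f2 + K) by (unfold z; field; lra).
    unfold K in *. nra. }
  intro z. rewrite e, HQ0, H. ring.
Qed.

(** The remainder [r1 * z + r0] of [P] has a square divisible by the quadratic. That square minus a
    multiple of the quadratic is linear, hence zero; so a nonzero remainder would make the quadratic
    a multiple of a square, against the discriminant. *)
Lemma quad2_divides_square f2 f1 f0 n P W : f2 <> 0 -> f1 ^ 2 - 4 * f2 * f0 <> 0 ->
  ispoly (S (S n)) P -> poly W -> (forall z, P z ^ 2 = quad2 f2 f1 f0 z * W z) ->
  exists Q, ispoly n Q /\ forall z, P z = quad2 f2 f1 f0 z * Q z.
Proof.
  intros H2 Hd HP HW H.
  destruct (quad2_division f2 f1 f0 H2 n P HP) as (Q & r1 & r0 & HQ & e).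
  exists Q. split; [assumption|].
  (* The cofactor in the divisibility of the squared remainder, with [r1 ^ 2 / f2] subtracted so
     that the product with the quadratic becomes the linear function [a * z + b]. *)
  set (X := fun z => W z - 2 * Q z * (r1 * z + r0) - quad2 f2 f1 f0 z * Q z ^ 2 - r1 ^ 2 / f2).
  assert (HX : poly X).
  { unfold X. assert (poly Q) by (exists n; assumption).
    assert (HF := poly_quad2 f2 f1 f0). poly_tac. }
  assert (E : forall z, quad2 f2 f1 f0 z * X z =
     (2 * r1 * r0 - r1 ^ 2 * f1 / f2) * z + (r0 ^ 2 - r1 ^ 2 * f0 / f2)).
  { intro z. unfold X. assert (Hz := H z). rewrite e in Hz.
    transitivity ((quad2 f2 f1 f0 z * Q z + r1 * z + r0) ^ 2
      - 2 * quad2 f2 f1 f0 z * Q z * (r1 * z + r0) - quad2 f2 f1 f0 z ^ 2 * Q z ^ 2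
      - quad2 f2 f1 f0 z * (r1 ^ 2 / f2)); [rewrite Hz; ring|].
    unfold quad2. field. assumption. }
  set (a := 2 * r1 * r0 - r1 ^ 2 * f1 / f2) in *. set (b := r0 ^ 2 - r1 ^ 2 * f0 / f2) in *.
  destruct HX as [k HX].
  assert (X0 : forall z, X z = 0).
  { apply (quad2_growth f2 f1 f0 k H2 X (Rabs a + Rabs b) HX). intros z Hz. rewrite E.
    eapply Rle_trans; [apply Rabs_triang|]. rewrite Rabs_mult, (Rabs_pos_eq z) by lra.
    pose proof (Rabs_pos b). nra. }
  assert (E0 := E 0). assert (E1 := E 1). rewrite X0 in E0, E1.
  assert (Ha : a = 0) by lra. assert (Hb : b = 0) by lra.
  assert (r1z : r1 = 0).
  { apply NNPP. intro Hr. apply Hd. unfold a in Ha. unfold b in Hb.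
    assert (F1 : r1 * f1 = 2 * r0 * f2).
    { apply Rmult_eq_reg_l with (r1 / f2); [|apply Rmult_integral_contrapositive_currified; [assumption | apply Rinv_neq_0_compat; assumption]].
      replace (r1 / f2 * (2 * r0 * f2)) with (2 * r1 * r0) by (field; assumption).
      replace (r1 / f2 * (r1 * f1)) with (r1 ^ 2 * f1 / f2) by (field; assumption). lra. }
    assert (F2 : r1 ^ 2 * f0 = r0 ^ 2 * f2).
    { replace (r1 ^ 2 * f0) with (r1 ^ 2 * f0 / f2 * f2) by (field; assumption).
      replace (r1 ^ 2 * f0 / f2) with (r0 ^ 2) by lra. reflexivity. }
    apply Rmult_eq_reg_l with (r1 ^ 2); [|apply pow_nonzero; assumption].
    replace (r1 ^ 2 * (f1 ^ 2 - 4 * f2 * f0)) with ((r1 * f1) ^ 2 - 4 * f2 * (r1 ^ 2 * f0)) by ring.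
    rewrite F1, F2. ring. }
  assert (r0z : r0 = 0).
  { unfold b in Hb. rewrite r1z in Hb. replace (0 ^ 2 * f0 / f2) with 0 in Hb by (field; assumption).
    nra. }
  intro z. rewrite e, r1z, r0z. ring.
Qed.

Lemma poly_cancel f P : poly f -> poly P -> f 1 <> 0 -> (forall z, f z * P z = 0) -> forall z, P z = 0.
Proof.
  intros Hf HP H1 H. destruct (poly_domain f P Hf HP H) as [E|E]; [|exact E].
  exfalso. apply H1, E.
Qed.

(** By infinite descent: the quadratic divides [U], hence [V], and the quotients satisfy the same equation. *)
Lemma sqrt_quad2_irrational f2 f1 f0 : f2 <> 0 -> f1 ^ 2 - 4 * f2 * f0 <> 0 -> quad2 f2 f1 f0 1 <> 0 ->
  forall n U V, ispoly n U -> ispoly n V -> (forall z, U z ^ 2 = quad2 f2 f1 f0 z * V z ^ 2) ->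
  (forall z, U z = 0) /\ (forall z, V z = 0).
Proof.
  intros H2 Hd H1. induction n as [|n IH]; intros U V HU HV H; [split; assumption|].
  assert (HF := poly_quad2 f2 f1 f0).
  assert (pV : poly V) by (exists (S n); assumption).
  destruct (quad2_divides_square f2 f1 f0 n U (fun z => V z ^ 2) H2 Hd) as (U1 & HU1 & eU);
    [apply ispoly_S, HU | poly_tac | exact H |].
  assert (pU1 : poly U1) by (exists n; assumption).
  assert (EV : forall z, V z ^ 2 - quad2 f2 f1 f0 z * U1 z ^ 2 = 0).
  { apply poly_cancel with (quad2 f2 f1 f0); [assumption | poly_tac | assumption |].
    intro z. specialize (H z). rewrite eU in H.
    replace (quad2 f2 f1 f0 z * (V z ^ 2 - quad2 f2 f1 f0 z * U1 z ^ 2)) with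
      (quad2 f2 f1 f0 z * V z ^ 2 - (quad2 f2 f1 f0 z * U1 z) ^ 2) by ring. rewrite H. ring. }
  destruct (quad2_divides_square f2 f1 f0 n V (fun z => U1 z ^ 2) H2 Hd) as (V1 & HV1 & eV);
    [apply ispoly_S, HV | poly_tac | intro z; specialize (EV z); lra |].
  assert (pV1 : poly V1) by (exists n; assumption).
  assert (EU : forall z, U1 z ^ 2 - quad2 f2 f1 f0 z * V1 z ^ 2 = 0).
  { apply poly_cancel with (quad2 f2 f1 f0); [assumption | poly_tac | assumption |].
    intro z. specialize (EV z). rewrite eV in EV.
    replace (quad2 f2 f1 f0 z * (U1 z ^ 2 - quad2 f2 f1 f0 z * V1 z ^ 2)) with
      (- ((quad2 f2 f1 f0 z * V1 z) ^ 2 - quad2 f2 f1 f0 z * U1 z ^ 2)) by ring. rewrite EV. ring. }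
  destruct (IH U1 V1 HU1 HV1) as [U0 V0]; [intro z; specialize (EU z); lra|].
  split; intro z; [rewrite eU, U0 | rewrite eV, V0]; ring.
Qed.

(** The norm [U^2 - f V^2] does not depend on the sign of the root, so [T] may be a different branch
    at each of the accumulating points. *)
Lemma sqrt_quad2_irrational_near f2 f1 f0 U V : f2 <> 0 -> f1 ^ 2 - 4 * f2 * f0 <> 0 ->
  quad2 f2 f1 f0 1 <> 0 -> poly U -> poly V ->
  near1 (fun z => exists T, T ^ 2 = quad2 f2 f1 f0 z /\ U z + V z * T = 0) ->
  (forall z, U z = 0) /\ (forall z, V z = 0).
Proof.
  intros H2 Hd H1 HU HV HN.
  assert (HF := poly_quad2 f2 f1 f0).
  assert (E : forall z, U z ^ 2 - quad2 f2 f1 f0 z * V z ^ 2 = 0).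
  { apply poly_identity; [poly_tac|]. apply (near1_mono _ _ 1) with (3 := HN); [lra|].
    intros z _ _ (T & HT & HE). rewrite <- HT. nra. }
  destruct HU as [a Ha]. destruct HV as [b Hb].
  apply (sqrt_quad2_irrational f2 f1 f0 H2 Hd H1 (a + b)).
  - apply ispoly_le with a; [lia | assumption].
  - apply ispoly_le with b; [lia | assumption].
  - intro z. specialize (E z). lra.
Qed.

(** A relation with [D <> 0] puts the root of [g] into the field generated by the root of [f]. Hence
    [g] or the product [f g] is a square up to a constant; the degree bounds on [A] and [B] turn
    this into the two explicit alternatives. *)
Lemma two_radicals f2 f1 f0 g2 g1 g0 A b1 b0 C D :
  f2 <> 0 -> f1 ^ 2 - 4 * f2 * f0 <> 0 -> quad2 f2 f1 f0 1 <> 0 -> D <> 0 ->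
  ispoly 3 A -> poly C ->
  near1 (fun z => exists T S, T ^ 2 = quad2 f2 f1 f0 z /\ S ^ 2 = quad2 g2 g1 g0 z /\
     A z + (b1 * z + b0) * T + C z * S + D * T * S = 0) ->
  g1 ^ 2 - 4 * g2 * g0 = 0 \/
  exists k, forall z, quad2 f2 f1 f0 z * k ^ 2 = quad2 g2 g1 g0 z * D ^ 2.
Proof.
  intros H2 Hd H1 HD HA3 HC HN.
  assert (HA : poly A) by (exists 3%nat; assumption).
  assert (HF := poly_quad2 f2 f1 f0). assert (HG := poly_quad2 g2 g1 g0).
  set (f := quad2 f2 f1 f0) in *. set (g := quad2 g2 g1 g0) in *.
  set (B := fun z => b1 * z + b0).
  assert (HB : poly B) by (unfold B; poly_tac).
  (* Multiplying the relation by its conjugate under [S -> - S] removes [S] and leaves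
     [U + V T = 0]; both coefficients then vanish identically. *)
  destruct (sqrt_quad2_irrational_near f2 f1 f0
    (fun z => A z ^ 2 + B z ^ 2 * f z - g z * (C z ^ 2 + D ^ 2 * f z))
    (fun z => 2 * (A z * B z - g z * (C z * D))) H2 Hd H1) as [HU HV]; try poly_tac.
  { apply (near1_mono _ _ 1) with (3 := HN); [lra|].
    intros z _ _ (T & S & HT & HS & E). exists T. split; [exact HT|].
    rewrite <- HT, <- HS. fold (B z) in E.
    replace (A z ^ 2 + B z ^ 2 * T ^ 2 - S ^ 2 * (C z ^ 2 + D ^ 2 * T ^ 2) +
      2 * (A z * B z - S ^ 2 * (C z * D)) * T)
    with ((A z + B z * T + C z * S + D * T * S) * (A z + B z * T - C z * S - D * T * S)) by ring.
    rewrite E. ring. }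
  (* Norms: [A^2 - B^2 f = +- g (C^2 - D^2 f)], the sign being constant because polynomials form a domain. *)
  destruct (poly_domain (fun z => A z ^ 2 - B z ^ 2 * f z - g z * (C z ^ 2 - D ^ 2 * f z))
     (fun z => A z ^ 2 - B z ^ 2 * f z + g z * (C z ^ 2 - D ^ 2 * f z))) as [E|E]; try poly_tac.
  { intro z. specialize (HU z). specialize (HV z). simpl in HU, HV.
    assert (U' : A z ^ 2 + B z ^ 2 * f z = g z * (C z ^ 2 + D ^ 2 * f z)) by lra.
    assert (V' : A z * B z = g z * (C z * D)) by lra.
    replace ((A z ^ 2 - B z ^ 2 * f z - g z * (C z ^ 2 - D ^ 2 * f z)) *
             (A z ^ 2 - B z ^ 2 * f z + g z * (C z ^ 2 - D ^ 2 * f z)))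
    with ((A z ^ 2 + B z ^ 2 * f z) ^ 2 - 4 * f z * (A z * B z) ^ 2
          - (g z * (C z ^ 2 - D ^ 2 * f z)) ^ 2) by ring.
    rewrite U', V'. ring. }
  - left.
    (* With this sign the two norm identities subtract to [B^2 = g D^2]. As [B] is linear and [D]
       constant, [g] is the square of a linear function. *)
    assert (EB : forall z, B z ^ 2 - g z * D ^ 2 = 0).
    { apply (poly_cancel f (fun z => B z ^ 2 - g z * D ^ 2)); [assumption | poly_tac | exact H1 |].
      intro z. specialize (E z). specialize (HU z). simpl in HU, E. nra. }
    assert (E0 := EB 0). assert (E1 := EB 1). assert (E2 := EB (-1)).
    unfold B, g, quad2 in E0, E1, E2.
    assert (D2 : D ^ 2 <> 0) by (apply pow_nonzero; assumption).
    assert (F0 : g0 * D ^ 2 = b0 ^ 2) by lra.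
    assert (F1 : g1 * D ^ 2 = 2 * b0 * b1) by nra.
    assert (F2 : g2 * D ^ 2 = b1 ^ 2) by nra.
    apply Rmult_eq_reg_r with ((D ^ 2) ^ 2); [|apply pow_nonzero; assumption].
    replace ((g1 ^ 2 - 4 * g2 * g0) * (D ^ 2) ^ 2) with ((g1 * D ^ 2) ^ 2 - 4 * (g2 * D ^ 2) * (g0 * D ^ 2)) by ring.
    rewrite F0, F1, F2. ring.
  - right.
    (* With the other sign they add to [A^2 = f g D^2]. So [f] divides [A], and the degree bound on
       [A] makes the quotient a constant [k]. *)
    assert (EA : forall z, A z ^ 2 = f z * (g z * D ^ 2)).
    { intro z. specialize (E z). specialize (HU z). simpl in HU, E. lra. }
    destruct (quad2_divides_square f2 f1 f0 1 A (fun z => g z * D ^ 2) H2 Hd HA3) as (Q & HQ & eQ);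
      [poly_tac | exact EA |].
    assert (pQ : poly Q) by (exists 1%nat; exact HQ).
    destruct HQ as (k & Q0 & HQ0 & e).
    exists k. intro z.
    assert (EK : forall z, f z * Q z ^ 2 - g z * D ^ 2 = 0).
    { apply (poly_cancel f (fun z => f z * Q z ^ 2 - g z * D ^ 2)); [assumption | poly_tac | exact H1 |].
      intro y. specialize (EA y). rewrite eQ in EA. fold f in EA.
      replace (f y * (f y * Q y ^ 2 - g y * D ^ 2)) with
        ((f y * Q y) ^ 2 - f y * (g y * D ^ 2)) by ring. rewrite EA. ring. }
    specialize (EK z). rewrite e, HQ0 in EK. replace (k + z * 0) with k in EK by ring. lra.
Qed.

(** * The four quadrilaterals around a face *)

Definition ch (x : R) : R := sqrt (1 + x ^ 2).
(** [hb p (sinh u) = cosh u + p sinh u] *)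
Definition hb (p x : R) : R := ch x + p * x.

Lemma ch_sq x : ch x ^ 2 = 1 + x ^ 2.
Proof. unfold ch. rewrite pow2_sqrt; nra. Qed.

Lemma ch_ge1 x : 1 <= ch x.
Proof. unfold ch. rewrite <- sqrt_1 at 1. apply sqrt_le_1; nra. Qed.

Lemma ch_unique s x : 0 <= s -> s ^ 2 - x ^ 2 = 1 -> s = ch x.
Proof. intros H E. unfold ch. replace (1 + x ^ 2) with (s ^ 2) by lra. rewrite sqrt_pow2; auto. Qed.

Lemma ch_opp x : ch (- x) = ch x.
Proof. unfold ch. f_equal. ring. Qed.

Lemma hb_opp p x : hb p (- x) = hb (- p) x.
Proof. unfold hb. rewrite ch_opp. ring. Qed.

Lemma ch_abs x : Rabs x < ch x.
Proof.
  assert (H := ch_sq x). assert (H1 := ch_ge1 x). assert (H2 := Rabs_pos x).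
  rewrite <- (pow2_abs x) in H. nra.
Qed.

(** For [Rabs p < 1] the function [hb p] has a turning point, where [x / ch x = - p]; the range
    [Rabs x < Rabs p] stays on one side of it. *)
Lemma hb_inj p x y : Rabs x < Rabs p -> Rabs y < Rabs p -> hb p x = hb p y -> x = y.
Proof.
  intros Hx Hy H. unfold hb in H.
  assert (cx := ch_sq x). assert (cy := ch_sq y). assert (gx := ch_ge1 x). assert (gy := ch_ge1 y).
  assert (E : (x - y) * ((x + y) + p * (ch x + ch y)) = 0).
  { transitivity ((ch x - ch y) * (ch x + ch y) + p * (x - y) * (ch x + ch y)).
    2:{ transitivity ((ch x + ch y) * ((ch x + p * x) - (ch y + p * y))); [ring | rewrite H; ring]. }
    transitivity (ch x ^ 2 - ch y ^ 2 + p * (x - y) * (ch x + ch y)); [rewrite cx, cy; ring | ring]. }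
  destruct (Rmult_integral _ _ E) as [E'|E']; [lra|]. exfalso.
  assert (Hs : Rabs (x + y) < Rabs p * (ch x + ch y)).
  { eapply Rle_lt_trans; [apply Rabs_triang|]. pose proof (Rabs_pos x). pose proof (Rabs_pos y). nra. }
  replace (x + y) with (- (p * (ch x + ch y))) in Hs by lra.
  rewrite Rabs_Ropp, Rabs_mult, (Rabs_pos_eq (ch x + ch y)) in Hs by lra. lra.
Qed.

(** Eliminates [x]: with [X = hb p x] and [Y = hb (- q) x] one has [(p + q) * ch x = q X + p Y] and
    [(p + q) * x = X - Y], and these are inserted into [ch x ^ 2 - x ^ 2 = 1]. *)
Lemma hb_conic p q x :
  (q ^ 2 - 1) * hb p x ^ 2 + 2 * (p * q + 1) * hb p x * hb (- q) x + (p ^ 2 - 1) * hb (- q) x ^ 2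
  = (p + q) ^ 2.
Proof.
  unfold hb. assert (H := ch_sq x).
  transitivity ((p + q) ^ 2 * (ch x ^ 2 - x ^ 2)); [ring|]. rewrite H. ring.
Qed.

(** Both factor pairs lie on conics given by [hb_conic]. A point of the first inserted into the
    second conic gives [x * (x * X + Y * ch x) = 0]; letting [x] tend to 0 gives [Y = 0], then
    [X = 0], and these two equations identify the parameters. *)
Lemma same_hyperbola p q p' q' : 0 < p -> 0 < q -> 0 < p' -> 0 < q' ->
  (forall eps, 0 < eps -> exists x y, x <> 0 /\ Rabs x < eps /\
     hb p x = hb p' y /\ hb (- q) x = hb (- q') y) ->
  p = p' /\ q = q'.
Proof.
  intros p0 q0 p0' q0' H.
  set (X := (p' + q') ^ 2 + (q' * p - p' * q) ^ 2 - (p + q) ^ 2).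
  set (Y := 2 * (p' + q') * (q' * p - p' * q)).
  assert (K : forall eps, 0 < eps -> exists x, x <> 0 /\ Rabs x < eps /\ x * X + Y * ch x = 0).
  { intros eps e0. destruct (H eps e0) as (x & y & x0 & xe & E1 & E2).
    exists x. repeat split; try assumption.
    apply Rmult_eq_reg_l with x; [|assumption].
    assert (C := hb_conic p' q' y). rewrite <- E1, <- E2 in C. unfold hb in C.
    assert (S := ch_sq x). unfold X, Y.
    transitivity (((q' ^ 2 - 1) * (ch x + p * x) ^ 2 + 2 * (p' * q' + 1) * (ch x + p * x) * (ch x + - q * x) +
      (p' ^ 2 - 1) * (ch x + - q * x) ^ 2 - (p' + q') ^ 2) + (p' + q') ^ 2 * (1 + x ^ 2 - ch x ^ 2)); [ring|].
    rewrite C, S. ring. }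
  assert (Y0 : Y = 0).
  { apply NNPP. intro HY. assert (HY' := Rabs_pos_lt _ HY).
    assert (HX := Rabs_pos X).
    destruct (K (Rabs Y / (Rabs X + 1))) as (x & x0 & xe & E); [apply Rdiv_lt_0_compat; lra|].
    assert (Rabs (x * X) = Rabs (Y * ch x)) by (replace (x * X) with (- (Y * ch x)) by lra; apply Rabs_Ropp).
    rewrite !Rabs_mult, (Rabs_pos_eq (ch x)) in H0 by (pose proof (ch_ge1 x); lra).
    assert (F : Rabs x * (Rabs X + 1) < Rabs Y).
    { apply Rmult_lt_compat_r with (r := Rabs X + 1) in xe; [|lra].
      replace (Rabs Y / (Rabs X + 1) * (Rabs X + 1)) with (Rabs Y) in xe by (field; lra). exact xe. }
    pose proof (ch_ge1 x). pose proof (Rabs_pos x). nra. }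
  destruct (K 1) as (x & x0 & _ & E); [lra|]. rewrite Y0 in E.
  assert (X0 : X = 0). { apply Rmult_eq_reg_l with x; [lra | assumption]. }
  unfold Y in Y0. apply Rmult_integral in Y0. destruct Y0 as [Y0|Y0]; [lra|].
  unfold X in X0. rewrite Y0 in X0.
  assert (E2 : (p' + q' - (p + q)) * (p' + q' + (p + q)) = 0) by nra.
  apply Rmult_integral in E2. destruct E2 as [E2|E2]; [|lra].
  assert ((p + q) * (p - p') = 0) by nra.
  apply Rmult_integral in H0. destruct H0; lra.
Qed.

Lemma near1_exp (P : R -> Prop) :
  (forall eps, 0 < eps -> exists x, x <> 0 /\ Rabs x < eps /\ P ((ch x + x) ^ 2)) -> near1 P.
Proof.
  (* For [Rabs x < 1] one has [ch x <= 2], so [z - 1 = 2 * x * (ch x + x)] is at most [6 * Rabs x]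
     in absolute value; hence the 6. *)
  intros H eps e0. destruct (H (Rmin 1 (eps / 6))) as (x & x0 & xe & Px); [apply Rmin_pos; lra|].
  assert (x1 := Rmin_l 1 (eps / 6)). assert (x2 := Rmin_r 1 (eps / 6)).
  exists ((ch x + x) ^ 2). assert (S := ch_sq x). assert (A := ch_abs x). assert (G := ch_ge1 x).
  assert (E : (ch x + x) ^ 2 - 1 = 2 * x * (ch x + x)).
  { transitivity (ch x ^ 2 + 2 * ch x * x + x ^ 2 - 1); [ring | rewrite S; ring]. }
  assert (W : 0 < ch x + x). { assert (B := Rle_abs (- x)). rewrite Rabs_Ropp in B. lra. }
  repeat split; [ | | assumption].
  - intro F. rewrite F in E. assert (E' : x * (ch x + x) = 0) by lra.
    apply Rmult_integral in E'. destruct E'; [contradiction | lra].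
  - rewrite E, !Rabs_mult, (Rabs_pos_eq 2), (Rabs_pos_eq (ch x + x)) by lra.
    assert (B := Rle_abs x). assert (C : ch x <= 2).
    { rewrite <- (pow2_abs x) in S. pose proof (Rabs_pos x).
      assert (X1 : Rabs x < 1) by lra. clear - S X1 H0 G. nra. }
    pose proof (Rabs_pos x). nra.
Qed.

Lemma ch_exp x : 2 * (ch x + x) * ch x = (ch x + x) ^ 2 + 1.
Proof. assert (H := ch_sq x). lra. Qed.

Lemma sh_exp x : 2 * (ch x + x) * x = (ch x + x) ^ 2 - 1.
Proof. assert (H := ch_sq x). lra. Qed.

Lemma hb_exp p x : (ch x + x) * hb p x = ((1 + p) * (ch x + x) ^ 2 + (1 - p)) / 2.
Proof.
  unfold hb. assert (A := ch_exp x). assert (B := sh_exp x).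
  transitivity ((2 * (ch x + x) * ch x + p * (2 * (ch x + x) * x)) / 2); [field | rewrite A, B; field].
Qed.

(** With [x = sinh u], the expression [x + p * ch x] is the derivative of [hb p x] with respect to
    [u]. Its square is a polynomial in [hb p x], which is the source of the radicals. *)
Lemma dhb_sq p x : (x + p * ch x) ^ 2 = hb p x ^ 2 + (p ^ 2 - 1).
Proof.
  unfold hb. assert (H := ch_sq x).
  transitivity ((ch x + p * x) ^ 2 + (p ^ 2 - 1) * (ch x ^ 2 - x ^ 2)); [ring | rewrite H; ring].
Qed.

(** The second factor of a quadrilateral is a combination of the first and its derivative in [u], so
    passing from one edge to the adjacent one costs a single square root. *)
Lemma hb_other p q x : p ^ 2 - 1 <> 0 ->
  hb (- q) x = (p + q) / (p ^ 2 - 1) * (x + p * ch x) - (p * q + 1) / (p ^ 2 - 1) * hb p x.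
Proof. intro H. unfold hb. field. assumption. Qed.

(** Configurations of the four quadrilaterals around a common face: the factors of the four shared edges agree. *)
Definition blk (p1 p2 p3 p4 q1 q2 q3 q4 t1 t2 t3 t4 : R) : Prop :=
  hb p1 t1 = hb p4 t4 /\ hb (- q1) t1 = hb (- q2) t2 /\
  hb p2 t2 = hb p3 t3 /\ hb (- q4) t4 = hb (- q3) t3.

Lemma sq_neq1 p : 0 < p -> p <> 1 -> p ^ 2 - 1 <> 0.
Proof.
  intros H0 H1 E. assert (F : (p - 1) * (p + 1) = 0) by lra.
  apply Rmult_integral in F. destruct F; lra.
Qed.

Lemma sq_neq p q : 0 < p -> 0 < q -> p <> q -> p ^ 2 - q ^ 2 <> 0.
Proof.
  intros H0 H1 H2 E. assert (F : (p - q) * (p + q) = 0) by lra.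
  apply Rmult_integral in F. destruct F; lra.
Qed.

(** After multiplication by [w], both factors of the first quadrilateral are linear in [z = w^2].
    Quadrilaterals 2 and 4 contribute one radical each, and [hb_conic] of quadrilateral 3 relates
    the two radicals. The inequalities between the parameters say that the discriminants
    [(q2^2 - 1) * (q2^2 - q1^2)] and [(p4^2 - 1) * (p4^2 - p1^2)], up to factors nonzero anyway, do
    not vanish. *)
Lemma blk_two_radicals p1 p2 p3 p4 q1 q2 q3 q4 :
  0 < p1 -> 0 < p2 -> 0 < p3 -> 0 < p4 -> 0 < q1 -> 0 < q2 -> 0 < q3 -> 0 < q4 ->
  p4 <> 1 -> p4 <> p1 -> q2 <> 1 -> q2 <> q1 ->
  (forall eps, 0 < eps -> exists t1 t2 t3 t4, t1 <> 0 /\ Rabs t1 < eps /\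
     blk p1 p2 p3 p4 q1 q2 q3 q4 t1 t2 t3 t4) -> False.
Proof.
  intros P1 P2 P3 P4 Q1 Q2 Q3 Q4 n4 n41 n2 n21 H.
  assert (N4 := sq_neq1 _ P4 n4). assert (N2 := sq_neq1 _ Q2 n2).
  assert (N41 := sq_neq _ _ P4 P1 n41). assert (N21 := sq_neq _ _ Q2 Q1 n21).
  (* The coefficients of [hb_other] for quadrilateral 2 ([mu], [nu]) and for quadrilateral 4 ([m],
     [n]). *)
  set (mu := (q2 + p2) / (q2 ^ 2 - 1)). set (nu := - ((q2 * p2 + 1) / (q2 ^ 2 - 1))).
  set (m := (p4 + q4) / (p4 ^ 2 - 1)). set (n := - ((p4 * q4 + 1) / (p4 ^ 2 - 1))).
  set (al := fun z : R => ((1 - p1) * z + (1 + p1)) / 2).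
  set (ga := fun z : R => ((1 + q1) * z + (1 - q1)) / 2).
  set (f2 := (1 + q1) ^ 2 / 4). set (f1 := (1 - q1 ^ 2) / 2 + q2 ^ 2 - 1). set (f0 := (1 - q1) ^ 2 / 4).
  set (g2 := (1 - p1) ^ 2 / 4). set (g1 := (1 - p1 ^ 2) / 2 + p4 ^ 2 - 1). set (g0 := (1 + p1) ^ 2 / 4).
  assert (Ef : forall z, quad2 f2 f1 f0 z = ga z ^ 2 + (q2 ^ 2 - 1) * z)
    by (intro z; unfold quad2, f2, f1, f0, ga; field).
  assert (Eg : forall z, quad2 g2 g1 g0 z = al z ^ 2 + (p4 ^ 2 - 1) * z)
    by (intro z; unfold quad2, g2, g1, g0, al; field).
  set (D := 2 * (p3 * q3 + 1) * mu * m).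
  assert (Hmu : mu <> 0) by (unfold mu; apply Rmult_integral_contrapositive_currified;
    [lra | apply Rinv_neq_0_compat; assumption]).
  assert (Hm : m <> 0) by (unfold m; apply Rmult_integral_contrapositive_currified;
    [lra | apply Rinv_neq_0_compat; assumption]).
  assert (HD : D <> 0).
  { unfold D. do 2 (apply Rmult_integral_contrapositive_currified; [|assumption]).
    apply Rgt_not_eq. nra. }
  assert (Hf2 : 0 < f2) by (unfold f2; nra).
  destruct (two_radicals f2 f1 f0 g2 g1 g0
    (fun z => (q3 ^ 2 - 1) * (mu ^ 2 * quad2 f2 f1 f0 z + nu ^ 2 * ga z ^ 2)
      + 2 * (p3 * q3 + 1) * nu * n * ga z * al z
      + (p3 ^ 2 - 1) * (m ^ 2 * quad2 g2 g1 g0 z + n ^ 2 * al z ^ 2) - (p3 + q3) ^ 2 * z)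
    ((q3 ^ 2 - 1) * mu * nu * (1 + q1) + (p3 * q3 + 1) * mu * n * (1 - p1))
    ((q3 ^ 2 - 1) * mu * nu * (1 - q1) + (p3 * q3 + 1) * mu * n * (1 + p1))
    (fun z => 2 * (p3 * q3 + 1) * nu * m * ga z + 2 * (p3 ^ 2 - 1) * m * n * al z) D) as [E|[k E]].
  - lra.
  - unfold f2, f1, f0.
    replace (((1 - q1 ^ 2) / 2 + q2 ^ 2 - 1) ^ 2 - 4 * ((1 + q1) ^ 2 / 4) * ((1 - q1) ^ 2 / 4))
      with ((q2 ^ 2 - 1) * (q2 ^ 2 - q1 ^ 2)) by field.
    apply Rmult_integral_contrapositive_currified; assumption.
  - rewrite Ef. unfold ga. nra.
  - exact HD.
  - assert (L : forall u v, ispoly 2 (fun z => (u * z + v) / 2)).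
    { intros u v. exists (v / 2), (fun _ => u / 2). split; [|intro; field].
      exists (u / 2), (fun _ => 0). split; [intro; reflexivity | intro; ring]. }
    assert (La : ispoly 2 al) by apply L. assert (Lg : ispoly 2 ga) by apply L.
    (* [ispoly_mul] would only give the bound 4. The sharp bound 3 is what makes the quotient by a
       quadratic constant in [two_radicals]. *)
    assert (X : forall A B, ispoly 2 A -> ispoly 2 B -> ispoly 3 (fun z => A z * B z)).
    { intros A B (c & A' & HA & eA) HB.
      apply ispoly_ext with (fun z => c * B z + z * (A' z * B z)); [|intro z; rewrite eA; ring].
      apply ispoly_add; [apply ispoly_S, ispoly_scale, HB|].
      exists 0, (fun z => A' z * B z). split; [|intro; ring].
      destruct HA as (d & A'' & HA & eA'). apply ispoly_ext with (fun z => d * B z).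
      - apply ispoly_scale, HB.
      - intro z. rewrite eA', HA. ring. }
    assert (I : ispoly 3 (fun z => z)).
    { apply ispoly_S. apply ispoly_ext with (fun z => (2 * z + 0) / 2); [apply L | intro; field]. }
    apply ispoly_ext with (fun z => ((q3 ^ 2 - 1) * (mu ^ 2 + nu ^ 2)) * (ga z * ga z)
      + ((2 * (p3 * q3 + 1) * nu * n) * (ga z * al z)
      + (((p3 ^ 2 - 1) * (m ^ 2 + n ^ 2)) * (al z * al z)
      + ((q3 ^ 2 - 1) * mu ^ 2 * (q2 ^ 2 - 1) + (p3 ^ 2 - 1) * m ^ 2 * (p4 ^ 2 - 1) - (p3 + q3) ^ 2) * z))).
    2:{ intro z. rewrite Ef, Eg. ring. }
    repeat apply ispoly_add; apply ispoly_scale; auto.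
  - unfold al, ga. poly_tac.
  - apply near1_exp. intros eps e0. destruct (H eps e0) as (t1 & t2 & t3 & t4 & t0 & te & B1 & B2 & B3 & B4).
    (* The sign is reversed so that the leading coefficient [f2 = (1 + q1)^2 / 4] cannot vanish;
       with [t1] it would be [(1 - q1)^2 / 4]. *)
    exists (- t1). split; [lra|]. split; [rewrite Rabs_Ropp; assumption|].
    set (w := ch (- t1) + - t1).
    assert (Ea : w * hb p4 t4 = al (w ^ 2)).
    { rewrite <- B1, <- (Ropp_involutive p1), <- hb_opp. unfold w. rewrite hb_exp. unfold al. field. }
    assert (Ec : w * hb (- q2) t2 = ga (w ^ 2)).
    { rewrite <- B2, <- hb_opp. unfold w. rewrite hb_exp. unfold ga. field. }
    exists (w * (- t2 + q2 * ch (- t2))), (w * (t4 + p4 * ch t4)).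
    assert (Eb : hb p2 t2 = mu * (- t2 + q2 * ch (- t2)) + nu * hb (- q2) t2).
    { replace (hb p2 t2) with (hb (- p2) (- t2)) by (rewrite hb_opp; f_equal; ring).
      rewrite <- (hb_opp q2 t2), (hb_other q2 p2 (- t2) N2).
      unfold mu, nu. field. assumption. }
    assert (Ed : hb (- q4) t4 = m * (t4 + p4 * ch t4) + n * hb p4 t4).
    { rewrite (hb_other p4 q4 t4 N4). unfold m, n. field. assumption. }
    repeat split.
    + rewrite Rpow_mult_distr, dhb_sq, Ef, <- Ec, (hb_opp q2 t2). ring.
    + rewrite Rpow_mult_distr, dhb_sq, Eg, <- Ea. ring.
    (* The relation sought is the conic of quadrilateral 3 multiplied by [w ^ 2], with the factors
       of its shared edges expressed through [T] and [S]. *)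
    + assert (E := hb_conic p3 q3 t3). rewrite <- B3, <- B4, Eb, Ed in E.
      set (T := - t2 + q2 * ch (- t2)) in *. set (S := t4 + p4 * ch t4) in *.
      assert (HT : T ^ 2 = hb (- q2) t2 ^ 2 + (q2 ^ 2 - 1)) by (unfold T; rewrite dhb_sq, hb_opp; reflexivity).
      assert (HS : S ^ 2 = hb p4 t4 ^ 2 + (p4 ^ 2 - 1)) by apply dhb_sq.
      rewrite Ef, Eg, <- Ea, <- Ec.
      assert (al_ : (1 - p1) * w ^ 2 + (1 + p1) = 2 * (w * hb p4 t4)) by (rewrite Ea; unfold al; field).
      assert (ga_ : (1 + q1) * w ^ 2 + (1 - q1) = 2 * (w * hb (- q2) t2)) by (rewrite Ec; unfold ga; field).
      set (a := hb p4 t4) in *. set (c := hb (- q2) t2) in *.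
      transitivity (w ^ 2 * ((q3 ^ 2 - 1) * (mu ^ 2 * (c ^ 2 + (q2 ^ 2 - 1)) + nu ^ 2 * c ^ 2)
        + 2 * (p3 * q3 + 1) * nu * n * c * a
        + (p3 ^ 2 - 1) * (m ^ 2 * (a ^ 2 + (p4 ^ 2 - 1)) + n ^ 2 * a ^ 2) - (p3 + q3) ^ 2)
        + ((q3 ^ 2 - 1) * mu * nu * ((1 + q1) * w ^ 2 + (1 - q1))
          + (p3 * q3 + 1) * mu * n * ((1 - p1) * w ^ 2 + (1 + p1))) * (w * T)
        + (2 * (p3 * q3 + 1) * nu * m * (w * c) + 2 * (p3 ^ 2 - 1) * m * n * (w * a)) * (w * S)
        + D * (w * T) * (w * S)); [ring|].
      rewrite al_, ga_, <- HT, <- HS. unfold D.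
      transitivity (w ^ 2 * ((q3 ^ 2 - 1) * (mu * T + nu * c) ^ 2 +
        2 * (p3 * q3 + 1) * (mu * T + nu * c) * (m * S + n * a) + (p3 ^ 2 - 1) * (m * S + n * a) ^ 2
        - (p3 + q3) ^ 2)); [ring | rewrite E; ring].
  - apply (Rmult_integral_contrapositive_currified _ _ N4 N41).
    rewrite <- E. unfold g2, g1, g0. field.
  - (* Proportional radicands are excluded by their extreme coefficients. *)
    assert (E0 := E 0). assert (E1 := E 1). assert (E2 := E (-1)).
    unfold quad2 in E0, E1, E2.
    assert (F0 : f0 * k ^ 2 = g0 * D ^ 2) by lra.
    assert (F2 : f2 * k ^ 2 = g2 * D ^ 2) by lra.
    assert (G : f0 * g2 = f2 * g0).
    { apply Rmult_eq_reg_r with (D ^ 2); [|apply pow_nonzero; assumption].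
      replace (f0 * g2 * D ^ 2) with (f0 * (g2 * D ^ 2)) by ring. rewrite <- F2.
      replace (f2 * g0 * D ^ 2) with (f2 * (g0 * D ^ 2)) by ring. rewrite <- F0. ring. }
    unfold f0, f2, g0, g2 in G.
    assert (G' : ((1 - q1) * (1 - p1) - (1 + q1) * (1 + p1)) * ((1 - q1) * (1 - p1) + (1 + q1) * (1 + p1)) = 0) by lra.
    assert (0 < q1 * p1) by (apply Rmult_lt_0_compat; assumption).
    apply Rmult_integral in G'. destruct G'; lra.
Qed.

(** If quadrilateral 2 is rational in [z], only the radical of quadrilateral 4 remains and its
    coefficient in the conic of quadrilateral 3 must vanish. This makes the factors [hb p2 t2] and
    [hb p1 t1] proportional, and at rest both are 1. *)
Lemma blk_rational p1 p2 p3 p4 q1 q2 q3 q4 ka be :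
  0 < p1 -> 0 < p3 -> 0 < p4 -> 0 < q3 -> 0 < q4 -> p4 <> 1 -> p4 <> p1 ->
  poly ka -> poly be -> ka 1 <> 0 -> be 1 = ka 1 ->
  (forall eps, 0 < eps -> exists t1 t2 t3 t4, t1 <> 0 /\ Rabs t1 < eps /\
     blk p1 p2 p3 p4 q1 q2 q3 q4 t1 t2 t3 t4 /\
     (ch t1 + t1) * hb p2 t2 * ka ((ch t1 + t1) ^ 2) = be ((ch t1 + t1) ^ 2)) ->
  forall z, be z = ka z * (((1 + p1) * z + (1 - p1)) / 2).
Proof.
  intros P1 P3 P4 Q3 Q4 n4 n41 pk pb k1 b1 H.
  assert (N4 := sq_neq1 _ P4 n4). assert (N41 := sq_neq _ _ P4 P1 n41).
  set (m := (p4 + q4) / (p4 ^ 2 - 1)). set (n := - ((p4 * q4 + 1) / (p4 ^ 2 - 1))).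
  set (al := fun z : R => ((1 + p1) * z + (1 - p1)) / 2).
  assert (pa : poly al) by (unfold al; poly_tac).
  set (g2 := (1 + p1) ^ 2 / 4). set (g1 := (1 - p1 ^ 2) / 2 + p4 ^ 2 - 1). set (g0 := (1 - p1) ^ 2 / 4).
  assert (Eg : forall z, quad2 g2 g1 g0 z = al z ^ 2 + (p4 ^ 2 - 1) * z)
    by (intro z; unfold quad2, g2, g1, g0, al; field).
  assert (Hm : m <> 0) by (unfold m; apply Rmult_integral_contrapositive_currified;
    [lra | apply Rinv_neq_0_compat; assumption]).
  assert (pg := poly_quad2 g2 g1 g0).
  set (V := fun z => (p3 * q3 + 1) * be z + (p3 ^ 2 - 1) * n * ka z * al z).
  assert (pV : poly V) by (unfold V; poly_tac).
  destruct (sqrt_quad2_irrational_near g2 g1 g0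
    (fun z => (q3 ^ 2 - 1) * be z ^ 2 + 2 * (p3 * q3 + 1) * n * be z * ka z * al z
      + (p3 ^ 2 - 1) * ka z ^ 2 * (m ^ 2 * quad2 g2 g1 g0 z + n ^ 2 * al z ^ 2) - (p3 + q3) ^ 2 * ka z ^ 2 * z)
    (fun z => 2 * m * ka z * V z)) as [_ HV].
  - unfold g2. nra.
  - replace (g1 ^ 2 - 4 * g2 * g0) with ((p4 ^ 2 - 1) * (p4 ^ 2 - p1 ^ 2)) by (unfold g2, g1, g0; field).
    apply Rmult_integral_contrapositive_currified; assumption.
  - rewrite Eg. unfold al. nra.
  - poly_tac.
  - poly_tac.
  - apply near1_exp. intros eps e0.
    destruct (H eps e0) as (t1 & t2 & t3 & t4 & t0 & te & (B1 & B2 & B3 & B4) & HB).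
    exists t1. split; [assumption|]. split; [assumption|].
    set (w := ch t1 + t1) in *.
    assert (Ea : w * hb p4 t4 = al (w ^ 2)) by (rewrite <- B1; unfold w; rewrite hb_exp; reflexivity).
    exists (w * (t4 + p4 * ch t4)). split.
    + rewrite Rpow_mult_distr, dhb_sq, Eg, <- Ea. ring.
    + assert (E := hb_conic p3 q3 t3). rewrite <- B3, <- B4, (hb_other p4 q4 t4 N4) in E.
      replace ((p4 + q4) / (p4 ^ 2 - 1) * (t4 + p4 * ch t4) - (p4 * q4 + 1) / (p4 ^ 2 - 1) * hb p4 t4)
        with (m * (t4 + p4 * ch t4) + n * hb p4 t4) in E by (unfold m, n; field; assumption).
      set (S := t4 + p4 * ch t4) in *.
      assert (HS : S ^ 2 = hb p4 t4 ^ 2 + (p4 ^ 2 - 1)) by apply dhb_sq.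
      unfold V. rewrite Eg, <- Ea, <- HB.
      set (a := hb p4 t4) in *. set (b := hb p2 t2) in *. set (k := ka (w ^ 2)) in *.
      transitivity (w ^ 2 * k ^ 2 * ((q3 ^ 2 - 1) * b ^ 2 + 2 * (p3 * q3 + 1) * b * (m * S + n * a)
        + (p3 ^ 2 - 1) * (m ^ 2 * (a ^ 2 + (p4 ^ 2 - 1)) + n ^ 2 * a ^ 2 + 2 * m * n * a * S)
        - (p3 + q3) ^ 2)); [ring|].
      rewrite <- HS, <- E. ring.
  - assert (V0 : forall z, V z = 0).
    { apply (poly_cancel ka); try assumption. intro z.
      apply Rmult_eq_reg_l with (2 * m); [|apply Rmult_integral_contrapositive_currified; lra].
      rewrite <- Rmult_assoc, HV. ring. }
    (* Evaluation at the rest position [z = 1], where [al] is 1 and [be] equals [ka], determines the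
       constant of proportionality. *)
    assert (V1 := V0 1). unfold V in V1. rewrite b1 in V1.
    replace (al 1) with 1 in V1 by (unfold al; field).
    assert (F : p3 * q3 + 1 + (p3 ^ 2 - 1) * n = 0).
    { apply Rmult_eq_reg_r with (ka 1); [|assumption]. lra. }
    intro z. specialize (V0 z). unfold V in V0.
    assert (P : 0 < p3 * q3 + 1) by (assert (0 < p3 * q3) by (apply Rmult_lt_0_compat; assumption); lra).
    apply Rmult_eq_reg_l with (p3 * q3 + 1); [|lra].
    fold (al z). replace ((p3 ^ 2 - 1) * n) with (- (p3 * q3 + 1)) in V0 by lra. lra.
Qed.

Definition blk_accum (p1 p2 p3 p4 q1 q2 q3 q4 : R) : Prop :=
  forall eps, 0 < eps -> exists t1 t2 t3 t4,
    (t1 <> 0 /\ t2 <> 0 /\ t3 <> 0 /\ t4 <> 0) /\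
    (Rabs t1 < eps /\ Rabs t2 < eps /\ Rabs t3 < eps /\ Rabs t4 < eps) /\
    blk p1 p2 p3 p4 q1 q2 q3 q4 t1 t2 t3 t4.

(** Once [hb p1 t1 = hb p2 t2], quadrilaterals 1 and 2 agree in two factors, so [same_hyperbola]
    identifies them; the same equality passes through the shared edges to quadrilaterals 4 and 3.
    The bound [d] leaves room for relations valid only near rest. *)
Lemma blk_equal_factors p1 p2 p3 p4 q1 q2 q3 q4 ka be d :
  0 < p1 -> 0 < p2 -> 0 < p3 -> 0 < p4 -> 0 < q1 -> 0 < q2 -> 0 < q3 -> 0 < q4 ->
  p4 <> 1 -> p4 <> p1 -> poly ka -> poly be -> ka 1 = 1 -> be 1 = 1 -> 0 < d ->
  (forall t1 t2 t3 t4, Rabs t1 < d -> Rabs t2 < d -> blk p1 p2 p3 p4 q1 q2 q3 q4 t1 t2 t3 t4 ->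
     (ch t1 + t1) * hb p2 t2 * ka ((ch t1 + t1) ^ 2) = be ((ch t1 + t1) ^ 2)) ->
  blk_accum p1 p2 p3 p4 q1 q2 q3 q4 ->
  p1 = p2 /\ q1 = q2 /\ p3 = p4 /\ q3 = q4.
Proof.
  intros P1 P2 P3 P4 Q1 Q2 Q3 Q4 n4 n41 pk pb k1 b1 d0 HB H.
  assert (E : forall z, be z = ka z * (((1 + p1) * z + (1 - p1)) / 2)).
  { apply (blk_rational p1 p2 p3 p4 q1 q2 q3 q4); try assumption; try lra.
    intros eps e0. destruct (H (Rmin eps d)) as (t1 & t2 & t3 & t4 & (z1 & _) & (s1 & s2 & _) & B);
      [apply Rmin_pos; assumption|].
    assert (m1 := Rmin_l eps d). assert (m2 := Rmin_r eps d).
    exists t1, t2, t3, t4. repeat split; try apply B; try assumption; [lra|].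
    apply (HB t1 t2 t3 t4); [lra | lra | exact B]. }
  destruct (poly_near1_pos ka pk) as (r & r0 & Hr); [lra|].
  assert (W : forall eps, 0 < eps -> exists t1 t2 t3 t4, (t1 <> 0 /\ t4 <> 0) /\
    (Rabs t1 < eps /\ Rabs t4 < eps) /\ blk p1 p2 p3 p4 q1 q2 q3 q4 t1 t2 t3 t4 /\ hb p1 t1 = hb p2 t2).
  { intros eps e0.
    (* Besides [eps] and [d], the bounds [1] and [r / 6] keep [z] within [r] of 1, so that [ka] does
       not vanish and can be cancelled. *)
    set (D := Rmin (Rmin eps d) (Rmin 1 (r / 6))).
    assert (D0 : 0 < D) by (repeat apply Rmin_pos; lra).
    assert (D1 : D <= eps /\ D <= d /\ D <= 1 /\ D <= r / 6).
    { unfold D. assert (u1 := Rmin_l (Rmin eps d) (Rmin 1 (r / 6))).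
      assert (u2 := Rmin_r (Rmin eps d) (Rmin 1 (r / 6))).
      assert (u3 := Rmin_l eps d). assert (u4 := Rmin_r eps d).
      assert (u5 := Rmin_l 1 (r / 6)). assert (u6 := Rmin_r 1 (r / 6)). lra. }
    destruct (H D D0) as (t1 & t2 & t3 & t4 & (z1 & z2 & z3 & z4) & (s1 & s2 & s3 & s4) & B).
    exists t1, t2, t3, t4. repeat split; try apply B; try assumption; try lra.
    assert (HB' := HB t1 t2 t3 t4 ltac:(lra) ltac:(lra) B). rewrite E in HB'.
    assert (S := ch_sq t1). assert (A := ch_abs t1). assert (G := ch_ge1 t1).
    assert (W : 0 < ch t1 + t1). { assert (U := Rle_abs (- t1)). rewrite Rabs_Ropp in U. lra. }
    assert (K : ka ((ch t1 + t1) ^ 2) <> 0).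
    { apply Hr. replace ((ch t1 + t1) ^ 2 - 1) with (2 * t1 * (ch t1 + t1)) by nra.
      rewrite !Rabs_mult, (Rabs_pos_eq 2), (Rabs_pos_eq (ch t1 + t1)) by lra.
      assert (U := Rle_abs t1). assert (T1 := Rabs_pos t1).
      assert (C : ch t1 <= 2). { assert (T1' : Rabs t1 < 1) by lra. rewrite <- (pow2_abs t1) in S. clear - S T1 T1' G. nra. }
      assert (Rabs t1 * (ch t1 + t1) <= Rabs t1 * 3) by (apply Rmult_le_compat_l; lra). lra. }
    rewrite <- hb_exp in HB'.
    apply Rmult_eq_reg_l with ((ch t1 + t1) * ka ((ch t1 + t1) ^ 2));
      [lra | apply Rmult_integral_contrapositive_currified; [lra | assumption]]. }
  destruct (same_hyperbola p1 q1 p2 q2 P1 Q1 P2 Q2) as [R1 R2].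
  { intros eps e0. destruct (W eps e0) as (t1 & t2 & t3 & t4 & (z1 & _) & (s1 & _) & (_ & B & _) & F).
    exists t1, t2. auto. }
  destruct (same_hyperbola p4 q4 p3 q3 P4 Q4 P3 Q3) as [R3 R4].
  { intros eps e0. destruct (W eps e0) as (t1 & t2 & t3 & t4 & (_ & z4) & (_ & s4) & (B1 & _ & B3 & B4) & F).
    exists t4, t3. repeat split; try assumption. congruence. }
  auto.
Qed.

(** Quadrilateral 2 is rational over quadrilateral 1 when [q2 = q1], since then [t2 = t1], and when
    [q2 = 1], since then its parametrization is. In all other cases two independent radicals occur,
    which is impossible. *)
Lemma blk_unequal_neq1 p1 p2 p3 p4 q1 q2 q3 q4 :
  0 < p1 -> 0 < p2 -> 0 < p3 -> 0 < p4 -> 0 < q1 -> 0 < q2 -> 0 < q3 -> 0 < q4 ->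
  p4 <> 1 -> p4 <> p1 -> blk_accum p1 p2 p3 p4 q1 q2 q3 q4 ->
  p1 = p2 /\ q1 = q2 /\ p3 = p4 /\ q3 = q4.
Proof.
  intros P1 P2 P3 P4 Q1 Q2 Q3 Q4 n4 n41 H.
  destruct (Req_dec q2 q1) as [E21|n21]; [|destruct (Req_dec q2 1) as [E2|n2]].
  - subst q2.
    apply (blk_equal_factors p1 p2 p3 p4 q1 q1 q3 q4 (fun _ => 1) (fun z => ((1 + p2) * z + (1 - p2)) / 2) q1);
      try assumption; try poly_tac; try lra.
    intros t1 t2 t3 t4 s1 s2 (_ & B & _).
    assert (F : t1 = t2).
    { apply (hb_inj (- q1)); rewrite ?Rabs_Ropp, ?(Rabs_pos_eq q1) by lra; assumption. }
    subst t2. cbv beta. rewrite hb_exp. field.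
  - subst q2.
    (* Here [ch t2 - t2], multiplied by [w], is the polynomial taken as [ka]; its reciprocal
       [ch t2 + t2] then equals [w / ka], which yields [be]. *)
    apply (blk_equal_factors p1 p2 p3 p4 q1 1 q3 q4 (fun z => ((1 - q1) * z + (1 + q1)) / 2)
      (fun z => ((1 + p2) * z + (1 - p2) * (((1 - q1) * z + (1 + q1)) / 2) ^ 2) / 2) 1);
      try assumption; try poly_tac; try lra.
    intros t1 t2 t3 t4 s1 s2 (_ & B & _).
    assert (F := hb_exp (- q1) t1). rewrite B in F.
    replace (((1 + - q1) * (ch t1 + t1) ^ 2 + (1 - - q1)) / 2)
      with (((1 - q1) * (ch t1 + t1) ^ 2 + (1 + q1)) / 2) in F by field.
    cbv beta. rewrite <- F. unfold hb. assert (S := ch_sq t2). set (w := ch t1 + t1).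
    transitivity (w ^ 2 * ((1 + p2) * (ch t2 ^ 2 - t2 ^ 2) + (1 - p2) * (ch t2 + -1 * t2) ^ 2) / 2); [field|].
    rewrite S. field.
  - exfalso. apply (blk_two_radicals p1 p2 p3 p4 q1 q2 q3 q4); try assumption.
    intros eps e0. destruct (H eps e0) as (t1 & t2 & t3 & t4 & (z1 & _) & (s1 & _) & B).
    exists t1, t2, t3, t4. auto.
Qed.

(** If [p4 = 1], then [p1 <> 1], and the block reflected by exchanging 1 with 4 and 2 with 3
    satisfies the stronger hypotheses. *)
Lemma blk_unequal p1 p2 p3 p4 q1 q2 q3 q4 :
  0 < p1 -> 0 < p2 -> 0 < p3 -> 0 < p4 -> 0 < q1 -> 0 < q2 -> 0 < q3 -> 0 < q4 ->
  p4 <> p1 -> blk_accum p1 p2 p3 p4 q1 q2 q3 q4 ->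
  p1 = p2 /\ q1 = q2 /\ p3 = p4 /\ q3 = q4.
Proof.
  intros P1 P2 P3 P4 Q1 Q2 Q3 Q4 n41 H.
  destruct (Req_dec p4 1) as [E4|n4]; [|apply blk_unequal_neq1; assumption].
  destruct (blk_unequal_neq1 p4 p3 p2 p1 q4 q3 q2 q1) as (A & B & C & D); try assumption; try lra.
  intros eps e0. destruct (H eps e0) as (t1 & t2 & t3 & t4 & (z1 & z2 & z3 & z4) & (s1 & s2 & s3 & s4) & B1 & B2 & B3 & B4).
  exists t4, t3, t2, t1. unfold blk. auto 10.
Qed.

(** * Grids of quadrilaterals with common edge factors *)

Definition inside (M N i j : nat) : Prop := (1 <= i <= M /\ 1 <= j <= N)%nat.

(** The inverses occur because the shared edge is the one with factor [s + p u] for the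
    quadrilateral before it and the one with factor [s + u / p] for the quadrilateral after it;
    similarly for [q], with a minus sign. *)
Definition grid_config (M N : nat) (p q tau : nat -> nat -> R) : Prop :=
  (forall i j, inside M N i j -> inside M N (S i) j ->
     hb (p i j) (tau i j) = hb (/ p (S i) j) (tau (S i) j)) /\
  (forall i j, inside M N i j -> inside M N i (S j) ->
     hb (- q i j) (tau i j) = hb (- / q i (S j)) (tau i (S j))).

(** All that is kept of a nontrivial deformation: configurations arbitrarily close to rest in which
    no vertex is at rest. *)
Definition grid_accum (M N : nat) (p q : nat -> nat -> R) : Prop :=
  forall eps, 0 < eps -> exists tau, grid_config M N p q tau /\
    forall i j, inside M N i j -> tau i j <> 0 /\ Rabs (tau i j) < eps.

Definition grid_pos (M N : nat) (p q : nat -> nat -> R) : Prop :=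
  forall i j, inside M N i j -> 0 < p i j /\ 0 < q i j.

(** Reflection in the common edge exchanges the edges with factors [s - q u] and [s - u / q] and
    keeps the other two. So [q] is inverted and [p] is kept. *)
Definition mirror (p q : nat -> nat -> R) (i j : nat) : Prop :=
  p i j = p i (S j) /\ q i j * q i (S j) = 1.

Lemma inv_of_mul_eq1 x y : x * y = 1 -> / y = x.
Proof. intro H. assert (y <> 0) by (intro E; subst; lra). apply Rmult_eq_reg_r with y; [|assumption]. rewrite H. field. assumption. Qed.

Lemma mul_of_eq_inv x y : 0 < y -> x = / y -> x * y = 1.
Proof. intros H ->. field. lra. Qed.

Lemma grid_block M N p q i j : grid_pos M N p q -> grid_accum M N p q ->
  inside M N i j -> inside M N (S i) (S j) ->
  p i j * p (S i) j <> 1 \/ p i (S j) * p (S i) (S j) <> 1 ->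
  mirror p q i j /\ mirror p q (S i) j.
Proof.
  intros HP HA H1 H2 Hne.
  assert (H3 : inside M N (S i) j) by (unfold inside in *; lia).
  assert (H4 : inside M N i (S j)) by (unfold inside in *; lia).
  destruct (HP _ _ H1) as [p1 q1]. destruct (HP _ _ H2) as [p3 q3].
  destruct (HP _ _ H3) as [p4 q4]. destruct (HP _ _ H4) as [p2 q2].
  assert (X : p i j = p i (S j) /\ q i j = / q i (S j) /\ / p (S i) (S j) = / p (S i) j /\
              / q (S i) (S j) = q (S i) j).
  { destruct Hne as [Hne|Hne].
    - apply blk_unequal; try assumption; try (apply Rinv_0_lt_compat; assumption).
      + intro E. apply Hne. rewrite <- E. field. lra.
      + intros eps e0. destruct (HA eps e0) as (tau & (C1 & C2) & HT).
        exists (tau i j), (tau i (S j)), (tau (S i) (S j)), (tau (S i) j).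
        unfold blk. repeat split; try (apply HT; assumption); [apply C1 | apply C2 | apply C1 | apply C2]; assumption.
    (* The inequality may occur in the second row of the block only; then the two rows are
       exchanged. *)
    - destruct (blk_unequal (p i (S j)) (p i j) (/ p (S i) j) (/ p (S i) (S j))
        (/ q i (S j)) (q i j) (q (S i) j) (/ q (S i) (S j))) as (A & B & C & D);
        try assumption; try (apply Rinv_0_lt_compat; assumption).
      + intro E. apply Hne. rewrite <- E. field. lra.
      + intros eps e0. destruct (HA eps e0) as (tau & (C1 & C2) & HT).
        exists (tau i (S j)), (tau i j), (tau (S i) j), (tau (S i) (S j)).
        unfold blk. repeat split; try (apply HT; assumption); [ | symmetry | | symmetry]; [apply C1 | apply C2 | apply C1 | apply C2]; assumption.
      + auto. }
  destruct X as (A & B & C & D). unfold mirror. repeat split.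
  - exact A.
  - apply mul_of_eq_inv; assumption.
  - rewrite <- (Rinv_inv (p (S i) j)), <- C, Rinv_inv. reflexivity.
  - apply mul_of_eq_inv; [assumption | symmetry; assumption].
Qed.

(** For mirror images the condition on the shared edge compares one and the same function
    [hb (- q i j)] at two parameters, and below [q i j] that function is injective. *)
Lemma grid_mirror_sync M N p q i j : grid_pos M N p q -> grid_accum M N p q ->
  inside M N i j -> inside M N i (S j) -> mirror p q i j ->
  forall eps, 0 < eps -> exists tau, grid_config M N p q tau /\ tau i j = tau i (S j) /\
    forall i j, inside M N i j -> tau i j <> 0 /\ Rabs (tau i j) < eps.
Proof.
  intros HP HA H1 H2 [Ep Eq] eps e0. destruct (HP _ _ H1) as [p1 q1].
  destruct (HA (Rmin eps (q i j))) as (tau & HC & HT); [apply Rmin_pos; assumption|].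
  exists tau. split; [exact HC|]. split.
  - assert (B := proj2 HC i j H1 H2). rewrite (inv_of_mul_eq1 _ _ Eq) in B.
    assert (m := Rmin_r eps (q i j)).
    apply (hb_inj (- q i j)); [| | exact B]; rewrite Rabs_Ropp, (Rabs_pos_eq (q i j)) by lra.
    + destruct (HT _ _ H1). lra.
    + destruct (HT _ _ H2). lra.
  - intros i' j' H. destruct (HT _ _ H) as [T0 T1]. split; [assumption|].
    assert (m := Rmin_l eps (q i j)). lra.
Qed.

(** By synchronization the two mirror images pass equal factors to their neighbours. These
    neighbours also share an edge, so they agree in two factors and are mirror images themselves. *)
Lemma grid_mirror_right M N p q i j : grid_pos M N p q -> grid_accum M N p q ->
  inside M N i j -> inside M N (S i) (S j) -> mirror p q i j -> mirror p q (S i) j.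
Proof.
  intros HP HA H1 H2 HM.
  assert (H3 : inside M N (S i) j) by (unfold inside in *; lia).
  assert (H4 : inside M N i (S j)) by (unfold inside in *; lia).
  destruct (HP _ _ H1) as [p1 q1]. destruct (HP _ _ H2) as [p3 q3].
  destruct (HP _ _ H3) as [p4 q4]. destruct (HP _ _ H4) as [p2 q2].
  destruct (same_hyperbola (/ p (S i) j) (q (S i) j) (/ p (S i) (S j)) (/ q (S i) (S j))) as [E1 E2];
    try assumption; try (apply Rinv_0_lt_compat; assumption).
  - intros eps e0.
    destruct (grid_mirror_sync M N p q i j HP HA H1 H4 HM eps e0) as (tau & [C1 C2] & E & HT).
    exists (tau (S i) j), (tau (S i) (S j)). destruct (HT _ _ H3) as [T0 T1].
    repeat split; try assumption; [|apply C2; assumption].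
    rewrite <- (C1 i j), <- (C1 i (S j)) by assumption. destruct HM as [-> _]. rewrite E. reflexivity.
  - split.
    + rewrite <- (Rinv_inv (p (S i) j)), E1, Rinv_inv. reflexivity.
    + apply mul_of_eq_inv; assumption.
Qed.

Lemma grid_mirror_left M N p q i j : grid_pos M N p q -> grid_accum M N p q ->
  inside M N i j -> inside M N (S i) (S j) -> mirror p q (S i) j -> mirror p q i j.
Proof.
  intros HP HA H1 H2 HM.
  assert (H3 : inside M N (S i) j) by (unfold inside in *; lia).
  assert (H4 : inside M N i (S j)) by (unfold inside in *; lia).
  destruct (HP _ _ H1) as [p1 q1]. destruct (HP _ _ H2) as [p3 q3].
  destruct (HP _ _ H3) as [p4 q4]. destruct (HP _ _ H4) as [p2 q2].
  destruct (same_hyperbola (p i j) (q i j) (p i (S j)) (/ q i (S j))) as [E1 E2];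
    try assumption; try (apply Rinv_0_lt_compat; assumption).
  - intros eps e0.
    destruct (grid_mirror_sync M N p q (S i) j HP HA H3 H2 HM eps e0) as (tau & [C1 C2] & E & HT).
    exists (tau i j), (tau i (S j)). destruct (HT _ _ H1) as [T0 T1].
    repeat split; try assumption; [|apply C2; assumption].
    rewrite (C1 i j), (C1 i (S j)) by assumption. destruct HM as [-> _]. rewrite E. reflexivity.
  - split; [assumption | apply mul_of_eq_inv; assumption].
Qed.

Lemma nat_spread (P : nat -> Prop) a b k : (a <= k <= b)%nat -> P k ->
  (forall i, (a <= i)%nat -> (S i <= b)%nat -> (P i <-> P (S i))) ->
  forall i, (a <= i <= b)%nat -> P i.
Proof.
  intros Hk Pk H.
  assert (U : forall d, (k + d <= b)%nat -> P (k + d)%nat).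
  { induction d as [|d IH]; intro L; [rewrite Nat.add_0_r; exact Pk|].
    rewrite Nat.add_succ_r. apply (H (k + d)%nat); [lia | lia |]. apply IH. lia. }
  assert (D : forall d, (a + d <= k)%nat -> P (k - d)%nat).
  { induction d as [|d IH]; intro L; [rewrite Nat.sub_0_r; exact Pk|].
    apply (H (k - S d)%nat); [lia | lia |]. replace (S (k - S d)) with (k - d)%nat by lia. apply IH. lia. }
  intros i Hi. destruct (Nat.le_gt_cases k i) as [L|L].
  - replace i with (k + (i - k))%nat by lia. apply U. lia.
  - replace i with (k - (k - i))%nat by lia. apply D. lia.
Qed.

(** A single unequal pair spreads in two directions. Mirror symmetry copies the values of [p], hence
    the inequality, to all [j]; then for each [j] the mirror relation at [i0] spreads to all [i]. *)
Lemma grid_unequal M N p q i0 j0 : grid_pos M N p q -> grid_accum M N p q ->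
  inside M N i0 j0 -> inside M N (S i0) j0 -> p i0 j0 * p (S i0) j0 <> 1 ->
  forall i j, inside M N i j -> inside M N i (S j) -> mirror p q i j.
Proof.
  intros HP HA H1 H2 Hne.
  assert (C : forall j, (1 <= j <= N)%nat -> p i0 j * p (S i0) j <> 1).
  { apply (nat_spread (fun j => p i0 j * p (S i0) j <> 1) 1 N j0); [unfold inside in *; lia | exact Hne |].
    intros j L1 L2.
    assert (X : p i0 j * p (S i0) j <> 1 \/ p i0 (S j) * p (S i0) (S j) <> 1 ->
      mirror p q i0 j /\ mirror p q (S i0) j) by (intro D; apply (grid_block M N); try assumption; unfold inside in *; lia).
    split; intro E; destruct X as [[E1 _] [E2 _]]; auto; congruence. }
  intros i j K1 K2.
  apply (nat_spread (fun i => mirror p q i j) 1 M i0); [unfold inside in *; lia | | | unfold inside in *; lia].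
  - apply (grid_block M N p q i0 j); auto; [unfold inside in *; lia | unfold inside in *; lia |].
    left. apply C. unfold inside in *. lia.
  - intros k L1 L2. split; intro.
    + apply (grid_mirror_right M N); auto; unfold inside in *; lia.
    + apply (grid_mirror_left M N); auto; unfold inside in *; lia.
Qed.

Definition transp {A : Type} (p : nat -> nat -> A) (i j : nat) : A := p j i.

(** Exchanging the indices exchanges the roles of [hb p] and [hb (- q)], which is compensated by
    reversing the sign of the parameter. *)
Lemma grid_accum_transp M N p q : grid_accum M N p q -> grid_accum N M (transp q) (transp p).
Proof.
  intros H eps e0. destruct (H eps e0) as (tau & [C1 C2] & HT).
  exists (fun i j => - tau j i). unfold transp. split; [split|].
  - intros i j H1 H2. rewrite !hb_opp. apply C2; unfold inside in *; lia.
  - intros i j H1 H2. rewrite !hb_opp, !Ropp_involutive. apply C1; unfold inside in *; lia.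
  - intros i j H1. destruct (HT j i) as [T0 T1]; [unfold inside in *; lia|].
    rewrite Rabs_Ropp. split; [lra | assumption].
Qed.

Lemma grid_classification M N p q : grid_pos M N p q -> grid_accum M N p q ->
  (forall i j, inside M N i j -> inside M N i (S j) -> mirror p q i j) \/
  (forall i j, inside M N i j -> inside M N (S i) j -> mirror (transp q) (transp p) j i) \/
  ((forall i j, inside M N i j -> inside M N (S i) j -> p i j * p (S i) j = 1) /\
   (forall i j, inside M N i j -> inside M N i (S j) -> q i j * q i (S j) = 1)).
Proof.
  intros HP HA.
  destruct (classic (exists i j, inside M N i j /\ inside M N (S i) j /\ p i j * p (S i) j <> 1))
    as [(i & j & H1 & H2 & H3)|A].
  { left. apply (grid_unequal M N p q i j); assumption. }
  destruct (classic (exists i j, inside M N i j /\ inside M N i (S j) /\ q i j * q i (S j) <> 1))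
    as [(i & j & H1 & H2 & H3)|B].
  { right; left. intros i' j' K1 K2.
    apply (grid_unequal N M (transp q) (transp p) j i); unfold transp; unfold inside in *; try lia.
    - intros a b L. destruct (HP b a); [unfold inside in *; lia|]. split; assumption.
    - apply grid_accum_transp, HA.
    - assumption. }
  right; right. split; intros i j H1 H2; apply NNPP; intro H3.
  - apply A. exists i, j. auto.
  - apply B. exists i, j. auto.
Qed.

(** * Explicit one-parameter families of edge factors *)

Definition quad_factors (p q x1 x2 x3 x4 : R) : Prop :=
  exists s u, s ^ 2 - u ^ 2 = 1 /\ x1 = s - u / q /\ x2 = s + p * u /\ x3 = s - q * u /\ x4 = s + u / p.

(** [A t i j] and [B t i j] are the factors of the edges from the vertex [(i, j)] to [(S i, j)] and to [(i, S j)]. *)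
Definition grid_solution (M N : nat) (p q : nat -> nat -> R) (A B : R -> nat -> nat -> R) : Prop :=
  (forall i j, (i <= M)%nat -> (1 <= j <= N)%nat -> continuity (fun t => A t i j) /\ A 0 i j = 1) /\
  (forall i j, (1 <= i <= M)%nat -> (j <= N)%nat -> continuity (fun t => B t i j) /\ B 0 i j = 1) /\
  (forall t i j, inside M N i j ->
     quad_factors (p i j) (q i j) (B t i (j - 1)%nat) (A t i j) (B t i j) (A t (i - 1)%nat j)) /\
  (A 1 1%nat 1%nat <> 1 \/ B 1 1%nat 1%nat <> 1).

Lemma ch_0 : ch 0 = 1.
Proof. unfold ch. replace (1 + 0 ^ 2) with 1 by ring. apply sqrt_1. Qed.

Lemma hb_0 p : hb p 0 = 1.
Proof. unfold hb. rewrite ch_0. ring. Qed.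

Lemma hb_gt1 p x : 0 < p -> 0 < x -> 1 < hb p x.
Proof. intros H0 H1. unfold hb. assert (H := ch_ge1 x). assert (0 < p * x) by (apply Rmult_lt_0_compat; assumption). lra. Qed.

Lemma hb_ge1 p x : 0 < p -> 0 <= x -> 1 <= hb p x.
Proof. intros H0 H1. unfold hb. assert (H := ch_ge1 x). assert (0 <= p * x) by (apply Rmult_le_pos; lra). lra. Qed.

Lemma continuity_sqrt_comp f : continuity f -> (forall t, 0 <= f t) -> continuity (fun t => sqrt (f t)).
Proof.
  intros H H0 t. apply (continuity_pt_comp f sqrt); [apply H | apply continuity_pt_sqrt, H0].
Qed.

Lemma continuity_id : continuity (fun t => t).
Proof. apply derivable_continuous. exact derivable_id. Qed.

Lemma continuity_cst c : continuity (fun _ => c).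
Proof. intro t. apply continuity_pt_const. intros a b. reflexivity. Qed.

Ltac cont_tac :=
  repeat first [ assumption | apply continuity_cst | apply continuity_id
    | apply continuity_minus | apply continuity_plus | apply continuity_opp | apply continuity_mult ].

Lemma continuity_hb p f : continuity f -> continuity (fun t => hb p (f t)).
Proof.
  intro H. unfold hb, ch. apply (continuity_plus (fun t => sqrt (1 + f t ^ 2))); [|cont_tac].
  apply continuity_sqrt_comp; [|intro t; nra].
  apply (continuity_plus (fun _ => 1) (fun t => f t ^ 2)); [cont_tac|].
  unfold pow. cont_tac.
Qed.

(** The nonnegative solution of [hb p x = a] for [a >= 1], with the numerator rationalized so that
    no division by [p ^ 2 - 1] is needed. *)
Definition hb_inv (p a : R) : R := (a ^ 2 - 1) / (p * a + sqrt (a ^ 2 + p ^ 2 - 1)).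

Lemma hb_inv_den p a : 0 < p -> 1 <= a -> 0 < p * a + sqrt (a ^ 2 + p ^ 2 - 1).
Proof.
  intros H0 H1. assert (H := sqrt_pos (a ^ 2 + p ^ 2 - 1)).
  assert (0 < p * a) by (apply Rmult_lt_0_compat; lra). lra.
Qed.

Lemma hb_inv_ge0 p a : 0 < p -> 1 <= a -> 0 <= hb_inv p a.
Proof. intros H0 H1. unfold hb_inv. apply Rle_mult_inv_pos; [nra | apply hb_inv_den; assumption]. Qed.

Lemma hb_inv_1 p : hb_inv p 1 = 0.
Proof. unfold hb_inv. replace (1 ^ 2 - 1) with 0 by ring. unfold Rdiv. ring. Qed.

Lemma hb_hb_inv p a : 0 < p -> 1 <= a -> hb p (hb_inv p a) = a.
Proof.
  intros H0 H1. assert (D := hb_inv_den p a H0 H1). unfold hb, hb_inv.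
  set (S := sqrt (a ^ 2 + p ^ 2 - 1)) in *.
  assert (HS : S ^ 2 = a ^ 2 + p ^ 2 - 1) by (unfold S; rewrite pow2_sqrt; nra).
  assert (S0 : 0 <= S) by apply sqrt_pos.
  assert (E : (a * S + p) / (p * a + S) = ch ((a ^ 2 - 1) / (p * a + S))).
  { apply ch_unique.
    - apply Rle_mult_inv_pos; [nra | assumption].
    - apply Rmult_eq_reg_r with ((p * a + S) ^ 2); [|apply pow_nonzero; lra].
      transitivity ((a * S + p) ^ 2 - (a ^ 2 - 1) ^ 2); [field; lra|].
      transitivity (a ^ 2 * S ^ 2 + 2 * p * a * S + p ^ 2 - (a ^ 2 - 1) ^ 2); [ring|].
      transitivity (p ^ 2 * a ^ 2 + 2 * p * a * S + S ^ 2); [rewrite HS; ring | ring]. }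
  rewrite <- E. field. lra.
Qed.

Lemma continuity_hb_inv p f : 0 < p -> continuity f -> (forall t, 1 <= f t) ->
  continuity (fun t => hb_inv p (f t)).
Proof.
  intros H0 H H1. unfold hb_inv.
  apply (continuity_div (fun t => f t ^ 2 - 1) (fun t => p * f t + sqrt (f t ^ 2 + p ^ 2 - 1))).
  - unfold pow. cont_tac.
  - apply (continuity_plus (fun t => p * f t)); [cont_tac|].
    apply continuity_sqrt_comp; [unfold pow; cont_tac|].
    intro t. specialize (H1 t). nra.
  - intro t. apply Rgt_not_eq. apply hb_inv_den; auto.
Qed.

Lemma quad_factors_hb p q u x1 x2 x3 x4 :
  x1 = hb (- / q) u -> x2 = hb p u -> x3 = hb (- q) u -> x4 = hb (/ p) u -> quad_factors p q x1 x2 x3 x4.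
Proof.
  intros -> -> -> ->. exists (ch u), u. unfold hb, Rdiv.
  split; [rewrite ch_sq; ring|]. repeat split; ring.
Qed.

(** Equal opposite ratios make both conditions on each shared edge identities, so all quadrilaterals
    can use the same parameter [t]. *)
Lemma grid_solution_opposite M N p q : (1 <= M)%nat -> (1 <= N)%nat -> grid_pos M N p q ->
  (forall i j, inside M N i j -> inside M N (S i) j -> p i j * p (S i) j = 1) ->
  (forall i j, inside M N i j -> inside M N i (S j) -> q i j * q i (S j) = 1) ->
  exists A B, grid_solution M N p q A B.
Proof.
  intros HM HN HP Ep Eq.
  (* Edges with first index 0 precede all vertices of the grid; their factor is read off from the
     vertex of index 1, with the inverse parameter. *)
  exists (fun t i j => match i with O => hb (/ p 1%nat j) t | _ => hb (p i j) t end),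
    (fun t i j => match j with O => hb (- / q i 1%nat) t | _ => hb (- q i j) t end).
  split; [|split; [|split]].
  - intros i j _ _. destruct i; split; try apply hb_0; apply continuity_hb, continuity_id.
  - intros i j _ _. destruct j; split; try apply hb_0; apply continuity_hb, continuity_id.
  - intros t i j H. destruct i as [|[|i]]; [unfold inside in H; lia | |]; (destruct j as [|[|j]]; [unfold inside in H; lia | |]);
      simpl; apply quad_factors_hb with t; try reflexivity.
    + rewrite (inv_of_mul_eq1 (q 1%nat (S j))); [reflexivity | apply Eq; unfold inside in *; lia].
    + rewrite (inv_of_mul_eq1 (p (S i) 1%nat)); [reflexivity | apply Ep; unfold inside in *; lia].
    + rewrite (inv_of_mul_eq1 (q (S (S i)) (S j))); [reflexivity | apply Eq; unfold inside in *; lia].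
    + rewrite (inv_of_mul_eq1 (p (S i) (S (S j)))); [reflexivity | apply Ep; unfold inside in *; lia].
  - left. apply Rgt_not_eq, hb_gt1; [|lra]. apply HP. unfold inside; lia.
Qed.

(** The parameter is passed on along [i]. It starts with [t ^ 2] rather than [t] because [hb_inv]
    needs arguments at least 1, hence nonnegative parameters, while the family must be continuous on
    the whole line. *)
Fixpoint strip (p : nat -> R) (i : nat) (t : R) : R :=
  match i with
  | O => t ^ 2
  | S k => hb_inv (/ p (S k)) (hb (p k) (strip p k t))
  end.

Lemma strip_props p i : (forall k, (k <= i)%nat -> 0 < p k) ->
  (forall t, 0 <= strip p i t) /\ continuity (strip p i) /\ strip p i 0 = 0.
Proof.
  induction i as [|i IH]; intro H; simpl.
  - split; [intro t; nra|]. split; [|ring]. unfold pow. cont_tac.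
  - destruct IH as (I1 & I2 & I3); [intros; apply H; lia|].
    assert (G : forall t, 1 <= hb (p i) (strip p i t)) by (intro t; apply hb_ge1; [apply H; lia | apply I1]).
    assert (P : 0 < / p (S i)) by (apply Rinv_0_lt_compat, H; lia).
    repeat split.
    + intro t. apply hb_inv_ge0; auto.
    + apply continuity_hb_inv; auto. apply continuity_hb, I2.
    + rewrite I3, hb_0. apply hb_inv_1.
Qed.

Lemma strip_S p i t : (forall k, (k <= S i)%nat -> 0 < p k) ->
  hb (/ p (S i)) (strip p (S i) t) = hb (p i) (strip p i t).
Proof.
  intro H. simpl. apply hb_hb_inv.
  - apply Rinv_0_lt_compat, H. lia.
  - apply hb_ge1; [apply H; lia|]. apply strip_props. intros; apply H; lia.
Qed.

(** Here [p] depends on [i] only. A parameter depending on [i] only then satisfies every condition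
    along [j], and [strip] takes care of those along [i]. *)
Lemma grid_solution_mirror M N p q : (1 <= M)%nat -> (1 <= N)%nat -> grid_pos M N p q ->
  (forall i j, inside M N i j -> inside M N i (S j) -> mirror p q i j) ->
  exists A B, grid_solution M N p q A B.
Proof.
  intros HM HN HP HMi.
  set (P := fun i => p (S i) 1%nat).
  assert (P0 : forall i, (S i <= M)%nat -> forall k, (k <= i)%nat -> 0 < P k).
  { intros i Hi k Hk. apply HP. unfold inside; lia. }
  assert (Pj : forall i j, inside M N i j -> p i j = p i 1%nat).
  { intros i j. induction j as [|[|j] IH]; intro H; [unfold inside in H; lia | reflexivity |].
    rewrite <- IH by (unfold inside in *; lia). symmetry. apply HMi; unfold inside in *; lia. }
  exists (fun t i j => match i with O => hb (/ P O) (strip P O t) | S k => hb (P k) (strip P k t) end),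
    (fun t i j => match j with O => hb (- / q i 1%nat) (strip P (i - 1) t) | _ => hb (- q i j) (strip P (i - 1) t) end).
  split; [|split; [|split]].
  - intros i j Hi _. destruct i as [|i].
    + destruct (strip_props P 0 (P0 O HM)) as (_ & C & E). rewrite E, hb_0. split; [apply continuity_hb, C | reflexivity].
    + destruct (strip_props P i (P0 i Hi)) as (_ & C & E). rewrite E, hb_0. split; [apply continuity_hb, C | reflexivity].
  - intros i j Hi _. destruct (strip_props P (i - 1)) as (_ & C & E); [apply P0; lia|].
    rewrite E. destruct j; rewrite hb_0; (split; [apply continuity_hb, C | reflexivity]).
  - intros t i j H. destruct i as [|i]; [unfold inside in H; lia|].
    apply quad_factors_hb with (strip P i t); replace (S i - 1)%nat with i by lia.
    + destruct j as [|[|j]]; [unfold inside in H; lia | reflexivity |].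
      replace (S (S j) - 1)%nat with (S j) by lia.
      destruct (HMi (S i) (S j)) as [_ E]; [unfold inside in *; lia | assumption |].
      rewrite (inv_of_mul_eq1 _ _ E). reflexivity.
    + rewrite Pj by assumption. reflexivity.
    + destruct j; [unfold inside in H; lia | reflexivity].
    + rewrite Pj by assumption. destruct i as [|i]; [reflexivity|].
      symmetry. apply (strip_S P). apply P0. unfold inside in H; lia.
  - left. apply Rgt_not_eq, hb_gt1; [apply (P0 O); lia | simpl; lra].
Qed.

Lemma grid_solution_transp M N p q : (1 <= M)%nat -> (1 <= N)%nat ->
  (exists A B, grid_solution N M (transp q) (transp p) A B) ->
  exists A B, grid_solution M N p q A B.
Proof.
  intros HM HN (A & B & HA & HB & HQ & HT).
  exists (fun t i j => B t j i), (fun t i j => A t j i). split; [|split; [|split]].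
  - intros i j H1 H2. apply HB; lia.
  - intros i j H1 H2. apply HA; lia.
  - intros t i j H. destruct (HQ t j i) as (s & u & E & E1 & E2 & E3 & E4); [unfold inside in *; lia|].
    unfold transp in *. exists s, (- u). unfold Rdiv in *. repeat split; rewrite ?E1, ?E2, ?E3, ?E4; lra.
  - destruct HT; auto.
Qed.

Lemma grid_solution_exists M N p q : (1 <= M)%nat -> (1 <= N)%nat -> grid_pos M N p q ->
  (forall i j, inside M N i j -> inside M N i (S j) -> mirror p q i j) \/
  (forall i j, inside M N i j -> inside M N (S i) j -> mirror (transp q) (transp p) j i) \/
  ((forall i j, inside M N i j -> inside M N (S i) j -> p i j * p (S i) j = 1) /\
   (forall i j, inside M N i j -> inside M N i (S j) -> q i j * q i (S j) = 1)) ->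
  exists A B, grid_solution M N p q A B.
Proof.
  intros HM HN HP [H|[H|[H1 H2]]].
  - apply grid_solution_mirror; assumption.
  - apply grid_solution_transp; try assumption. apply grid_solution_mirror; try assumption.
    + intros i j L. destruct (HP j i); [unfold inside in *; lia|]. split; assumption.
    + intros i j L1 L2. apply H; unfold inside in *; lia.
  - apply grid_solution_opposite; assumption.
Qed.

(** * Gradient quadrilaterals *)

(** Twice the signed area of the triangle of gradients. *)
Definition turn (a b c : plane) : R :=
  (pa b - pa a) * (pb c - pb b) - (pb b - pb a) * (pa c - pa b).

Definition convex_planes (a b c d : plane) : Prop :=
  0 < turn a b c * turn b c d /\ 0 < turn b c d * turn c d a /\ 0 < turn c d a * turn d a b.

(** For the gradient quadrilateral [a b c d], the square root of the product of the two ratios in which the diagonals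
    divide each other: the opposite ratio is [shape a b c d ^ 2], see [opp_ratio_shape]. *)
Definition shape (a b c d : plane) : R :=
  sqrt (turn c d a * turn d a b / (turn a b c * turn b c d)).

Lemma same_sign_trans x y z : 0 < x * y -> 0 < y * z -> 0 < x * z.
Proof.
  intros H1 H2. assert (y <> 0) by (intro E; rewrite E in H2; lra).
  assert (0 < (x * y) * (y * z)) by (apply Rmult_lt_0_compat; assumption).
  assert (0 < y * y) by (apply Rsqr_pos_lt; assumption).
  apply Rmult_lt_reg_l with (y * y); [assumption|]. lra.
Qed.

Lemma convex_planes_rot a b c d : convex_planes a b c d -> convex_planes b c d a.
Proof.
  intros (H1 & H2 & H3). repeat split; try assumption.
  rewrite Rmult_comm. apply same_sign_trans with (turn c d a); [|assumption].
  apply same_sign_trans with (turn b c d); assumption.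
Qed.

Lemma turn_sum a b c d : turn a b c + turn c d a = turn b c d + turn d a b.
Proof. unfold turn. ring. Qed.

Lemma convex_planes_nonzero a b c d : convex_planes a b c d ->
  turn a b c <> 0 /\ turn b c d <> 0 /\ turn c d a <> 0 /\ turn d a b <> 0 /\ turn a b c + turn c d a <> 0.
Proof.
  intros (H1 & H2 & H3). assert (H4 := same_sign_trans _ _ _ H1 H2).
  repeat split; intro E; try (rewrite E in *; lra).
  replace (turn c d a) with (- turn a b c) in H4 by lra. nra.
Qed.

Lemma shape_pos a b c d : convex_planes a b c d -> 0 < shape a b c d.
Proof.
  intros (H1 & H2 & H3). unfold shape. apply sqrt_lt_R0. apply Rdiv_lt_0_compat; assumption.
Qed.

Lemma shape_sq a b c d : convex_planes a b c d ->
  shape a b c d ^ 2 = turn c d a * turn d a b / (turn a b c * turn b c d).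
Proof.
  intros (H1 & H2 & H3). unfold shape. rewrite pow2_sqrt; [reflexivity|].
  apply Rlt_le, Rdiv_lt_0_compat; assumption.
Qed.

Lemma shape_opposite a b c d : convex_planes a b c d -> shape c d a b = / shape a b c d.
Proof.
  intros (H1 & H2 & H3). unfold shape. rewrite <- sqrt_inv.
  assert (N := convex_planes_nonzero a b c d (conj H1 (conj H2 H3))).
  f_equal. field. tauto.
Qed.

Lemma shape_reverse a b c d : shape a d c b = shape b c d a.
Proof.
  unfold shape.
  assert (T : forall x y z, turn z y x = - turn x y z) by (intros; unfold turn; ring).
  rewrite (T b c d), (T a b c), (T c d a), (T d a b).
  f_equal. unfold Rdiv.
  f_equal; [ring | f_equal; ring].
Qed.

Lemma square_eq x y : 0 < x * y -> x ^ 2 = y ^ 2 -> x = y.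
Proof.
  intros H E. assert (F : (x - y) * (x + y) = 0) by lra.
  apply Rmult_integral in F. destruct F as [F|F]; [lra|].
  exfalso. replace x with (- y) in H by lra. nra.
Qed.

(** Together with [shape_div] and [turn_sum] this determines the four turns up to a common factor.
    The sign is known from convexity, so it suffices to compare squares. *)
Lemma shape_mul a b c d : convex_planes a b c d ->
  shape a b c d * shape b c d a * turn b c d = turn d a b.
Proof.
  intro H. assert (N := convex_planes_nonzero _ _ _ _ H).
  assert (P := shape_pos _ _ _ _ H). assert (Q := shape_pos _ _ _ _ (convex_planes_rot _ _ _ _ H)).
  assert (P2 := shape_sq _ _ _ _ H). assert (Q2 := shape_sq _ _ _ _ (convex_planes_rot _ _ _ _ H)).
  destruct H as (H1 & H2 & H3). apply square_eq.
  - rewrite !Rmult_assoc. do 2 (apply Rmult_lt_0_compat; [assumption|]).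
    apply same_sign_trans with (turn c d a); assumption.
  - rewrite !Rpow_mult_distr, P2, Q2. field. tauto.
Qed.

Lemma shape_div a b c d : convex_planes a b c d ->
  shape a b c d * turn a b c = shape b c d a * turn c d a.
Proof.
  intro H. assert (N := convex_planes_nonzero _ _ _ _ H).
  assert (P := shape_pos _ _ _ _ H). assert (Q := shape_pos _ _ _ _ (convex_planes_rot _ _ _ _ H)).
  assert (P2 := shape_sq _ _ _ _ H). assert (Q2 := shape_sq _ _ _ _ (convex_planes_rot _ _ _ _ H)).
  destruct H as (H1 & H2 & H3). apply square_eq.
  - replace (shape a b c d * turn a b c * (shape b c d a * turn c d a))
      with (shape a b c d * (shape b c d a * (turn a b c * turn c d a))) by ring.
    do 2 (apply Rmult_lt_0_compat; [assumption|]).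
    apply same_sign_trans with (turn b c d); assumption.
  - rewrite !Rpow_mult_distr, P2, Q2. field. tauto.
Qed.

Lemma det2_basis u1 u2 e1 e2 f1 f2 : e1 * f2 - e2 * f1 <> 0 ->
  u1 * e2 - u2 * e1 = 0 -> u1 * f2 - u2 * f1 = 0 -> u1 = 0 /\ u2 = 0.
Proof.
  intros H E F. split; apply Rmult_eq_reg_l with (e1 * f2 - e2 * f1); try assumption.
  - replace ((e1 * f2 - e2 * f1) * u1) with ((u1 * f2 - u2 * f1) * e1 - (u1 * e2 - u2 * e1) * f1) by ring.
    rewrite E, F. ring.
  - replace ((e1 * f2 - e2 * f1) * u2) with ((u1 * f2 - u2 * f1) * e2 - (u1 * e2 - u2 * e1) * f2) by ring.
    rewrite E, F. ring.
Qed.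

(** The quadrilateral with these edges is the Christoffel dual of the gradient quadrilateral. *)
Lemma shape_kernel a b c d p q : convex_planes a b c d -> p = shape a b c d -> q = shape b c d a ->
  p * (pa c - pa b) + (pa a - pa d) / p - q * (pa d - pa c) - (pa b - pa a) / q = 0 /\
  p * (pb c - pb b) + (pb a - pb d) / p - q * (pb d - pb c) - (pb b - pb a) / q = 0.
Proof.
  intros H Ep Eq. assert (N := convex_planes_nonzero _ _ _ _ H).
  assert (P := shape_pos _ _ _ _ H). assert (Q := shape_pos _ _ _ _ (convex_planes_rot _ _ _ _ H)).
  assert (M := shape_mul _ _ _ _ H). assert (D := shape_div _ _ _ _ H).
  assert (S := turn_sum a b c d).
  rewrite <- Ep in *. rewrite <- Eq in *. clear Ep Eq.
  (* A vector vanishes once its determinants with the two independent edges [b - a] and [c - b]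
     do. *)
  apply det2_basis with (pa b - pa a) (pb b - pb a) (pa c - pa b) (pb c - pb b).
  - exact (proj1 N).
  - apply Rmult_eq_reg_l with p; [|lra]. rewrite Rmult_0_r.
    transitivity (p * (q * turn c d a - p * turn a b c) + (turn d a b - p * q * turn b c d)
      + p * q * (turn b c d - turn b c d)).
    + unfold turn. field. lra.
    + rewrite D, M. ring.
  - apply Rmult_eq_reg_l with (p * q); [|apply Rgt_not_eq, Rmult_lt_0_compat; assumption]. rewrite Rmult_0_r.
    transitivity (q * turn b c d + q * (p * q * turn b c d) - q * turn a b c - p * turn a b c).
    + unfold turn. field. lra.
    + rewrite D, M. replace (turn c d a) with (turn b c d + turn d a b - turn a b c) by lra. ring.
Qed.

(** The closing condition leaves a plane of solutions, spanned by [(1, 1, 1, 1)] and the Christoffel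
    dual [(- 1/q, p, - q, 1/p)]. The coordinates [s] and [u] are recovered from [x2] and [x3], and
    the area becomes the form [s^2 - u^2]. *)
Lemma closed_quad_factors a b c d x1 x2 x3 x4 : convex_planes a b c d ->
  x1 * (pa b - pa a) + x2 * (pa c - pa b) + x3 * (pa d - pa c) + x4 * (pa a - pa d) = 0 ->
  x1 * (pb b - pb a) + x2 * (pb c - pb b) + x3 * (pb d - pb c) + x4 * (pb a - pb d) = 0 ->
  x1 * x2 * turn a b c + x3 * x4 * turn c d a = turn a b c + turn c d a ->
  let p := shape a b c d in let q := shape b c d a in
  let s := (q * x2 + p * x3) / (p + q) in let u := (x2 - x3) / (p + q) in
  s ^ 2 - u ^ 2 = 1 /\ x1 = s - u / q /\ x2 = s + p * u /\ x3 = s - q * u /\ x4 = s + u / p.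
Proof.
  intros H Ca Cb Ar p q s u. assert (N := convex_planes_nonzero _ _ _ _ H).
  assert (P := shape_pos _ _ _ _ H). assert (Q := shape_pos _ _ _ _ (convex_planes_rot _ _ _ _ H)).
  assert (M := shape_mul _ _ _ _ H). assert (D := shape_div _ _ _ _ H).
  destruct (shape_kernel a b c d p q H eq_refl eq_refl) as [Ka Kb].
  fold p in P, M, D. fold q in Q, M, D.
  assert (X2 : x2 = s + p * u) by (unfold s, u; field; lra).
  assert (X3 : x3 = s - q * u) by (unfold s, u; field; lra).
  (* Subtracting the known solution leaves a closing relation between the two edges at [a] alone;
     they are independent, so both remainders vanish. *)
  assert (Ya : (x1 - (s - u / q)) * (pa b - pa a) + (x4 - (s + u / p)) * (pa a - pa d) = 0).
  { rewrite X2, X3 in Ca.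
    transitivity ((x1 * (pa b - pa a) + (s + p * u) * (pa c - pa b) + (s - q * u) * (pa d - pa c) + x4 * (pa a - pa d))
      - u * (p * (pa c - pa b) + (pa a - pa d) / p - q * (pa d - pa c) - (pa b - pa a) / q)).
    - field. lra.
    - rewrite Ca, Ka. ring. }
  assert (Yb : (x1 - (s - u / q)) * (pb b - pb a) + (x4 - (s + u / p)) * (pb a - pb d) = 0).
  { rewrite X2, X3 in Cb.
    transitivity ((x1 * (pb b - pb a) + (s + p * u) * (pb c - pb b) + (s - q * u) * (pb d - pb c) + x4 * (pb a - pb d))
      - u * (p * (pb c - pb b) + (pb a - pb d) / p - q * (pb d - pb c) - (pb b - pb a) / q)).
    - field. lra.
    - rewrite Cb, Kb. ring. }
  set (y1 := x1 - (s - u / q)) in *. set (y4 := x4 - (s + u / p)) in *.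
  assert (Z1 : y1 = 0).
  { apply Rmult_eq_reg_r with (turn d a b); [|tauto].
    transitivity ((pa a - pa d) * (y1 * (pb b - pb a) + y4 * (pb a - pb d))
      - (pb a - pb d) * (y1 * (pa b - pa a) + y4 * (pa a - pa d))); [unfold turn; ring | rewrite Ya, Yb; ring]. }
  assert (Z4 : y4 = 0).
  { apply Rmult_eq_reg_r with (turn d a b); [|tauto].
    transitivity ((pb b - pb a) * (y1 * (pa b - pa a) + y4 * (pa a - pa d))
      - (pa b - pa a) * (y1 * (pb b - pb a) + y4 * (pb a - pb d))); [unfold turn; ring | rewrite Ya, Yb; ring]. }
  assert (X1 : x1 = s - u / q) by (unfold y1 in Z1; lra).
  assert (X4 : x4 = s + u / p) by (unfold y4 in Z4; lra).
  repeat split; try assumption.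
  (* In the area all terms other than the multiple of [s ^ 2 - u ^ 2] contain
     [p * turn a b c - q * turn c d a], which is zero by [shape_div]. *)
  apply Rmult_eq_reg_r with (turn a b c + turn c d a); [|tauto].
  rewrite Rmult_1_l. etransitivity; [|exact Ar]. rewrite X1, X2, X3, X4.
  apply Rmult_eq_reg_l with (p * q); [|apply Rgt_not_eq, Rmult_lt_0_compat; assumption].
  transitivity (p * q * (s ^ 2 - u ^ 2) * (turn a b c + turn c d a)
    + s * u * (p * q - 1) * (p * turn a b c - q * turn c d a)
    + u ^ 2 * (p * turn a b c - q * turn c d a) * (q - p)).
  - rewrite D. ring.
  - field. lra.
Qed.

Lemma quad_factors_closed a b c d x1 x2 x3 x4 : convex_planes a b c d ->
  quad_factors (shape a b c d) (shape b c d a) x1 x2 x3 x4 ->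
  x1 * (pa b - pa a) + x2 * (pa c - pa b) + x3 * (pa d - pa c) + x4 * (pa a - pa d) = 0 /\
  x1 * (pb b - pb a) + x2 * (pb c - pb b) + x3 * (pb d - pb c) + x4 * (pb a - pb d) = 0 /\
  x1 * x2 * turn a b c + x3 * x4 * turn c d a = turn a b c + turn c d a.
Proof.
  intros H (s & u & E & X1 & X2 & X3 & X4). assert (N := convex_planes_nonzero _ _ _ _ H).
  assert (P := shape_pos _ _ _ _ H). assert (Q := shape_pos _ _ _ _ (convex_planes_rot _ _ _ _ H)).
  assert (D := shape_div _ _ _ _ H).
  destruct (shape_kernel a b c d _ _ H eq_refl eq_refl) as [Ka Kb].
  set (p := shape a b c d) in *. set (q := shape b c d a) in *.
  rewrite X1, X2, X3, X4. repeat split.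
  - transitivity (u * (p * (pa c - pa b) + (pa a - pa d) / p - q * (pa d - pa c) - (pa b - pa a) / q));
      [field; lra | rewrite Ka; ring].
  - transitivity (u * (p * (pb c - pb b) + (pb a - pb d) / p - q * (pb d - pb c) - (pb b - pb a) / q));
      [field; lra | rewrite Kb; ring].
  - apply Rmult_eq_reg_l with (p * q); [|apply Rgt_not_eq, Rmult_lt_0_compat; assumption].
    transitivity (p * q * (s ^ 2 - u ^ 2) * (turn a b c + turn c d a)
      + s * u * (p * q - 1) * (p * turn a b c - q * turn c d a)
      + u ^ 2 * (p * turn a b c - q * turn c d a) * (q - p)).
    + field. lra.
    + rewrite D, E. ring.
Qed.

(** * Opposite ratios as ratios on the diagonals *)

Definition ev (p : plane) (x y : R) : R := pa p * x + pb p * y + pc p.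

Lemma sum_sq_pos u v : u <> 0 \/ v <> 0 -> 0 < u ^ 2 + v ^ 2.
Proof.
  intro H. assert (A := pow2_ge_0 u). assert (B := pow2_ge_0 v).
  assert (C : forall w, w <> 0 -> 0 < w ^ 2) by (intros w Hw; assert (0 < w * w) by (apply Rsqr_pos_lt; assumption); lra).
  destruct H as [H|H]; specialize (C _ H); lra.
Qed.

Lemma affine_zero_line d1 d2 d3 r1 r2 r3 : d1 <> 0 \/ d2 <> 0 ->
  (forall x y, d1 * x + d2 * y + d3 = 0 -> r1 * x + r2 * y + r3 = 0) ->
  exists k, r1 = k * d1 /\ r2 = k * d2 /\ r3 = k * d3.
Proof.
  intros Hd H. assert (N : 0 < d1 ^ 2 + d2 ^ 2) by (apply sum_sq_pos; assumption).
  set (n := d1 ^ 2 + d2 ^ 2) in *.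
  assert (Hn : n = d1 ^ 2 + d2 ^ 2) by reflexivity. clearbody n.
  (* The zero line, parametrized from the foot of the perpendicular from the origin. *)
  assert (E : forall s, r1 * (- d3 * d1 / n - s * d2) + r2 * (- d3 * d2 / n + s * d1) + r3 = 0).
  { intro s. apply H. transitivity (d3 * (1 - (d1 ^ 2 + d2 ^ 2) / n)); [field; lra|].
    rewrite <- Hn. field. lra. }
  assert (E0 := E 0). assert (E1 := E 1).
  assert (F : r2 * d1 = r1 * d2) by lra.
  exists ((r1 * d1 + r2 * d2) / n).
  assert (R1 : r1 = (r1 * d1 + r2 * d2) / n * d1).
  { apply Rmult_eq_reg_r with n; [|lra].
    transitivity (r1 * d1 ^ 2 + (r2 * d1) * d2); [rewrite F, Hn; ring | field; lra]. }
  assert (R2 : r2 = (r1 * d1 + r2 * d2) / n * d2).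
  { apply Rmult_eq_reg_r with n; [|lra].
    transitivity ((r1 * d2) * d1 + r2 * d2 ^ 2); [rewrite <- F, Hn; ring | field; lra]. }
  repeat split; try assumption.
  transitivity (- (r1 * (- d3 * d1 / n - 0 * d2) + r2 * (- d3 * d2 / n + 0 * d1))); [lra | field; lra].
Qed.

(** A plane through the line of intersection belongs to the pencil of the two planes, so its
    gradient lies on the line joining theirs. *)
Lemma line_in_plane P Q S : pa P <> pa Q \/ pb P <> pb Q ->
  (forall X, on_plane P X -> on_plane Q X -> on_plane S X) ->
  exists k, pa S = pa P + k * (pa Q - pa P) /\ pb S = pb P + k * (pb Q - pb P) /\
            pc S = pc P + k * (pc Q - pc P).
Proof.
  intros H HX.
  destruct (affine_zero_line (pa Q - pa P) (pb Q - pb P) (pc Q - pc P)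
    (pa S - pa P) (pb S - pb P) (pc S - pc P)) as (k & E1 & E2 & E3).
  - destruct H; [left | right]; lra.
  - intros x y E. assert (F := HX (mkpt x y (ev P x y))). unfold on_plane, ev in F. simpl in F.
    specialize (F eq_refl). lra.
  - exists k. lra.
Qed.

Lemma iso_angle_scale P Q k u v : pa P - pa Q = k * u -> pb P - pb Q = k * v -> 0 < k ->
  iso_angle P Q = k * sqrt (u ^ 2 + v ^ 2).
Proof.
  intros E F H. unfold iso_angle. rewrite E, F.
  replace ((k * u) ^ 2 + (k * v) ^ 2) with (k ^ 2 * (u ^ 2 + v ^ 2)) by ring.
  rewrite sqrt_mult by nra. rewrite sqrt_pow2; [reflexivity | lra].
Qed.

Lemma same_sign_ratio x y : 0 < x * y -> 0 < x / (x + y) /\ 0 < y / (x + y) /\ x + y <> 0.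
Proof.
  intro H. assert (0 < x * (x + y)) by nra. assert (0 < y * (x + y)) by nra.
  assert (N : x + y <> 0) by (intro E; rewrite E in *; lra).
  assert (0 < (x + y) * (x + y)) by (apply Rsqr_pos_lt; assumption).
  repeat split; try assumption.
  - replace (x / (x + y)) with (x * (x + y) / ((x + y) * (x + y))) by (field; assumption).
    apply Rdiv_lt_0_compat; assumption.
  - replace (y / (x + y)) with (y * (x + y) / ((x + y) * (x + y))) by (field; assumption).
    apply Rdiv_lt_0_compat; assumption.
Qed.

(** Isotropic angles are distances of gradients, and the gradient of the spanned plane is the
    crossing point of the diagonals [ac] and [bd]. The common point over [(x, y)] ensures that the
    plane exists. *)
Lemma opp_ratio_shape a b c d x y r : convex_planes a b c d ->
  ev b x y = ev a x y -> ev c x y = ev a x y -> ev d x y = ev a x y ->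
  (opp_ratio_is a b c d r <-> r = shape a b c d ^ 2).
Proof.
  intros H Vb Vc Vd. assert (N := convex_planes_nonzero _ _ _ _ H).
  rewrite (shape_sq _ _ _ _ H).
  assert (T := turn_sum a b c d).
  destruct H as (H1 & H2 & H3).
  assert (A1 := same_sign_trans _ _ _ H1 H2). assert (A2 := same_sign_trans _ _ _ H2 H3).
  destruct (same_sign_ratio _ _ A1) as (B1 & B2 & B3).
  destruct (same_sign_ratio _ _ A2) as (C1 & C2 & C3).
  (* The positions of the crossing point on [ac] and on [bd], as ratios of the areas cut off by the
     other diagonal. *)
  set (la := turn d a b / (turn b c d + turn d a b)) in *.
  set (mu := turn a b c / (turn a b c + turn c d a)) in *.
  assert (La : 1 - la = turn b c d / (turn b c d + turn d a b)) by (unfold la; field; assumption).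
  assert (Mu : 1 - mu = turn c d a / (turn a b c + turn c d a)) by (unfold mu; field; assumption).
  assert (Wac : pa a <> pa c \/ pb a <> pb c).
  { apply NNPP. intro W. apply not_or_and in W. destruct W as [W1 W2].
    apply (proj1 N). apply NNPP in W1. apply NNPP in W2. unfold turn. rewrite W1, W2. ring. }
  assert (Wbd : pa b <> pa d \/ pb b <> pb d).
  { apply NNPP. intro W. apply not_or_and in W. destruct W as [W1 W2].
    apply (proj1 (proj2 N)). apply NNPP in W1. apply NNPP in W2. unfold turn. rewrite W1, W2. ring. }
  assert (Ga : pa a + la * (pa c - pa a) = pa b + mu * (pa d - pa b)).
  { unfold la, mu. rewrite T. apply Rmult_eq_reg_r with (turn b c d + turn d a b); [|assumption].
    transitivity (turn b c d * pa a + turn d a b * pa c); [field; assumption|].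
    transitivity (turn c d a * pa b + turn a b c * pa d); [unfold turn; ring|].
    replace (turn c d a) with (turn b c d + turn d a b - turn a b c) by lra. field. assumption. }
  assert (Gb : pb a + la * (pb c - pb a) = pb b + mu * (pb d - pb b)).
  { unfold la, mu. rewrite T. apply Rmult_eq_reg_r with (turn b c d + turn d a b); [|assumption].
    transitivity (turn b c d * pb a + turn d a b * pb c); [field; assumption|].
    transitivity (turn c d a * pb b + turn a b c * pb d); [unfold turn; ring|].
    replace (turn c d a) with (turn b c d + turn d a b - turn a b c) by lra. field. assumption. }
  assert (Key : forall p,
    pa p = pa a + la * (pa c - pa a) -> pb p = pb a + la * (pb c - pb a) ->
    iso_angle a p / iso_angle c p * (iso_angle d p / iso_angle b p)
    = turn c d a * turn d a b / (turn a b c * turn b c d)).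
  { intros p Pa Pb.
    rewrite (iso_angle_scale a p la (pa a - pa c) (pb a - pb c)) by (assumption || (rewrite ?Pa, ?Pb; ring)).
    rewrite (iso_angle_scale c p (1 - la) (pa c - pa a) (pb c - pb a)) by (assumption || (rewrite ?Pa, ?Pb; ring) || (rewrite La; assumption)).
    rewrite (iso_angle_scale b p mu (pa b - pa d) (pb b - pb d)) by (assumption || (rewrite ?Pa, ?Pb, ?Ga, ?Gb; ring)).
    rewrite (iso_angle_scale d p (1 - mu) (pa d - pa b) (pb d - pb b)) by (assumption || (rewrite ?Pa, ?Pb, ?Ga, ?Gb; ring) || (rewrite Mu; assumption)).
    replace ((pa a - pa c) ^ 2 + (pb a - pb c) ^ 2) with ((pa c - pa a) ^ 2 + (pb c - pb a) ^ 2) by ring.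
    replace ((pa b - pa d) ^ 2 + (pb b - pb d) ^ 2) with ((pa d - pa b) ^ 2 + (pb d - pb b) ^ 2) by ring.
    assert (0 < sqrt ((pa c - pa a) ^ 2 + (pb c - pb a) ^ 2)).
    { apply sqrt_lt_R0, sum_sq_pos. destruct Wac; [left | right]; lra. }
    assert (0 < sqrt ((pa d - pa b) ^ 2 + (pb d - pb b) ^ 2)).
    { apply sqrt_lt_R0, sum_sq_pos. destruct Wbd; [left | right]; lra. }
    rewrite La, Mu. unfold la, mu. field. repeat split; lra || tauto. }
  split.
  - intros (p & P1 & P2 & ->).
    destruct (line_in_plane a c p Wac P1) as (k & K1 & K2 & _).
    destruct (line_in_plane b d p Wbd P2) as (l & L1 & L2 & _).
    assert (K : k = la).
    { unfold la. apply Rmult_eq_reg_r with (turn b c d + turn d a b); [|assumption].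
      transitivity (turn d a b); [|field; assumption].
      transitivity (turn d a b
         + (((pa a + k * (pa c - pa a)) - (pa b + l * (pa d - pa b))) * (pb d - pb b)
          - ((pb a + k * (pb c - pb a)) - (pb b + l * (pb d - pb b))) * (pa d - pa b))); [unfold turn; ring|].
      rewrite <- K1, <- K2, <- L1, <- L2. ring. }
    apply Key; [rewrite K1, K | rewrite K2, K]; reflexivity.
  - intros ->.
    exists (mkpl (pa a + la * (pa c - pa a)) (pb a + la * (pb c - pb a)) (pc a + la * (pc c - pc a))).
    assert (Gc : pc a + la * (pc c - pc a) = pc b + mu * (pc d - pc b)).
    { unfold ev in *.
      replace (pc b) with (pa a * x + pb a * y + pc a - pa b * x - pb b * y) by lra.
      replace (pc c) with (pa a * x + pb a * y + pc a - pa c * x - pb c * y) by lra.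
      replace (pc d) with (pa a * x + pb a * y + pc a - pa d * x - pb d * y) by lra.
      transitivity (pa a * x + pb a * y + pc a - (pa a + la * (pa c - pa a)) * x - (pb a + la * (pb c - pb a)) * y);
        [ring | rewrite Ga, Gb; ring]. }
    split; [|split].
    + unfold on_plane. simpl. intros X E1 E2.
      transitivity ((1 - la) * (pa a * px X + pb a * py X + pc a) + la * (pa c * px X + pb c * py X + pc c));
        [rewrite <- E1, <- E2; ring | ring].
    + unfold on_plane. simpl. intros X E1 E2. rewrite Ga, Gb, Gc.
      transitivity ((1 - mu) * (pa b * px X + pb b * py X + pc b) + mu * (pa d * px X + pb d * py X + pc d));
        [rewrite <- E1, <- E2; ring | ring].
    + symmetry. apply Key; reflexivity.
Qed.

(** * Pairs of adjacent quadrilaterals with parallel chords *)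

Lemma ratio_pair_inj P q S r : 0 < P -> 0 < q -> 0 < S -> 0 < r ->
  (/ q + P) / (q + P) = (/ r + S) / (r + S) -> (/ P - P) / (q + P) = (/ S - S) / (r + S) ->
  P = S /\ q = r.
Proof.
  intros P0 q0 S0 r0. set (rho := (/ r + S) / (r + S)). set (sg := (/ S - S) / (r + S)). intros E1 E2.
  assert (rho0 : 0 < rho).
  { unfold rho. apply Rdiv_lt_0_compat; [|lra]. assert (0 < / r) by (apply Rinv_0_lt_compat; assumption). lra. }
  assert (A1 : rho * q = P * (1 + sg)) by (rewrite <- E1, <- E2; field; lra).
  assert (A2 : rho * r = S * (1 + sg)) by (unfold rho, sg; field; lra).
  assert (B1 : sg * (q + P) * P = 1 - P ^ 2) by (rewrite <- E2; field; lra).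
  assert (B2 : sg * (r + S) * S = 1 - S ^ 2) by (unfold sg; field; lra).
  assert (s0 : 0 < 1 + sg).
  { apply Rmult_lt_reg_l with P; [assumption|]. rewrite <- A1, Rmult_0_r. apply Rmult_lt_0_compat; assumption. }
  assert (K : q * S = r * P).
  { apply Rmult_eq_reg_l with (rho * (1 + sg)); [|apply Rgt_not_eq, Rmult_lt_0_compat; assumption].
    transitivity ((rho * q) * (S * (1 + sg))); [ring|]. rewrite A1, <- A2. ring. }
  assert (PS : P = S).
  { apply square_eq; [apply Rmult_lt_0_compat; assumption|].
    assert (X : P ^ 2 * (1 - S ^ 2) = S ^ 2 * (1 - P ^ 2)); [|lra].
    rewrite <- B1, <- B2. transitivity (sg * P * S * (r * P + P * S)); [ring|]. rewrite <- K. ring. }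
  split; [exact PS|]. rewrite PS in K. apply Rmult_eq_reg_r with S; lra.
Qed.

(** For planes through one point the constant term is a fixed affine function of the gradient, so
    the Christoffel relation extends from gradients to the affine functions themselves. *)
Lemma shape_kernel_c a b c d x y p q : convex_planes a b c d ->
  ev b x y = ev a x y -> ev c x y = ev a x y -> ev d x y = ev a x y ->
  p = shape a b c d -> q = shape b c d a ->
  p * (pc c - pc b) + (pc a - pc d) / p - q * (pc d - pc c) - (pc b - pc a) / q = 0.
Proof.
  intros H Vb Vc Vd Ep Eq. destruct (shape_kernel a b c d p q H Ep Eq) as [Ka Kb].
  unfold ev in *.
  assert (P := shape_pos _ _ _ _ H). rewrite <- Ep in P.
  assert (Q := shape_pos _ _ _ _ (convex_planes_rot _ _ _ _ H)). rewrite <- Eq in Q.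
  replace (pc b) with (pa a * x + pb a * y + pc a - pa b * x - pb b * y) by lra.
  replace (pc c) with (pa a * x + pb a * y + pc a - pa c * x - pb c * y) by lra.
  replace (pc d) with (pa a * x + pb a * y + pc a - pa d * x - pb d * y) by lra.
  transitivity (- (p * (pa c - pa b) + (pa a - pa d) / p - q * (pa d - pa c) - (pa b - pa a) / q) * x
    - (p * (pb c - pb b) + (pb a - pb d) / p - q * (pb d - pb c) - (pb b - pb a) / q) * y).
  - field. lra.
  - rewrite Ka, Kb. ring.
Qed.

(** The function [a' - a] vanishes exactly over the line where the planes meet. Proportional
    differences with [k <> 0] thus mean that the two lines have the same top view, that is, lie in
    one isotropic plane. *)
Definition parallel_chords (a a' b b' : plane) : Prop :=
  exists k, pa b' - pa b = k * (pa a' - pa a) /\ pb b' - pb b = k * (pb a' - pb a) /\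
    pc b' - pc b = k * (pc a' - pc a).

(** The Christoffel relations express [b1 - b0] and [b2 - b1] through the affine functions
    [a1 - a0], [a2 - a1] and [b1 - a1], which are linearly independent. Comparing coefficients gives
    [rho1 = rho2] and [sg1 = sg2], and [ratio_pair_inj] recovers the parameters. *)
Lemma chord_parallel a0 a1 a2 b0 b1 b2 x1 y1 x2 y2 :
  convex_planes a0 a1 b1 b0 -> convex_planes a1 a2 b2 b1 ->
  ev a1 x1 y1 = ev a0 x1 y1 -> ev b1 x1 y1 = ev a0 x1 y1 -> ev b0 x1 y1 = ev a0 x1 y1 ->
  ev a2 x2 y2 = ev a1 x2 y2 -> ev b2 x2 y2 = ev a1 x2 y2 -> ev b1 x2 y2 = ev a1 x2 y2 ->
  (x1 <> x2 \/ y1 <> y2) ->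
  (parallel_chords a0 a2 b0 b2 <->
   shape a1 b1 b0 a0 = shape a2 b2 b1 a1 /\ shape a0 a1 b1 b0 * shape a1 a2 b2 b1 = 1).
Proof.
  intros H1 H2 V1 V2 V3 U1 U2 U3 Hne.
  set (p1 := shape a0 a1 b1 b0). set (q1 := shape a1 b1 b0 a0).
  set (p2 := shape a1 a2 b2 b1). set (q2 := shape a2 b2 b1 a1).
  assert (P1 := shape_pos _ _ _ _ H1). assert (Q1 := shape_pos _ _ _ _ (convex_planes_rot _ _ _ _ H1)).
  assert (P2 := shape_pos _ _ _ _ H2). assert (Q2 := shape_pos _ _ _ _ (convex_planes_rot _ _ _ _ H2)).
  fold p1 in P1. fold p2 in P2. fold q1 in Q1. fold q2 in Q2.
  destruct (shape_kernel _ _ _ _ p1 q1 H1 eq_refl eq_refl) as [K1a K1b].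
  destruct (shape_kernel _ _ _ _ p2 q2 H2 eq_refl eq_refl) as [K2a K2b].
  assert (K1c := shape_kernel_c _ _ _ _ _ _ p1 q1 H1 V1 V2 V3 eq_refl eq_refl).
  assert (K2c := shape_kernel_c _ _ _ _ _ _ p2 q2 H2 U1 U2 U3 eq_refl eq_refl).
  (* The coefficients of these expressions; the first quadrilateral enters with the inverse of [p1]
     because it meets the common edge from the opposite side. *)
  set (rho1 := (/ q1 + / p1) / (q1 + / p1)). set (sg1 := (p1 - / p1) / (q1 + / p1)).
  set (rho2 := (/ q2 + p2) / (q2 + p2)). set (sg2 := (/ p2 - p2) / (q2 + p2)).
  assert (I1 : 0 < / p1) by (apply Rinv_0_lt_compat; assumption).
  assert (S1 : forall u0 u1 v0 v1, p1 * (v1 - u1) + (u0 - v0) / p1 - q1 * (v0 - v1) - (u1 - u0) / q1 = 0 ->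
    v1 - v0 = rho1 * (u1 - u0) - sg1 * (v1 - u1)).
  { intros u0 u1 v0 v1 E. apply Rmult_eq_reg_l with (q1 + / p1); [|lra].
    transitivity ((/ q1 + / p1) * (u1 - u0) - (p1 - / p1) * (v1 - u1)
      + (p1 * (v1 - u1) + (u0 - v0) / p1 - q1 * (v0 - v1) - (u1 - u0) / q1)).
    - field. lra.
    - rewrite E. unfold rho1, sg1. field. repeat split; try lra.
      assert (0 < q1 * p1) by (apply Rmult_lt_0_compat; assumption). lra. }
  assert (S2 : forall u1 u2 v1 v2, p2 * (v2 - u2) + (u1 - v1) / p2 - q2 * (v1 - v2) - (u2 - u1) / q2 = 0 ->
    v2 - v1 = rho2 * (u2 - u1) + sg2 * (v1 - u1)).
  { intros u1 u2 v1 v2 E. apply Rmult_eq_reg_l with (q2 + p2); [|lra].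
    transitivity ((/ q2 + p2) * (u2 - u1) + (/ p2 - p2) * (v1 - u1)
      + (p2 * (v2 - u2) + (u1 - v1) / p2 - q2 * (v1 - v2) - (u2 - u1) / q2)).
    - field. lra.
    - rewrite E. unfold rho2, sg2. field. lra. }
  apply S1 in K1a, K1b, K1c. apply S2 in K2a, K2b, K2c.
  split.
  - intros (k & Ea & Eb & Ec).
    assert (La : (rho1 - k) * (pa a1 - pa a0) + (rho2 - k) * (pa a2 - pa a1) + (sg2 - sg1) * (pa b1 - pa a1) = 0) by lra.
    assert (Lb : (rho1 - k) * (pb a1 - pb a0) + (rho2 - k) * (pb a2 - pb a1) + (sg2 - sg1) * (pb b1 - pb a1) = 0) by lra.
    assert (Lc : (rho1 - k) * (pc a1 - pc a0) + (rho2 - k) * (pc a2 - pc a1) + (sg2 - sg1) * (pc b1 - pc a1) = 0) by lra.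
    destruct (convex_planes_nonzero _ _ _ _ H1) as (N1 & _).
    destruct (convex_planes_nonzero _ _ _ _ H2) as (_ & _ & _ & N2 & _).
    unfold ev in *.
    (* Only [a2 - a1] does not vanish at the first vertex. *)
    assert (W : (pa a2 - pa a1) * x1 + (pb a2 - pb a1) * y1 + (pc a2 - pc a1) <> 0).
    { intro W.
      destruct (det2_basis (x1 - x2) (y1 - y2) (pb b1 - pb a1) (pa a1 - pa b1) (pb a1 - pb a2) (pa a2 - pa a1))
        as [Z1 Z2].
      - intro E. apply N2. unfold turn. lra.
      - lra.
      - lra.
      - destruct Hne; lra. }
    assert (R2 : rho2 = k).
    { apply Rminus_diag_uniq. apply Rmult_eq_reg_r with ((pa a2 - pa a1) * x1 + (pb a2 - pb a1) * y1 + (pc a2 - pc a1)); [|exact W].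
      rewrite Rmult_0_l.
      transitivity (((rho1 - k) * (pa a1 - pa a0) + (rho2 - k) * (pa a2 - pa a1) + (sg2 - sg1) * (pa b1 - pa a1)) * x1
       + ((rho1 - k) * (pb a1 - pb a0) + (rho2 - k) * (pb a2 - pb a1) + (sg2 - sg1) * (pb b1 - pb a1)) * y1
       + ((rho1 - k) * (pc a1 - pc a0) + (rho2 - k) * (pc a2 - pc a1) + (sg2 - sg1) * (pc b1 - pc a1))
       - (rho1 - k) * ((pa a1 * x1 + pb a1 * y1 + pc a1) - (pa a0 * x1 + pb a0 * y1 + pc a0))
       - (sg2 - sg1) * ((pa b1 * x1 + pb b1 * y1 + pc b1) - (pa a1 * x1 + pb a1 * y1 + pc a1))); [ring|].
      rewrite La, Lb, Lc, V2, V1. ring. }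
    rewrite R2 in La, Lb.
    destruct (det2_basis (rho1 - k) (sg2 - sg1) (- (pb b1 - pb a1)) (pb a1 - pb a0) (- (pa b1 - pa a1)) (pa a1 - pa a0))
      as [Z1 Z2].
    + intro E. apply N1. unfold turn. lra.
    + lra.
    + lra.
    + destruct (ratio_pair_inj (/ p1) q1 p2 q2) as [E1 E2]; try assumption.
      * fold rho1. fold rho2. lra.
      * rewrite Rinv_inv. fold sg1. fold sg2. lra.
      * split; [exact E2|]. rewrite <- E1. field. lra.
  - intros [Eq Ep]. exists rho1.
    assert (E : p2 = / p1) by (apply Rmult_eq_reg_l with p1; [rewrite Ep; field; lra | lra]).
    assert (R : rho2 = rho1) by (unfold rho1, rho2; rewrite Eq, E; reflexivity).
    assert (S : sg2 = sg1) by (unfold sg1, sg2; rewrite Eq, E, Rinv_inv; reflexivity).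
    rewrite R, S in *. lra.
Qed.

(** * Convexity of the gradient quadrilateral of an admissible 4-hedral angle *)

Lemma sum_sq_pos3 u v w : ~ (u = 0 /\ v = 0 /\ w = 0) -> 0 < u ^ 2 + v ^ 2 + w ^ 2.
Proof.
  intro H. assert (U := pow2_ge_0 u). assert (V := pow2_ge_0 v). assert (W := pow2_ge_0 w).
  assert (Z : forall x, x ^ 2 = 0 -> x = 0) by (intros x Hx; apply Rsqr_0_uniq; unfold Rsqr; lra).
  apply Rnot_le_lt. intro L. apply H. repeat split; apply Z; lra.
Qed.

Lemma pos_parallel_scale u v : ~ is_zero u -> pos_parallel u v ->
  exists t, 0 < t /\ v = vscale t u.
Proof.
  destruct u as [u1 u2 u3], v as [v1 v2 v3]. unfold is_zero, pos_parallel, cross, dot, vscale. simpl.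
  intros Hu [(C1 & C2 & C3) D]. simpl in C1, C2, C3, D.
  assert (N := sum_sq_pos3 _ _ _ Hu).
  set (n := u1 ^ 2 + u2 ^ 2 + u3 ^ 2) in *. assert (Hn : n = u1 ^ 2 + u2 ^ 2 + u3 ^ 2) by reflexivity.
  clearbody n.
  exists ((u1 * v1 + u2 * v2 + u3 * v3) / n). split; [apply Rdiv_lt_0_compat; assumption|].
  f_equal; (apply Rmult_eq_reg_r with n; [|lra]).
  - transitivity ((u1 * v1 + u2 * v2 + u3 * v3) * u1 - u2 * (u1 * v2 - u2 * v1) + u3 * (u3 * v1 - u1 * v3));
      [rewrite Hn; ring | rewrite C3, C2; field; lra].
  - transitivity ((u1 * v1 + u2 * v2 + u3 * v3) * u2 + u1 * (u1 * v2 - u2 * v1) - u3 * (u2 * v3 - u3 * v2));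
      [rewrite Hn; ring | rewrite C3, C1; field; lra].
  - transitivity ((u1 * v1 + u2 * v2 + u3 * v3) * u3 - u1 * (u3 * v1 - u1 * v3) + u2 * (u2 * v3 - u3 * v2));
      [rewrite Hn; ring | rewrite C2, C1; field; lra].
Qed.

Lemma scale_pos_parallel u t : ~ is_zero u -> 0 < t -> pos_parallel u (vscale t u).
Proof.
  destruct u as [u1 u2 u3]. unfold is_zero, pos_parallel, cross, dot, vscale. simpl. intros Hu H.
  split; [repeat split; simpl; ring|].
  assert (N := sum_sq_pos3 _ _ _ Hu).
  assert (0 < t * (u1 ^ 2 + u2 ^ 2 + u3 ^ 2)) by (apply Rmult_lt_0_compat; assumption). lra.
Qed.

(** Explicit scale factors instead of parallelism make the four turns accessible to linear algebra
    and to linear maps. *)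
Lemma convex_quad_spec A B C D : convex_quad A B C D <->
  det3 (vsub B A) (vsub C A) (vsub D A) = 0 /\
  ~ is_zero (cross (vsub B A) (vsub C B)) /\
  exists t2 t3 t4, (0 < t2 /\ 0 < t3 /\ 0 < t4) /\
    cross (vsub C B) (vsub D C) = vscale t2 (cross (vsub B A) (vsub C B)) /\
    cross (vsub D C) (vsub A D) = vscale t3 (cross (vsub B A) (vsub C B)) /\
    cross (vsub A D) (vsub B A) = vscale t4 (cross (vsub B A) (vsub C B)).
Proof.
  unfold convex_quad. cbv zeta. split.
  - intros (H & N & P2 & P3 & P4). split; [assumption|]. split; [assumption|].
    destruct (pos_parallel_scale _ _ N P2) as (t2 & T2 & E2).
    destruct (pos_parallel_scale _ _ N P3) as (t3 & T3 & E3).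
    destruct (pos_parallel_scale _ _ N P4) as (t4 & T4 & E4).
    exists t2, t3, t4. auto.
  - intros (H & N & t2 & t3 & t4 & (T2 & T3 & T4) & E2 & E3 & E4).
    rewrite E2, E3, E4. repeat split; try assumption; apply scale_pos_parallel; assumption.
Qed.

Lemma kappa_of_orth u v x y : x <> 0 \/ y <> 0 -> u * x + v * y = 0 ->
  exists k, u = - k * y /\ v = k * x.
Proof.
  intros H E. assert (N := sum_sq_pos x y H).
  exists ((v * x - u * y) / (x ^ 2 + y ^ 2)).
  split; (apply Rmult_eq_reg_r with (x ^ 2 + y ^ 2); [|lra]).
  - transitivity (- (v * x - u * y) * y + (u * x + v * y) * x); [ring | rewrite E; field; lra].
  - transitivity ((v * x - u * y) * x + (u * x + v * y) * y); [ring | rewrite E; field; lra].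
Qed.

(** Coordinates are relative to the vertex of the angle. Admissibility makes the top views of the
    four rays wind around the origin, so the determinants [n0], ..., [n3] of consecutive rays have
    one sign. A gradient edge is a quarter turn of a ray times some [k], and the [k] also have one
    sign; each turn of gradients is a product of two of these and one [n]. *)
Lemma cone_convex_planes x0 y0 z0 x1 y1 z1 x2 y2 z2 x3 y3 z3 P0 P1 P2 P3 h t2 t3 t4 l0 l1 l2 l3 s :
  z0 = pa P0 * x0 + pb P0 * y0 -> z1 = pa P0 * x1 + pb P0 * y1 ->
  z1 = pa P1 * x1 + pb P1 * y1 -> z2 = pa P1 * x2 + pb P1 * y2 ->
  z2 = pa P2 * x2 + pb P2 * y2 -> z3 = pa P2 * x3 + pb P2 * y3 ->
  z3 = pa P3 * x3 + pb P3 * y3 -> z0 = pa P3 * x0 + pb P3 * y0 ->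
  h <> 0 -> 0 < t2 -> 0 < t3 -> 0 < t4 -> 0 < l0 -> 0 < l1 -> 0 < l2 -> 0 < l3 ->
  x0 * (y1 * z2 - z1 * y2) + y0 * (z1 * x2 - x1 * z2) + z0 * (x1 * y2 - y1 * x2) = h ->
  x1 * (y2 * z3 - z2 * y3) + y1 * (z2 * x3 - x2 * z3) + z1 * (x2 * y3 - y2 * x3) = t2 * h ->
  x2 * (y3 * z0 - z3 * y0) + y2 * (z3 * x0 - x3 * z0) + z2 * (x3 * y0 - y3 * x0) = t3 * h ->
  x3 * (y0 * z1 - z0 * y1) + y3 * (z0 * x1 - x0 * z1) + z3 * (x0 * y1 - y0 * x1) = t4 * h ->
  l0 * x0 + l1 * x1 + l2 * x2 + l3 * x3 = 0 -> l0 * y0 + l1 * y1 + l2 * y2 + l3 * y3 = 0 ->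
  l0 * z0 + l1 * z1 + l2 * z2 + l3 * z3 = s ->
  convex_planes P0 P1 P2 P3.
Proof.
  intros A0 A1 B1 B2 C2 C3 D3 D0 Hh T2 T3 T4 L0 L1 L2 L3 E0 E1 E2 E3 X Y Z.
  set (D := fun x y z x' y' z' x'' y'' z'' =>
    x * (y' * z'' - z' * y'') + y * (z' * x'' - x' * z'') + z * (x' * y'' - y' * x'')).
  (* The isotropic vector of length [s] is the combination of the four rays with weights [l0], ...,
     [l3]; expanding a spatial determinant along it gives the planar determinant of the top
     views. *)
  assert (DS : forall x y z x' y' z', s * (x * y' - y * x') = l0 * D x y z x' y' z' x0 y0 z0
    + l1 * D x y z x' y' z' x1 y1 z1 + l2 * D x y z x' y' z' x2 y2 z2 + l3 * D x y z x' y' z' x3 y3 z3).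
  { intros. rewrite <- Z. unfold D.
    transitivity ((l0 * z0 + l1 * z1 + l2 * z2 + l3 * z3) * (x * y' - y * x')
      - (l0 * x0 + l1 * x1 + l2 * x2 + l3 * x3) * (z * y' - y * z')
      + (l0 * y0 + l1 * y1 + l2 * y2 + l3 * y3) * (z * x' - x * z')); [rewrite X, Y; ring | ring]. }
  assert (N0 : s * (x0 * y1 - y0 * x1) = (l2 + l3 * t4) * h).
  { rewrite (DS x0 y0 z0 x1 y1 z1). transitivity (l2 * h + l3 * (t4 * h)); [|ring].
    rewrite <- E3, <- E0. unfold D. ring. }
  assert (N1 : s * (x1 * y2 - y1 * x2) = (l0 + l3 * t2) * h).
  { rewrite (DS x1 y1 z1 x2 y2 z2). transitivity (l0 * h + l3 * (t2 * h)); [|ring].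
    rewrite <- E1, <- E0. unfold D. ring. }
  assert (N2 : s * (x2 * y3 - y2 * x3) = (l0 * t3 + l1 * t2) * h).
  { rewrite (DS x2 y2 z2 x3 y3 z3). transitivity (l0 * (t3 * h) + l1 * (t2 * h)); [|ring].
    rewrite <- E2, <- E1. unfold D. ring. }
  assert (N3 : s * (x3 * y0 - y3 * x0) = (l1 * t4 + l2 * t3) * h).
  { rewrite (DS x3 y3 z3 x0 y0 z0). transitivity (l1 * (t4 * h) + l2 * (t3 * h)); [|ring].
    rewrite <- E2, <- E3. unfold D. ring. }
  set (n0 := x0 * y1 - y0 * x1) in *. set (n1 := x1 * y2 - y1 * x2) in *.
  set (n2 := x2 * y3 - y2 * x3) in *. set (n3 := x3 * y0 - y3 * x0) in *.
  assert (h2 : 0 < h * h) by (apply Rsqr_pos_lt; assumption).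
  assert (M34 : 0 < l3 * t4) by (apply Rmult_lt_0_compat; assumption).
  assert (M32 : 0 < l3 * t2) by (apply Rmult_lt_0_compat; assumption).
  assert (M03 : 0 < l0 * t3) by (apply Rmult_lt_0_compat; assumption).
  assert (M12 : 0 < l1 * t2) by (apply Rmult_lt_0_compat; assumption).
  assert (M14 : 0 < l1 * t4) by (apply Rmult_lt_0_compat; assumption).
  assert (M23 : 0 < l2 * t3) by (apply Rmult_lt_0_compat; assumption).
  assert (s0 : s <> 0).
  { intro S. rewrite S, Rmult_0_l in N0. symmetry in N0. apply Rmult_integral in N0. destruct N0; [lra | contradiction]. }
  assert (s2 : 0 < s * s) by (apply Rsqr_pos_lt; assumption).
  assert (sgn : forall u v k l, s * u = k * h -> s * v = l * h -> 0 < k -> 0 < l -> 0 < u * v).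
  { intros u v k l U V K L. apply Rmult_lt_reg_l with (s * s); [assumption|].
    replace (s * s * (u * v)) with ((s * u) * (s * v)) by ring. rewrite U, V, Rmult_0_r.
    replace (k * h * (l * h)) with (k * l * (h * h)) by ring.
    apply Rmult_lt_0_compat; [apply Rmult_lt_0_compat|]; assumption. }
  assert (n01 := sgn _ _ _ _ N0 N1 ltac:(lra) ltac:(lra)).
  assert (n12 := sgn _ _ _ _ N1 N2 ltac:(lra) ltac:(lra)).
  assert (n23 := sgn _ _ _ _ N2 N3 ltac:(lra) ltac:(lra)).
  assert (n30 := sgn _ _ _ _ N3 N0 ltac:(lra) ltac:(lra)).
  assert (nz : forall u v, 0 < u * v -> u <> 0) by (intros u v U V; rewrite V in U; lra).
  assert (top : forall u v u' v', u * v' - v * u' <> 0 -> u <> 0 \/ v <> 0).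
  { intros u v u' v' U. destruct (Req_dec u 0) as [u0|u0]; [|left; assumption].
    right. intro v0. apply U. rewrite u0, v0. ring. }
  (* Consecutive planes share a ray, so the difference of their gradients is orthogonal to the top
     view of that ray. *)
  destruct (kappa_of_orth (pa P1 - pa P0) (pb P1 - pb P0) x1 y1) as (k1 & K1 & K1');
    [apply (top _ _ x2 y2), (nz _ _ n12) | lra |].
  destruct (kappa_of_orth (pa P2 - pa P1) (pb P2 - pb P1) x2 y2) as (k2 & K2 & K2');
    [apply (top _ _ x3 y3), (nz _ _ n23) | lra |].
  destruct (kappa_of_orth (pa P3 - pa P2) (pb P3 - pb P2) x3 y3) as (k3 & K3 & K3');
    [apply (top _ _ x0 y0), (nz _ _ n30) | lra |].
  destruct (kappa_of_orth (pa P0 - pa P3) (pb P0 - pb P3) x0 y0) as (k0 & K0 & K0');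
    [apply (top _ _ x1 y1), (nz _ _ n01) | lra |].
  (* The height of the next ray over the previous plane, multiplied by the determinant [n0], is the
     volume [h]; this fixes the sign of [k1]. *)
  assert (F1 : h = k1 * (n0 * n1)).
  { rewrite <- E0, A0, A1, B2. transitivity (((pa P1 - pa P0) * x2 + (pb P1 - pb P0) * y2) * n0);
      [unfold n0, n1, n2, n3; ring | rewrite K1, K1'; unfold n0, n1; ring]. }
  assert (F2 : t2 * h = k2 * (n1 * n2)).
  { rewrite <- E1, B1, B2, C3. transitivity (((pa P2 - pa P1) * x3 + (pb P2 - pb P1) * y3) * n1);
      [unfold n0, n1, n2, n3; ring | rewrite K2, K2'; unfold n1, n2; ring]. }
  assert (F3 : t3 * h = k3 * (n2 * n3)).
  { rewrite <- E2, C2, C3, D0. transitivity (((pa P3 - pa P2) * x0 + (pb P3 - pb P2) * y0) * n2);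
      [unfold n0, n1, n2, n3; ring | rewrite K3, K3'; unfold n2, n3; ring]. }
  assert (F0 : t4 * h = k0 * (n3 * n0)).
  { rewrite <- E3, D3, D0, A1. transitivity (((pa P0 - pa P3) * x1 + (pb P0 - pb P3) * y1) * n3);
      [unfold n0, n1, n2, n3; ring | rewrite K0, K0'; unfold n3, n0; ring]. }
  assert (sgk : forall u v m n k l, k * h = u * m -> l * h = v * n -> 0 < m -> 0 < n -> 0 < k -> 0 < l -> 0 < u * v).
  { intros u v m n k l U V M N K L.
    assert (0 < m * n) by (apply Rmult_lt_0_compat; assumption).
    apply Rmult_lt_reg_l with (m * n); [assumption|].
    replace (m * n * (u * v)) with ((u * m) * (v * n)) by ring. rewrite <- U, <- V, Rmult_0_r.
    replace (k * h * (l * h)) with (k * l * (h * h)) by ring.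
    apply Rmult_lt_0_compat; [apply Rmult_lt_0_compat|]; assumption. }
  assert (F1' : 1 * h = k1 * (n0 * n1)) by lra.
  assert (k12 := sgk _ _ _ _ _ _ F1' F2 n01 n12 Rlt_0_1 T2).
  assert (k23 := sgk _ _ _ _ _ _ F2 F3 n12 n23 T2 T3).
  assert (k30 := sgk _ _ _ _ _ _ F3 F0 n23 n30 T3 T4).
  assert (k01 := sgk _ _ _ _ _ _ F0 F1' n30 n01 T4 Rlt_0_1).
  assert (W0 : turn P0 P1 P2 = k1 * k2 * n1) by (unfold turn; rewrite K1, K1', K2, K2'; unfold n1; ring).
  assert (W1 : turn P1 P2 P3 = k2 * k3 * n2) by (unfold turn; rewrite K2, K2', K3, K3'; unfold n2; ring).
  assert (W2 : turn P2 P3 P0 = k3 * k0 * n3) by (unfold turn; rewrite K3, K3', K0, K0'; unfold n3; ring).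
  assert (W3 : turn P3 P0 P1 = k0 * k1 * n0) by (unfold turn; rewrite K0, K0', K1, K1'; unfold n0; ring).
  unfold convex_planes. rewrite W0, W1, W2, W3.
  repeat split.
  - replace (k1 * k2 * n1 * (k2 * k3 * n2)) with (k1 * k2 * (k2 * k3) * (n1 * n2)) by ring.
    apply Rmult_lt_0_compat; [apply Rmult_lt_0_compat|]; assumption.
  - replace (k2 * k3 * n2 * (k3 * k0 * n3)) with (k2 * k3 * (k3 * k0) * (n2 * n3)) by ring.
    apply Rmult_lt_0_compat; [apply Rmult_lt_0_compat|]; assumption.
  - replace (k3 * k0 * n3 * (k0 * k1 * n0)) with (k3 * k0 * (k0 * k1) * (n3 * n0)) by ring.
    apply Rmult_lt_0_compat; [apply Rmult_lt_0_compat|]; assumption.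
Qed.

Lemma cone_convex O V0 V1 V2 V3 P0 P1 P2 P3 s l0 l1 l2 l3 :
  convex_quad V0 V1 V2 V3 -> det3 (vsub V0 O) (vsub V1 O) (vsub V2 O) <> 0 ->
  0 < l0 -> 0 < l1 -> 0 < l2 -> 0 < l3 -> l0 + l1 + l2 + l3 = 1 ->
  vadd O (vscale s e3) = vadd (vadd (vscale l0 V0) (vscale l1 V1)) (vadd (vscale l2 V2) (vscale l3 V3)) ->
  on_plane P0 O -> on_plane P0 V0 -> on_plane P0 V1 ->
  on_plane P1 O -> on_plane P1 V1 -> on_plane P1 V2 ->
  on_plane P2 O -> on_plane P2 V2 -> on_plane P2 V3 ->
  on_plane P3 O -> on_plane P3 V3 -> on_plane P3 V0 ->
  convex_planes P0 P1 P2 P3.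
Proof.
  intros HV Hd L0 L1 L2 L3 Ls Hs.
  apply convex_quad_spec in HV.
  destruct HV as (Cop & _ & t2 & t3 & t4 & (T2 & T3 & T4) & E2 & E3 & E4).
  destruct O as [ox oy oz], V0 as [x0 y0 z0], V1 as [x1 y1 z1], V2 as [x2 y2 z2], V3 as [x3 y3 z3].
  unfold on_plane, vsub, vadd, vscale, cross, det3, dot, e3 in *. simpl in *.
  intros. injection Hs as Hx Hy Hz. injection E2 as E2x E2y E2z.
  injection E3 as E3x E3y E3z. injection E4 as E4x E4y E4z.
  assert (Lo : forall w, l0 * w + l1 * w + l2 * w + l3 * w = w)
    by (intro w; transitivity ((l0 + l1 + l2 + l3) * w); [ring | rewrite Ls; ring]).
  assert (Lx := Lo ox). assert (Ly := Lo oy). assert (Lz := Lo oz).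
  match type of Hd with ?h <> 0 =>
    apply (cone_convex_planes (x0 - ox) (y0 - oy) (z0 - oz) (x1 - ox) (y1 - oy) (z1 - oz)
      (x2 - ox) (y2 - oy) (z2 - oz) (x3 - ox) (y3 - oy) (z3 - oz) P0 P1 P2 P3 h t2 t3 t4 l0 l1 l2 l3 s)
  end; try exact Hd; try reflexivity; try lra.
  - transitivity ((x1 - ox) * ((y2 - y1) * (z3 - z2) - (z2 - z1) * (y3 - y2))
      + (y1 - oy) * ((z2 - z1) * (x3 - x2) - (x2 - x1) * (z3 - z2))
      + (z1 - oz) * ((x2 - x1) * (y3 - y2) - (y2 - y1) * (x3 - x2))); [ring|].
    rewrite E2x, E2y, E2z. ring.
  - transitivity ((x2 - ox) * ((y3 - y2) * (z0 - z3) - (z3 - z2) * (y0 - y3))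
      + (y2 - oy) * ((z3 - z2) * (x0 - x3) - (x3 - x2) * (z0 - z3))
      + (z2 - oz) * ((x3 - x2) * (y0 - y3) - (y3 - y2) * (x0 - x3))); [ring|].
    rewrite E3x, E3y, E3z. ring.
  - transitivity ((x3 - ox) * ((y0 - y3) * (z1 - z0) - (z0 - z3) * (y1 - y0))
      + (y3 - oy) * ((z0 - z3) * (x1 - x0) - (x0 - x3) * (z1 - z0))
      + (z3 - oz) * ((x0 - x3) * (y1 - y0) - (y0 - y3) * (x1 - x0))); [ring|].
    (* Only here is coplanarity of the quadrilateral used: it lets the fourth vertex have the same
       product with the common normal as the first. *)
    rewrite E4x, E4y, E4z. symmetry.
    match type of Cop with ?c = 0 => match goal with |- ?l = ?r => transitivity (l + t4 * c); [rewrite Cop; ring | ring] end end.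
Qed.

(** * Dual-convex nets *)

Lemma flat_normal p A B D : on_plane p A -> on_plane p B -> on_plane p D ->
  let nv := cross (vsub B A) (vsub D A) in px nv = - pa p * pz nv /\ py nv = - pb p * pz nv.
Proof.
  unfold on_plane. intros HA HB HD. simpl. rewrite HA, HB, HD. split; ring.
Qed.

Lemma plane_through_unique p A B D : on_plane p A -> on_plane p B -> on_plane p D ->
  pz (cross (vsub B A) (vsub D A)) <> 0 -> plane_through A B D = p.
Proof.
  intros HA HB HD Hz. destruct (flat_normal p A B D HA HB HD) as [Ex Ey].
  unfold plane_through. cbv zeta. rewrite Ex, Ey.
  set (z := pz (cross (vsub B A) (vsub D A))) in *.
  replace (- (- pa p * z) / z) with (pa p) by (field; assumption).
  replace (- (- pb p * z) / z) with (pb p) by (field; assumption).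
  unfold on_plane in HA. rewrite HA. destruct p as [a b c]. simpl. f_equal. ring.
Qed.

Definition nonisotropic_faces (m n : nat) (F : net) : Prop :=
  forall k l, (k < m)%nat -> (l < n)%nat -> pz (face_normal F k l) <> 0 /\
    forall r, (r < 4)%nat -> on_plane (face_plane F k l) (face_vertex F k l r).

(** The normal of three points of [p] is its last coordinate times a fixed vector. Were that
    coordinate 0, the whole normal would vanish, against strict convexity at a corner. *)
Lemma face_plane_unique p F k l : convex_quad (F k l) (F (S k) l) (F (S k) (S l)) (F k (S l)) ->
  (forall r, (r < 4)%nat -> on_plane p (face_vertex F k l r)) ->
  face_plane F k l = p /\ pz (face_normal F k l) <> 0.
Proof.
  intros HQ H. assert (HA := H 0%nat ltac:(lia)). assert (HB := H 1%nat ltac:(lia)). assert (HD := H 3%nat ltac:(lia)).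
  simpl in HA, HB, HD.
  assert (Hz : pz (face_normal F k l) <> 0).
  { intro Z. apply convex_quad_spec in HQ.
    destruct HQ as (_ & N & t2 & t3 & t4 & (_ & _ & T4) & _ & _ & E4).
    destruct (flat_normal p _ _ _ HA HB HD) as [Ex Ey].
    unfold face_normal in Z. rewrite Z, Rmult_0_r in Ex, Ey.
    apply N.
    assert (E : cross (vsub (F (S k) l) (F k l)) (vsub (F k (S l)) (F k l)) =
      vscale t4 (cross (vsub (F (S k) l) (F k l)) (vsub (F (S k) (S l)) (F (S k) l)))).
    { rewrite <- E4. unfold cross, vsub. simpl. f_equal; ring. }
    rewrite E in Ex, Ey, Z. simpl in Ex, Ey, Z. unfold is_zero. simpl.
    repeat split; (apply Rmult_eq_reg_l with t4; [lra | lra]). }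
  split; [apply plane_through_unique; assumption | assumption].
Qed.

Definition vertex_planes (F : net) (i j : nat) : Prop :=
  convex_planes (around_plane F i j 0) (around_plane F i j 1) (around_plane F i j 2) (around_plane F i j 3).

(** As [m] and [n] are at least 2, each face is one of the four around some non-boundary vertex, and
    there dual convexity supplies a non-isotropic plane. *)
Lemma dual_convex_faces m n F : dual_convex m n F -> nonisotropic_faces m n F.
Proof.
  intros (Hm & Hn & (_ & _ & HN) & HD) k l Hk Hl.
  assert (E : exists i j r, non_boundary m n i j /\ (r < 4)%nat /\ around i j r = (k, l)).
  { destruct k as [|k], l as [|l].
    - exists 1%nat, 1%nat, 0%nat. unfold non_boundary. repeat split; lia.
    - exists 1%nat, (S l), 3%nat. unfold non_boundary. repeat split; lia.
    - exists (S k), 1%nat, 1%nat. unfold non_boundary. repeat split; lia.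
    - exists (S k), (S l), 2%nat. unfold non_boundary. repeat split; lia. }
  destruct E as (i & j & r & Hij & Hr & E).
  destruct (HD i j Hij) as (O & V & _ & _ & _ & H). destruct (H r Hr) as (p & Hp & _).
  rewrite E in Hp. simpl in Hp.
  destruct (face_plane_unique p F k l (HN k l Hk Hl) Hp) as [Ep Hz].
  split; [exact Hz|]. rewrite Ep. exact Hp.
Qed.

Lemma around_bounds m n i j r : non_boundary m n i j ->
  (fst (around i j r) < m)%nat /\ (snd (around i j r) < n)%nat.
Proof.
  unfold non_boundary. intro H. destruct r as [|[|[|r]]]; simpl; lia.
Qed.

Lemma dual_convex_vertex m n F i j : dual_convex m n F -> non_boundary m n i j -> vertex_planes F i j.
Proof.
  intros (Hm & Hn & (_ & _ & HN) & HD) Hij.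
  destruct (HD i j Hij) as (O & V & HV & Hd & (s & l0 & l1 & l2 & l3 & L0 & L1 & L2 & L3 & Ls & Hs) & H).
  assert (G : forall r, (r < 4)%nat -> on_plane (around_plane F i j r) O /\
     on_plane (around_plane F i j r) (V r) /\ on_plane (around_plane F i j r) (V (S r mod 4)%nat)).
  { intros r Hr. destruct (H r Hr) as (p & Hp & HO). destruct (around_bounds m n i j r Hij) as [B1 B2].
    destruct (face_plane_unique p F _ _ (HN _ _ B1 B2) Hp) as [Ep _].
    unfold around_plane. rewrite Ep. exact HO. }
  destruct (G 0%nat ltac:(lia)) as (G00 & G01 & G02). destruct (G 1%nat ltac:(lia)) as (G10 & G11 & G12).
  destruct (G 2%nat ltac:(lia)) as (G20 & G21 & G22). destruct (G 3%nat ltac:(lia)) as (G30 & G31 & G32).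
  apply (cone_convex O (V 0%nat) (V 1%nat) (V 2%nat) (V 3%nat) _ _ _ _ s l0 l1 l2 l3); assumption.
Qed.

Lemma non_boundary_inside m n i j : non_boundary m n i j <-> inside (m - 1) (n - 1) i j.
Proof. unfold non_boundary, inside. lia. Qed.

Lemma around_plane_S F i j :
  around_plane F (S i) (S j) 0 = face_plane F i j /\ around_plane F (S i) (S j) 1 = face_plane F (S i) j /\
  around_plane F (S i) (S j) 2 = face_plane F (S i) (S j) /\ around_plane F (S i) (S j) 3 = face_plane F i (S j).
Proof. unfold around_plane, around. simpl. rewrite !Nat.sub_0_r. auto. Qed.

Lemma on_plane_ev p X : on_plane p X <-> ev p (px X) (py X) = pz X.
Proof. unfold on_plane, ev. split; auto. Qed.

Lemma around_plane_vertex m n F i j r : nonisotropic_faces m n F -> non_boundary m n i j -> (r < 4)%nat ->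
  ev (around_plane F i j r) (px (F i j)) (py (F i j)) = pz (F i j).
Proof.
  intros HF H Hr. destruct (around_bounds m n i j r H) as [B1 B2].
  apply on_plane_ev. destruct (HF _ _ B1 B2) as [_ G].
  destruct i as [|i]; [unfold non_boundary in H; lia|]. destruct j as [|j]; [unfold non_boundary in H; lia|].
  unfold around_plane. destruct r as [|[|[|[|r]]]]; [ | | | | lia]; simpl in *; rewrite ?Nat.sub_0_r in *.
  - apply (G 2%nat). lia.
  - apply (G 3%nat). lia.
  - apply (G 0%nat). lia.
  - apply (G 1%nat). lia.
Qed.

(** The squares of [net_p] and [net_q] are the opposite ratios towards the vertices of indices
    [(i - 1, j)] and [(i, j - 1)]; the opposite edges have the inverse ratios. *)
Definition net_p (F : net) (i j : nat) : R :=
  shape (around_plane F i j 0) (around_plane F i j 1) (around_plane F i j 2) (around_plane F i j 3).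
Definition net_q (F : net) (i j : nat) : R :=
  shape (around_plane F i j 1) (around_plane F i j 2) (around_plane F i j 3) (around_plane F i j 0).

Lemma net_pq_pos m n F i j : dual_convex m n F -> non_boundary m n i j -> 0 < net_p F i j /\ 0 < net_q F i j.
Proof.
  intros HD H. assert (C := dual_convex_vertex m n F i j HD H). split; apply shape_pos.
  - exact C.
  - apply convex_planes_rot, C.
Qed.

Lemma opp_ratio_net m n F i j r : dual_convex m n F -> non_boundary m n i j ->
  (opp_ratio_at F i j 0 r <-> r = net_p F i j ^ 2) /\
  (opp_ratio_at F i j 1 r <-> r = net_q F i j ^ 2) /\
  (opp_ratio_at F i j 2 r <-> r = (/ net_p F i j) ^ 2) /\
  (opp_ratio_at F i j 3 r <-> r = (/ net_q F i j) ^ 2).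
Proof.
  intros HD H. assert (C := dual_convex_vertex m n F i j HD H).
  assert (HF := dual_convex_faces m n F HD).
  assert (V := fun r => around_plane_vertex m n F i j r HF H).
  assert (V0 := V 0%nat ltac:(lia)). assert (V1 := V 1%nat ltac:(lia)).
  assert (V2 := V 2%nat ltac:(lia)). assert (V3 := V 3%nat ltac:(lia)). clear V.
  assert (C1 := convex_planes_rot _ _ _ _ C). assert (C2 := convex_planes_rot _ _ _ _ C1).
  assert (C3 := convex_planes_rot _ _ _ _ C2).
  unfold opp_ratio_at, net_p, net_q. simpl.
  rewrite <- (shape_opposite _ _ _ _ C), <- (shape_opposite _ _ _ _ C1).
  repeat apply conj; apply (opp_ratio_shape _ _ _ _ (px (F i j)) (py (F i j))); try assumption; congruence.
Qed.

(** * Conditions (i) and (ii) in terms of the parameters of the vertices *)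

Lemma sq_inv_eq x y : 0 < x -> 0 < y -> (/ x) ^ 2 = y ^ 2 <-> x * y = 1.
Proof.
  intros Hx Hy. assert (Ix : 0 < / x) by (apply Rinv_0_lt_compat; assumption). split; intro E.
  - apply square_eq in E; [|apply Rmult_lt_0_compat; assumption]. rewrite <- E. field. lra.
  - replace (/ x) with y; [reflexivity|]. apply Rmult_eq_reg_l with x; [|lra]. rewrite E. field. lra.
Qed.

Lemma equal_opp_ratios_spec m n F : dual_convex m n F ->
  ((forall i j, non_boundary m n i j -> non_boundary m n (S i) j ->
       exists r, opp_ratio_at F i j 2 r /\ opp_ratio_at F (S i) j 0 r) /\
   (forall i j, non_boundary m n i j -> non_boundary m n i (S j) ->
       exists r, opp_ratio_at F i j 3 r /\ opp_ratio_at F i (S j) 1 r)) <->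
  ((forall i j, inside (m - 1) (n - 1) i j -> inside (m - 1) (n - 1) (S i) j ->
      net_p F i j * net_p F (S i) j = 1) /\
   (forall i j, inside (m - 1) (n - 1) i j -> inside (m - 1) (n - 1) i (S j) ->
      net_q F i j * net_q F i (S j) = 1)).
Proof.
  intro HD.
  assert (X : forall i j i' j' s s' x y, 0 < x -> 0 < y ->
    (forall r, opp_ratio_at F i j s r <-> r = (/ x) ^ 2) -> (forall r, opp_ratio_at F i' j' s' r <-> r = y ^ 2) ->
    (exists r, opp_ratio_at F i j s r /\ opp_ratio_at F i' j' s' r) <-> x * y = 1).
  { intros i j i' j' s s' x y Hx Hy E E'. rewrite <- (sq_inv_eq x y Hx Hy). split.
    - intros (r & R1 & R2). apply E in R1. apply E' in R2. congruence.
    - intro Z. exists (y ^ 2). split; [apply E; symmetry; exact Z | apply E'; reflexivity]. }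
  assert (Xp : forall i j, non_boundary m n i j -> non_boundary m n (S i) j ->
    (exists r, opp_ratio_at F i j 2 r /\ opp_ratio_at F (S i) j 0 r) <-> net_p F i j * net_p F (S i) j = 1).
  { intros i j L1 L2. apply X; try assumption; try (apply (net_pq_pos m n); assumption);
      intro r; apply (opp_ratio_net m n F); assumption. }
  assert (Xq : forall i j, non_boundary m n i j -> non_boundary m n i (S j) ->
    (exists r, opp_ratio_at F i j 3 r /\ opp_ratio_at F i (S j) 1 r) <-> net_q F i j * net_q F i (S j) = 1).
  { intros i j L1 L2. apply X; try assumption; try (apply (net_pq_pos m n); assumption);
      intro r; apply (opp_ratio_net m n F); assumption. }
  split; intros [H1 H2]; split; intros i j L1 L2.
  - apply non_boundary_inside in L1, L2. apply Xp; auto.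
  - apply non_boundary_inside in L1, L2. apply Xq; auto.
  - apply Xp; try assumption. apply H1; apply non_boundary_inside; assumption.
  - apply Xq; try assumption. apply H2; apply non_boundary_inside; assumption.
Qed.

(** An isotropic plane contains the line of intersection exactly when its equation is a multiple of
    [w l - u l]. Hence all lines share one such plane if and only if consecutive differences are
    proportional. *)
Lemma strip_isotropic K (u w : nat -> plane) :
  (forall l, (l < K)%nat -> pa (u l) <> pa (w l) \/ pb (u l) <> pb (w l)) -> (1 <= K)%nat ->
  ((exists a b c, (a <> 0 \/ b <> 0) /\ forall l, (l < K)%nat -> forall X,
      on_plane (u l) X -> on_plane (w l) X -> in_iso_plane a b c X) <->
   (forall l, (S l < K)%nat -> parallel_chords (u l) (w l) (u (S l)) (w (S l)))).
Proof.
  intros Hne HK. split.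
  - intros (a & b & c & Hab & H).
    assert (G : forall l, (l < K)%nat -> exists k, k <> 0 /\ a = k * (pa (w l) - pa (u l)) /\
       b = k * (pb (w l) - pb (u l)) /\ - c = k * (pc (w l) - pc (u l))).
    { intros l Hl.
      destruct (affine_zero_line (pa (w l) - pa (u l)) (pb (w l) - pb (u l)) (pc (w l) - pc (u l)) a b (- c))
        as (k & E1 & E2 & E3).
      - destruct (Hne l Hl); [left | right]; lra.
      - intros x y E. assert (X := H l Hl (mkpt x y (ev (u l) x y))).
        unfold on_plane, in_iso_plane, ev in X. simpl in X. specialize (X eq_refl). lra.
      - exists k. repeat split; try assumption. intro Z. rewrite Z in E1, E2. destruct Hab; lra. }
    intros l Hl. destruct (G l ltac:(lia)) as (k & K0 & A1 & A2 & A3).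
    destruct (G (S l) Hl) as (k' & K0' & B1 & B2 & B3).
    exists (k / k'). repeat split; (apply Rmult_eq_reg_l with k'; [|assumption]).
    + rewrite <- B1, A1. field. assumption.
    + rewrite <- B2, A2. field. assumption.
    + rewrite <- B3, A3. field. assumption.
  - intro H.
    exists (pa (w O) - pa (u O)), (pb (w O) - pb (u O)), (- (pc (w O) - pc (u O))).
    split; [destruct (Hne O ltac:(lia)); [left | right]; lra|].
    assert (G : forall l, (l < K)%nat -> parallel_chords (u O) (w O) (u l) (w l)).
    { induction l as [|l IH]; intro Hl; [exists 1; repeat split; ring|].
      destruct (IH ltac:(lia)) as (k & E1 & E2 & E3). destruct (H l Hl) as (k' & F1 & F2 & F3).
      exists (k' * k). rewrite F1, F2, F3, E1, E2, E3. repeat split; ring. }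
    intros l Hl X HX1 HX2. destruct (G l Hl) as (k & E1 & E2 & E3).
    assert (k0 : k <> 0) by (intro Z; rewrite Z in E1, E2; destruct (Hne l Hl); lra).
    unfold on_plane, in_iso_plane in *. apply Rmult_eq_reg_l with k; [|assumption].
    transitivity ((pa (w l) - pa (u l)) * px X + (pb (w l) - pb (u l)) * py X); [rewrite E1, E2; ring|].
    transitivity (- (pc (w l) - pc (u l))); [lra | rewrite E3; ring].
Qed.

Lemma convex_planes_reverse a b c d : convex_planes a b c d -> convex_planes a d c b.
Proof.
  intro H. destruct (convex_planes_rot _ _ _ _ H) as (_ & _ & H4).
  destruct H as (H1 & H2 & H3). unfold convex_planes.
  assert (T : forall x y z, turn z y x = - turn x y z) by (intros; unfold turn; ring).
  rewrite (T c d a), (T b c d), (T a b c), (T d a b). repeat split; lra.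
Qed.

Lemma nonparallel_gradients m n F k l k' l' : nonisotropic_faces m n F ->
  (k < m)%nat -> (l < n)%nat -> (k' < m)%nat -> (l' < n)%nat ->
  ~ is_zero (cross (face_normal F k l) (face_normal F k' l')) ->
  pa (face_plane F k l) <> pa (face_plane F k' l') \/ pb (face_plane F k l) <> pb (face_plane F k' l').
Proof.
  intros HF K L K' L' H. apply NNPP. intro N. apply not_or_and in N. destruct N as [N1 N2].
  apply NNPP in N1. apply NNPP in N2. apply H.
  destruct (HF k l K L) as [_ G]. destruct (HF k' l' K' L') as [_ G'].
  destruct (flat_normal _ _ _ _ (G 0%nat ltac:(lia)) (G 1%nat ltac:(lia)) (G 3%nat ltac:(lia))) as [Ex Ey].
  destruct (flat_normal _ _ _ _ (G' 0%nat ltac:(lia)) (G' 1%nat ltac:(lia)) (G' 3%nat ltac:(lia))) as [Ex' Ey'].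
  change (px (face_normal F k l) = - pa (face_plane F k l) * pz (face_normal F k l)) in Ex.
  change (py (face_normal F k l) = - pb (face_plane F k l) * pz (face_normal F k l)) in Ey.
  change (px (face_normal F k' l') = - pa (face_plane F k' l') * pz (face_normal F k' l')) in Ex'.
  change (py (face_normal F k' l') = - pb (face_plane F k' l') * pz (face_normal F k' l')) in Ey'.
  destruct (face_normal F k l) as [a1 a2 a3], (face_normal F k' l') as [b1 b2 b3].
  unfold is_zero. simpl in *. rewrite Ex, Ey, Ex', Ey', N1, N2. repeat split; ring.
Qed.

Definition pairwise_nonparallel (m n : nat) (F : net) : Prop :=
  forall k l k' l', (k < m)%nat -> (l < n)%nat -> (k' < m)%nat -> (l' < n)%nat ->
     (k, l) <> (k', l') -> ~ is_zero (cross (face_normal F k l) (face_normal F k' l')).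

Lemma face_top_edges F k l : pz (face_normal F k l) <> 0 ->
  (px (F k l) <> px (F (S k) l) \/ py (F k l) <> py (F (S k) l)) /\
  (px (F k l) <> px (F k (S l)) \/ py (F k l) <> py (F k (S l))).
Proof.
  intro H. simpl in H. split; apply NNPP; intro N; apply not_or_and in N; destruct N as [N1 N2];
    apply NNPP in N1; apply NNPP in N2; apply H; rewrite N1, N2; ring.
Qed.

Lemma vertex_planes_S m n F i j : dual_convex m n F -> (S i < m)%nat -> (S j < n)%nat ->
  convex_planes (face_plane F i j) (face_plane F (S i) j) (face_plane F (S i) (S j)) (face_plane F i (S j)).
Proof.
  intros HD Hi Hj. destruct (around_plane_S F i j) as (<- & <- & <- & <-).
  apply (dual_convex_vertex m n); [assumption | unfold non_boundary; lia].
Qed.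

Lemma net_pq_S F i j :
  net_p F (S i) (S j) = shape (face_plane F i j) (face_plane F (S i) j) (face_plane F (S i) (S j)) (face_plane F i (S j)) /\
  net_q F (S i) (S j) = shape (face_plane F (S i) j) (face_plane F (S i) (S j)) (face_plane F i (S j)) (face_plane F i j).
Proof. destruct (around_plane_S F i j) as (<- & <- & <- & <-). split; reflexivity. Qed.

Lemma face_planes_vertex m n F i j : nonisotropic_faces m n F -> (S i < m)%nat -> (S j < n)%nat ->
  let z := pz (F (S i) (S j)) in let v p := ev p (px (F (S i) (S j))) (py (F (S i) (S j))) in
  v (face_plane F i j) = z /\ v (face_plane F (S i) j) = z /\
  v (face_plane F (S i) (S j)) = z /\ v (face_plane F i (S j)) = z.
Proof.
  intros HF Hi Hj z v. destruct (around_plane_S F i j) as (<- & <- & <- & <-).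
  repeat split; apply (around_plane_vertex m n); try assumption; try lia; unfold non_boundary; lia.
Qed.

Lemma chord_columns m n F k l : dual_convex m n F -> (S (S k) < m)%nat -> (S l < n)%nat ->
  (parallel_chords (face_plane F k l) (face_plane F (S (S k)) l) (face_plane F k (S l)) (face_plane F (S (S k)) (S l)) <->
   net_q F (S k) (S l) = net_q F (S (S k)) (S l) /\ net_p F (S k) (S l) * net_p F (S (S k)) (S l) = 1).
Proof.
  intros HD Hk Hl. assert (HF := dual_convex_faces m n F HD).
  destruct (net_pq_S F k l) as [-> ->]. destruct (net_pq_S F (S k) l) as [-> ->].
  destruct (face_planes_vertex m n F k l HF ltac:(lia) Hl) as (V0 & V1 & V2 & V3).
  destruct (face_planes_vertex m n F (S k) l HF Hk Hl) as (U0 & U1 & U2 & U3).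
  apply (chord_parallel _ _ _ _ _ _ (px (F (S k) (S l))) (py (F (S k) (S l)))
     (px (F (S (S k)) (S l))) (py (F (S (S k)) (S l)))); try congruence.
  - apply (vertex_planes_S m n); try assumption; lia.
  - apply (vertex_planes_S m n); assumption.
  - apply face_top_edges. apply HF; lia.
Qed.

(** Exchanging the two directions reverses the cyclic order of the faces around a vertex;
    [shape_reverse] translates the parameters. *)
Lemma chord_rows m n F k l : dual_convex m n F -> (S k < m)%nat -> (S (S l) < n)%nat ->
  (parallel_chords (face_plane F k l) (face_plane F k (S (S l))) (face_plane F (S k) l) (face_plane F (S k) (S (S l))) <->
   net_p F (S k) (S l) = net_p F (S k) (S (S l)) /\ net_q F (S k) (S l) * net_q F (S k) (S (S l)) = 1).
Proof.
  intros HD Hk Hl. assert (HF := dual_convex_faces m n F HD).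
  destruct (net_pq_S F k l) as [-> ->]. destruct (net_pq_S F k (S l)) as [-> ->].
  destruct (face_planes_vertex m n F k l HF Hk ltac:(lia)) as (V0 & V1 & V2 & V3).
  destruct (face_planes_vertex m n F k (S l) HF Hk Hl) as (U0 & U1 & U2 & U3).
  rewrite <- (shape_reverse (face_plane F k l) (face_plane F (S k) l)),
    <- (shape_reverse (face_plane F k (S l)) (face_plane F k l)),
    <- (shape_reverse (face_plane F k (S l)) (face_plane F (S k) (S l))),
    <- (shape_reverse (face_plane F k (S (S l))) (face_plane F k (S l))).
  apply (chord_parallel _ _ _ _ _ _ (px (F (S k) (S l))) (py (F (S k) (S l)))
     (px (F (S k) (S (S l)))) (py (F (S k) (S (S l))))); try congruence.
  - apply convex_planes_reverse, (vertex_planes_S m n); try assumption; lia.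
  - apply convex_planes_reverse, (vertex_planes_S m n); assumption.
  - apply face_top_edges. apply HF; lia.
Qed.

Lemma isotropic_columns_spec m n F : dual_convex m n F -> pairwise_nonparallel m n F ->
  ((forall k, (k + 3 <= m)%nat ->
       exists a b c, (a <> 0 \/ b <> 0) /\
         forall l, (l < n)%nat -> forall X,
           on_plane (face_plane F k l) X -> on_plane (face_plane F (k + 2) l) X ->
           in_iso_plane a b c X) <->
   (forall i j, inside (m - 1) (n - 1) i j -> inside (m - 1) (n - 1) (S i) j ->
      mirror (transp (net_q F)) (transp (net_p F)) j i)).
Proof.
  intros HD HP. assert (HF := dual_convex_faces m n F HD).
  assert (Hn : (2 <= n)%nat) by apply HD.
  assert (S1 : forall k, (k + 3 <= m)%nat -> _ <-> _) by
    (intros k Hk; apply (strip_isotropic n (face_plane F k) (face_plane F (k + 2))); [|lia];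
     intros l Hl; apply (nonparallel_gradients m n); try assumption; try lia;
     apply HP; try lia; intro E; injection E; lia).
  unfold mirror, transp. split; intro H.
  - intros [|i] [|j] L1 L2; try (unfold inside in *; lia).
    apply (chord_columns m n); try assumption; try (unfold inside in *; lia).
    replace (S (S i)) with (i + 2)%nat by lia.
    apply (proj1 (S1 i ltac:(unfold inside in *; lia)) (H i ltac:(unfold inside in *; lia))). unfold inside in *; lia.
  - intros k Hk. apply S1; [assumption|]. intros l Hl.
    replace (k + 2)%nat with (S (S k)) by lia.
    apply (chord_columns m n); try assumption; try lia.
    apply H; unfold inside; lia.
Qed.

Lemma isotropic_rows_spec m n F : dual_convex m n F -> pairwise_nonparallel m n F ->
  ((forall l, (l + 3 <= n)%nat ->
       exists a b c, (a <> 0 \/ b <> 0) /\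
         forall k, (k < m)%nat -> forall X,
           on_plane (face_plane F k l) X -> on_plane (face_plane F k (l + 2)) X ->
           in_iso_plane a b c X) <->
   (forall i j, inside (m - 1) (n - 1) i j -> inside (m - 1) (n - 1) i (S j) ->
      mirror (net_p F) (net_q F) i j)).
Proof.
  intros HD HP. assert (HF := dual_convex_faces m n F HD).
  assert (Hm : (2 <= m)%nat) by apply HD.
  assert (S1 : forall l, (l + 3 <= n)%nat -> _ <-> _) by
    (intros l Hl; apply (strip_isotropic m (fun k => face_plane F k l) (fun k => face_plane F k (l + 2))); [|lia];
     intros k Hk; apply (nonparallel_gradients m n); try assumption; try lia;
     apply HP; try lia; intro E; injection E; lia).
  unfold mirror. split; intro H.
  - intros [|i] [|j] L1 L2; try (unfold inside in *; lia).
    apply (chord_rows m n); try assumption; try (unfold inside in *; lia).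
    replace (S (S j)) with (j + 2)%nat by lia.
    apply (proj1 (S1 j ltac:(unfold inside in *; lia)) (H j ltac:(unfold inside in *; lia))). unfold inside in *; lia.
  - intros l Hl. apply S1; [assumption|]. intros k Hk.
    replace (l + 2)%nat with (S (S l)) by lia.
    apply (chord_rows m n); try assumption; try lia.
    apply H; unfold inside; lia.
Qed.

(** * Deformations from edge factors *)

Lemma curvature_turn F i j : curvature F i j = / 2 *
  (turn (around_plane F i j 0) (around_plane F i j 1) (around_plane F i j 2)
   + turn (around_plane F i j 2) (around_plane F i j 3) (around_plane F i j 0)).
Proof. unfold curvature, det2, top, dual_point, turn. simpl. ring. Qed.

Lemma turn_scale a b c a' b' c' x y :
  pa b' - pa a' = x * (pa b - pa a) -> pb b' - pb a' = x * (pb b - pb a) ->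
  pa c' - pa b' = y * (pa c - pa b) -> pb c' - pb b' = y * (pb c - pb b) ->
  turn a' b' c' = x * y * turn a b c.
Proof. intros E1 E2 E3 E4. unfold turn. rewrite E1, E2, E3, E4. ring. Qed.

Lemma quad_factors_closed_c a b c d x y x1 x2 x3 x4 : convex_planes a b c d ->
  ev b x y = ev a x y -> ev c x y = ev a x y -> ev d x y = ev a x y ->
  quad_factors (shape a b c d) (shape b c d a) x1 x2 x3 x4 ->
  x1 * (pc b - pc a) + x2 * (pc c - pc b) + x3 * (pc d - pc c) + x4 * (pc a - pc d) = 0.
Proof.
  intros H Vb Vc Vd HQ. destruct (quad_factors_closed a b c d x1 x2 x3 x4 H HQ) as (Ca & Cb & _).
  unfold ev in *.
  replace (pc b) with (pa a * x + pb a * y + pc a - pa b * x - pb b * y) by lra.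
  replace (pc c) with (pa a * x + pb a * y + pc a - pa c * x - pb c * y) by lra.
  replace (pc d) with (pa a * x + pb a * y + pc a - pa d * x - pb d * y) by lra.
  transitivity (- (x1 * (pa b - pa a) + x2 * (pa c - pa b) + x3 * (pa d - pa c) + x4 * (pa a - pa d)) * x
    - (x1 * (pb b - pb a) + x2 * (pb c - pb b) + x3 * (pb d - pb c) + x4 * (pb a - pb d)) * y).
  - ring.
  - rewrite Ca, Cb. ring.
Qed.

(** Given edge factors [A], [B], the coefficient [c] of the affine function to be added over the face [(k, l)], summed
    along the path of faces [(0, 0), ..., (k, 0), ..., (k, l)]. *)
Fixpoint incr_col (c : plane -> R) (F : net) (B : nat -> nat -> R) (k : nat) : R :=
  match k with
  | O => 0
  | S k' => incr_col c F B k' + (B (S k') O - 1) * (c (face_plane F (S k') O) - c (face_plane F k' O))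
  end.

Fixpoint incr (c : plane -> R) (F : net) (A B : nat -> nat -> R) (k l : nat) : R :=
  match l with
  | O => incr_col c F B k
  | S l' => incr c F A B k l' + (A k (S l') - 1) * (c (face_plane F k (S l')) - c (face_plane F k l'))
  end.

(** Path independence of the sum: moving the path across one vertex changes nothing because the
    scaled gradient quadrilateral there closes up. *)
Lemma incr_exchange c F A B k l :
  (forall l', (l' < l)%nat ->
    B (S k) l' * (c (face_plane F (S k) l') - c (face_plane F k l'))
    + A (S k) (S l') * (c (face_plane F (S k) (S l')) - c (face_plane F (S k) l'))
    + B (S k) (S l') * (c (face_plane F k (S l')) - c (face_plane F (S k) (S l')))
    + A k (S l') * (c (face_plane F k l') - c (face_plane F k (S l'))) = 0) ->
  incr c F A B (S k) l - incr c F A B k l = (B (S k) l - 1) * (c (face_plane F (S k) l) - c (face_plane F k l)).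
Proof.
  induction l as [|l IH]; intro H; simpl; [ring|].
  assert (E := IH (fun l' L => H l' (Nat.lt_lt_succ_r _ _ L))). assert (C := H l (Nat.lt_succ_diag_r l)). lra.
Qed.

Lemma incr_zero c F A B m n : (forall i j, (i < m)%nat -> (1 <= j < n)%nat -> A i j = 1) ->
  (forall i j, (1 <= i < m)%nat -> (j < n)%nat -> B i j = 1) ->
  forall k l, (k < m)%nat -> (l < n)%nat -> incr c F A B k l = 0.
Proof.
  intros HA HB k l Hk. induction l as [|l IH]; intro Hl; simpl.
  - induction k as [|k IHk]; simpl; [reflexivity|]. rewrite IHk, HB by lia. ring.
  - rewrite IH, HA by lia. ring.
Qed.

Lemma incr_continuity c F A B m n :
  (forall i j, (i < m)%nat -> (1 <= j < n)%nat -> continuity (fun t => A t i j)) ->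
  (forall i j, (1 <= i < m)%nat -> (j < n)%nat -> continuity (fun t => B t i j)) ->
  forall k l, (k < m)%nat -> (l < n)%nat -> continuity (fun t => incr c F (A t) (B t) k l).
Proof.
  intros HA HB k l Hk. induction l as [|l IH]; intro Hl; simpl.
  - induction k as [|k IHk]; simpl; [apply continuity_cst|].
    assert (C1 := IHk ltac:(lia)). assert (C2 := HB (S k) O ltac:(lia) ltac:(lia)). cont_tac.
  - assert (C1 := IH ltac:(lia)). assert (C2 := HA k (S l) ltac:(lia) ltac:(lia)). cont_tac.
Qed.

Definition incr_plane (F : net) (A B : nat -> nat -> R) (k l : nat) : plane :=
  mkpl (incr pa F A B k l) (incr pb F A B k l) (incr pc F A B k l).

(** The minima assign a face also to the boundary vertices with [i = m] or [j = n], which are not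
    the first vertex of any face. *)
Definition lift_height (m n : nat) (F : net) (A B : nat -> nat -> R) (i j : nat) : R :=
  ev (incr_plane F A B (Nat.min i (m - 1)) (Nat.min j (n - 1))) (px (F i j)) (py (F i j)).

Definition lift_net (m n : nat) (F : net) (A B : nat -> nat -> R) : net :=
  fun i j => mkpt (px (F i j)) (py (F i j)) (pz (F i j) + lift_height m n F A B i j).

Definition closed_factors (m n : nat) (F : net) (A B : nat -> nat -> R) : Prop :=
  forall i j, non_boundary m n i j ->
    quad_factors (net_p F i j) (net_q F i j) (B i (j - 1)%nat) (A i j) (B i j) (A (i - 1)%nat j).

Lemma closed_factors_S m n F A B k l : closed_factors m n F A B -> (S k < m)%nat -> (S l < n)%nat ->
  quad_factors (net_p F (S k) (S l)) (net_q F (S k) (S l)) (B (S k) l) (A (S k) (S l)) (B (S k) (S l)) (A k (S l)).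
Proof.
  intros H Hk Hl. assert (Q := H (S k) (S l) ltac:(unfold non_boundary; lia)).
  replace (S k - 1)%nat with k in Q by lia. replace (S l - 1)%nat with l in Q by lia. exact Q.
Qed.

Lemma incr_plane_steps m n F A B k l : dual_convex m n F -> closed_factors m n F A B -> (l < n)%nat ->
  ((S k < m)%nat -> forall x y, ev (incr_plane F A B (S k) l) x y - ev (incr_plane F A B k l) x y =
     (B (S k) l - 1) * (ev (face_plane F (S k) l) x y - ev (face_plane F k l) x y)) /\
  ((S k < m)%nat -> pa (incr_plane F A B (S k) l) - pa (incr_plane F A B k l) =
     (B (S k) l - 1) * (pa (face_plane F (S k) l) - pa (face_plane F k l))) /\
  ((S k < m)%nat -> pb (incr_plane F A B (S k) l) - pb (incr_plane F A B k l) =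
     (B (S k) l - 1) * (pb (face_plane F (S k) l) - pb (face_plane F k l))).
Proof.
  intros HD HC Hl. assert (HF := dual_convex_faces m n F HD).
  assert (X : (S k < m)%nat -> forall l', (l' < l)%nat -> 
     convex_planes (face_plane F k l') (face_plane F (S k) l') (face_plane F (S k) (S l')) (face_plane F k (S l')) /\
     quad_factors (net_p F (S k) (S l')) (net_q F (S k) (S l')) (B (S k) l') (A (S k) (S l')) (B (S k) (S l')) (A k (S l'))).
  { intros Hk l' Hl'. split; [apply (vertex_planes_S m n) | apply (closed_factors_S m n)]; try assumption; lia. }
  assert (E : forall c, (c = pa \/ c = pb \/ c = pc) -> (S k < m)%nat -> incr c F A B (S k) l - incr c F A B k l =
     (B (S k) l - 1) * (c (face_plane F (S k) l) - c (face_plane F k l))).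
  { intros c Hc Hk. apply incr_exchange. intros l' Hl'. destruct (X Hk l' Hl') as [C Q].
    destruct (net_pq_S F k l') as [E1 E2]. rewrite E1, E2 in Q.
    destruct Hc as [->|[->| ->]]; try (apply quad_factors_closed; assumption).
    destruct (face_planes_vertex m n F k l' HF Hk ltac:(lia)) as (V0 & V1 & V2 & V3).
    apply quad_factors_closed_c with (px (F (S k) (S l'))) (py (F (S k) (S l'))); try assumption; congruence. }
  assert (Ea := E pa ltac:(auto)). assert (Eb := E pb ltac:(auto)). assert (Ec := E pc ltac:(auto)).
  split; [|split; assumption].
  intros Hk x y. specialize (Ea Hk). specialize (Eb Hk). specialize (Ec Hk).
  unfold ev, incr_plane. cbn [pa pb pc].
  transitivity ((incr pa F A B (S k) l - incr pa F A B k l) * x + (incr pb F A B (S k) l - incr pb F A B k l) * y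
    + (incr pc F A B (S k) l - incr pc F A B k l)); [ring | rewrite Ea, Eb, Ec; ring].
Qed.

Lemma incr_plane_step_row F A B k l x y : ev (incr_plane F A B k (S l)) x y - ev (incr_plane F A B k l) x y =
  (A k (S l) - 1) * (ev (face_plane F k (S l)) x y - ev (face_plane F k l) x y).
Proof. unfold ev, incr_plane. cbn [pa pb pc incr]. ring. Qed.

(** Increments of neighbouring faces differ by a multiple of the difference of the face planes,
    which vanishes at the common vertices. So each of the faces at a vertex gives the same
    height. *)
Lemma lift_height_face m n F A B k l : dual_convex m n F -> closed_factors m n F A B ->
  (k < m)%nat -> (l < n)%nat ->
  forall i j, (i = k \/ i = S k) -> (j = l \/ j = S l) ->
  lift_height m n F A B i j = ev (incr_plane F A B k l) (px (F i j)) (py (F i j)).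
Proof.
  intros HD HC Hk Hl i j Hi Hj. assert (HF := dual_convex_faces m n F HD).
  assert (W : forall k' l', (k' < m)%nat -> (l' < n)%nat -> (i = k' \/ i = S k') -> (j = l' \/ j = S l') ->
    ev (face_plane F k' l') (px (F i j)) (py (F i j)) = pz (F i j)).
  { intros k' l' K L I J. apply on_plane_ev. destruct (HF k' l' K L) as [_ G].
    destruct I as [->| ->], J as [->| ->];
      [apply (G 0%nat) | apply (G 3%nat) | apply (G 1%nat) | apply (G 2%nat)]; lia. }
  set (x := px (F i j)) in *. set (y := py (F i j)) in *.
  assert (R : forall k', (k' < m)%nat -> (i = k' \/ i = S k') ->
    ev (incr_plane F A B k' (Nat.min j (n - 1))) x y = ev (incr_plane F A B k' l) x y).
  { intros k' K I. destruct Hj as [->| ->]; [rewrite Nat.min_l by lia; reflexivity|].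
    destruct (Nat.le_gt_cases (S l) (n - 1)) as [L|L].
    - rewrite Nat.min_l by lia. apply Rminus_diag_uniq. rewrite incr_plane_step_row.
      rewrite !W by (lia || auto). ring.
    - rewrite Nat.min_r by lia. replace (n - 1)%nat with l by lia. reflexivity. }
  assert (C : ev (incr_plane F A B (Nat.min i (m - 1)) l) x y = ev (incr_plane F A B k l) x y).
  { destruct Hi as [->| ->]; [rewrite Nat.min_l by lia; reflexivity|].
    destruct (Nat.le_gt_cases (S k) (m - 1)) as [L|L].
    - rewrite Nat.min_l by lia. apply Rminus_diag_uniq.
      destruct (incr_plane_steps m n F A B k l HD HC Hl) as (E & _). rewrite E by lia.
      rewrite !W by (lia || auto). ring.
    - rewrite Nat.min_r by lia. replace (m - 1)%nat with k by lia. reflexivity. }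
  unfold lift_height. fold x. fold y. rewrite R by lia. exact C.
Qed.

Lemma lift_net_face m n F A B k l : dual_convex m n F -> closed_factors m n F A B ->
  (k < m)%nat -> (l < n)%nat -> forall r, (r < 4)%nat ->
  face_vertex (lift_net m n F A B) k l r =
  iso_cong 0 (pa (incr_plane F A B k l)) (pb (incr_plane F A B k l)) (mkpt 0 0 (pc (incr_plane F A B k l)))
    (face_vertex F k l r).
Proof.
  intros HD HC Hk Hl r Hr.
  assert (E : forall i j, (i = k \/ i = S k) -> (j = l \/ j = S l) -> lift_net m n F A B i j =
    iso_cong 0 (pa (incr_plane F A B k l)) (pb (incr_plane F A B k l)) (mkpt 0 0 (pc (incr_plane F A B k l))) (F i j)).
  { intros i j I J. unfold lift_net, iso_cong. rewrite (lift_height_face m n F A B k l), cos_0, sin_0 by assumption.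
    unfold ev. cbn [px py pz]. f_equal; ring. }
  destruct r as [|[|[|[|r]]]]; simpl; [ | | | | lia]; apply E; auto.
Qed.

Lemma convex_quad_iso_cong phi c1 c2 b A B C D : convex_quad A B C D ->
  convex_quad (iso_cong phi c1 c2 b A) (iso_cong phi c1 c2 b B) (iso_cong phi c1 c2 b C) (iso_cong phi c1 c2 b D).
Proof.
  rewrite !convex_quad_spec. intros (H & N & t2 & t3 & t4 & T & E2 & E3 & E4).
  assert (CS : cos phi ^ 2 + sin phi ^ 2 = 1) by (assert (Z := sin2_cos2 phi); unfold Rsqr in Z; lra).
  (* The inverse transpose of the matrix of the congruence, by which cross products transform
     because its determinant is 1. *)
  set (L := fun v : pt => mkpt (cos phi * (px v - c1 * pz v) - sin phi * (py v - c2 * pz v))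
     (sin phi * (px v - c1 * pz v) + cos phi * (py v - c2 * pz v)) (pz v)).
  assert (X : forall P Q S U, cross (vsub (iso_cong phi c1 c2 b P) (iso_cong phi c1 c2 b Q))
      (vsub (iso_cong phi c1 c2 b S) (iso_cong phi c1 c2 b U)) = L (cross (vsub P Q) (vsub S U))).
  { intros P Q S U. unfold L, cross, vsub, iso_cong. simpl.
    set (u1 := px P - px Q). set (u2 := py P - py Q). set (v1 := px S - px U). set (v2 := py S - py U).
    set (u3 := pz P - pz Q). set (v3 := pz S - pz U).
    f_equal.
    - transitivity ((sin phi * u1 + cos phi * u2) * (c1 * v1 + c2 * v2 + v3)
        - (c1 * u1 + c2 * u2 + u3) * (sin phi * v1 + cos phi * v2));
        [unfold u1, u2, u3, v1, v2, v3; ring | ring].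
    - transitivity ((c1 * u1 + c2 * u2 + u3) * (cos phi * v1 - sin phi * v2)
        - (cos phi * u1 - sin phi * u2) * (c1 * v1 + c2 * v2 + v3));
        [unfold u1, u2, u3, v1, v2, v3; ring | ring].
    - transitivity ((cos phi ^ 2 + sin phi ^ 2) * (u1 * v2 - u2 * v1));
        [unfold u1, u2, u3, v1, v2, v3; ring | rewrite CS; ring]. }
  assert (LS : forall t v, L (vscale t v) = vscale t (L v)).
  { intros t v. unfold L, vscale. simpl. f_equal; ring. }
  rewrite !X, E2, E3, E4, !LS. split; [|split].
  - transitivity (dot (vsub (iso_cong phi c1 c2 b B) (iso_cong phi c1 c2 b A)) (L (cross (vsub C A) (vsub D A)))).
    + unfold det3. rewrite X. reflexivity.
    + rewrite <- H. unfold det3, dot, L, cross, vsub, iso_cong. simpl.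
      set (u1 := px B - px A). set (u2 := py B - py A). set (u3 := pz B - pz A).
      set (v1 := px C - px A). set (v2 := py C - py A). set (v3 := pz C - pz A).
      set (w1 := px D - px A). set (w2 := py D - py A). set (w3 := pz D - pz A).
      transitivity ((cos phi ^ 2 + sin phi ^ 2) * (u1 * (v2 * w3 - v3 * w2 - c1 * (v1 * w2 - v2 * w1))
         + u2 * (v3 * w1 - v1 * w3 - c2 * (v1 * w2 - v2 * w1)))
         + (c1 * u1 + c2 * u2 + u3) * (v1 * w2 - v2 * w1));
        [unfold u1, u2, u3, v1, v2, v3, w1, w2, w3; ring | rewrite CS; ring].
  - intro Z. apply N. unfold is_zero, L in *.
    set (v := cross (vsub B A) (vsub C B)) in *. clearbody v. cbn [px py pz] in Z. destruct Z as (Z1 & Z2 & Z3).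
    rewrite Z3 in Z1, Z2.
    assert (Y1 : px v = 0).
    { transitivity ((cos phi ^ 2 + sin phi ^ 2) * px v); [rewrite CS; ring|].
      transitivity (cos phi * (cos phi * (px v - c1 * 0) - sin phi * (py v - c2 * 0))
        + sin phi * (sin phi * (px v - c1 * 0) + cos phi * (py v - c2 * 0))); [ring | rewrite Z1, Z2; ring]. }
    assert (Y2 : py v = 0).
    { transitivity ((cos phi ^ 2 + sin phi ^ 2) * py v); [rewrite CS; ring|].
      transitivity (cos phi * (sin phi * (px v - c1 * 0) + cos phi * (py v - c2 * 0))
        - sin phi * (cos phi * (px v - c1 * 0) - sin phi * (py v - c2 * 0))); [ring | rewrite Z1, Z2; ring]. }
    auto.
  - exists t2, t3, t4. auto.
Qed.

Lemma lift_net_is_net m n F A B : dual_convex m n F -> closed_factors m n F A B -> is_net m n (lift_net m n F A B).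
Proof.
  intros HD HC. destruct (proj1 (proj2 (proj2 HD))) as (M & N & H).
  split; [assumption|]. split; [assumption|]. intros k l Hk Hl.
  assert (E := lift_net_face m n F A B k l HD HC Hk Hl).
  assert (E0 := E 0%nat ltac:(lia)). assert (E1 := E 1%nat ltac:(lia)).
  assert (E2 := E 2%nat ltac:(lia)). assert (E3 := E 3%nat ltac:(lia)).
  simpl face_vertex in E0, E1, E2, E3. rewrite E0, E1, E2, E3.
  apply convex_quad_iso_cong. apply H; assumption.
Qed.

Lemma lift_net_face_plane m n F A B k l : dual_convex m n F -> closed_factors m n F A B ->
  (k < m)%nat -> (l < n)%nat ->
  face_plane (lift_net m n F A B) k l =
  mkpl (pa (face_plane F k l) + pa (incr_plane F A B k l)) (pb (face_plane F k l) + pb (incr_plane F A B k l))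
       (pc (face_plane F k l) + pc (incr_plane F A B k l)).
Proof.
  intros HD HC Hk Hl. apply face_plane_unique.
  - apply (lift_net_is_net m n F A B HD HC); assumption.
  - intros r Hr. rewrite (lift_net_face m n) by assumption.
    destruct (dual_convex_faces m n F HD k l Hk Hl) as [_ G]. specialize (G r Hr).
    unfold on_plane, iso_cong in *. rewrite cos_0, sin_0.
    set (X := face_vertex F k l r) in *. set (P := face_plane F k l) in *. set (Q := incr_plane F A B k l) in *.
    clearbody X P Q. cbn [px py pz pa pb pc]. rewrite G. ring.
Qed.

Lemma lift_net_curvature m n F A B i j : dual_convex m n F -> closed_factors m n F A B ->
  non_boundary m n i j -> curvature (lift_net m n F A B) i j = curvature F i j.
Proof.
  intros HD HC H. destruct i as [|k]; [unfold non_boundary in H; lia|].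
  destruct j as [|l]; [unfold non_boundary in H; lia|].
  assert (Hk : (S k < m)%nat) by (unfold non_boundary in H; lia).
  assert (Hl : (S l < n)%nat) by (unfold non_boundary in H; lia).
  rewrite !curvature_turn.
  destruct (around_plane_S F k l) as (-> & -> & -> & ->).
  destruct (around_plane_S (lift_net m n F A B) k l) as (-> & -> & -> & ->).
  rewrite !(lift_net_face_plane m n) by (assumption || lia).
  destruct (incr_plane_steps m n F A B k l HD HC ltac:(lia)) as (_ & Ba & Bb).
  destruct (incr_plane_steps m n F A B k (S l) HD HC ltac:(lia)) as (_ & Ba' & Bb').
  specialize (Ba Hk). specialize (Bb Hk). specialize (Ba' Hk). specialize (Bb' Hk).
  assert (Aa : forall k, pa (incr_plane F A B k (S l)) - pa (incr_plane F A B k l) =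
    (A k (S l) - 1) * (pa (face_plane F k (S l)) - pa (face_plane F k l))) by (intro; unfold incr_plane; cbn [pa pb pc incr]; ring).
  assert (Ab : forall k, pb (incr_plane F A B k (S l)) - pb (incr_plane F A B k l) =
    (A k (S l) - 1) * (pb (face_plane F k (S l)) - pb (face_plane F k l))) by (intro; unfold incr_plane; cbn [pa pb pc incr]; ring).
  assert (Aa1 := Aa k). assert (Aa2 := Aa (S k)). assert (Ab1 := Ab k). assert (Ab2 := Ab (S k)).
  assert (Q := closed_factors_S m n F A B k l HC Hk Hl).
  destruct (net_pq_S F k l) as [E1 E2]. rewrite E1, E2 in Q.
  apply quad_factors_closed in Q; [|apply (vertex_planes_S m n); assumption].
  destruct Q as (_ & _ & Q). f_equal. rewrite <- Q.
  f_equal; apply turn_scale; cbn [pa pb]; lra.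
Qed.

(** Only heights are compared, and [phi] does not enter them; three non-collinear top views
    determine the increment of each face. *)
Lemma lift_net_trivial m n F A B phi c1 c2 b k l : dual_convex m n F -> closed_factors m n F A B ->
  (forall i j, (i <= m)%nat -> (j <= n)%nat -> lift_net m n F A B i j = iso_cong phi c1 c2 b (F i j)) ->
  (k < m)%nat -> (l < n)%nat -> incr_plane F A B k l = mkpl c1 c2 (pz b).
Proof.
  intros HD HC H Hk Hl. assert (HF := dual_convex_faces m n F HD). destruct (HF k l Hk Hl) as [Hz G].
  assert (HX : forall i j, (i <= m)%nat -> (j <= n)%nat ->
     lift_height m n F A B i j = c1 * px (F i j) + c2 * py (F i j) + pz b).
  { intros i j Hi Hj. assert (E := H i j Hi Hj). unfold lift_net, iso_cong in E. injection E as E1 E2 E3.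
    lra. }
  set (N := fun i j => mkpt (px (F i j)) (py (F i j)) (lift_height m n F A B i j)).
  assert (O1 : forall i j, (i = k \/ i = S k) -> (j = l \/ j = S l) -> on_plane (incr_plane F A B k l) (N i j)).
  { intros i j I J. unfold on_plane, N. cbn [px py pz].
    rewrite (lift_height_face m n F A B k l) by assumption. reflexivity. }
  assert (O2 : forall i j, (i = k \/ i = S k) -> (j = l \/ j = S l) -> on_plane (mkpl c1 c2 (pz b)) (N i j)).
  { intros i j I J. unfold on_plane, N. cbn [px py pz pa pb pc]. apply HX; lia. }
  rewrite <- (plane_through_unique (incr_plane F A B k l) (N k l) (N (S k) l) (N k (S l))); auto.
  apply plane_through_unique; auto.
Qed.

Lemma continuity_continuous01 (f : R -> R) : continuity f -> forall t eps, 0 < eps ->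
  exists delta, 0 < delta /\ forall s, Rabs (s - t) < delta -> Rabs (f s - f t) < eps.
Proof.
  intros H t eps e0. destruct (H t eps e0) as (d & d0 & Hd). exists d. split; [exact d0|].
  intros s Hs. destruct (Req_dec s t) as [->|Hne].
  - rewrite Rminus_diag, Rabs_R0. exact e0.
  - apply (Hd s). split; [|exact Hs]. split; [exact I | auto].
Qed.

Lemma solution_flexible m n F A B : dual_convex m n F -> pairwise_nonparallel m n F ->
  grid_solution (m - 1) (n - 1) (net_p F) (net_q F) A B -> flexible m n F.
Proof.
  intros HD HP (HA & HB & HQ & HT). assert (HF := dual_convex_faces m n F HD).
  assert (Hm : (2 <= m)%nat) by apply HD. assert (Hn : (2 <= n)%nat) by apply HD.
  assert (HC : forall t, closed_factors m n F (A t) (B t)).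
  { intros t i j H. apply HQ, non_boundary_inside, H. }
  exists (fun t => lift_net m n F (A t) (B t)). split; [split; [|split; [|split; [|split]]]|].
  - intros i j Hi Hj.
    assert (Z : forall c, incr c F (A 0) (B 0) (Nat.min i (m - 1)) (Nat.min j (n - 1)) = 0).
    { intro c. apply (incr_zero c F (A 0) (B 0) m n); try lia; intros; [apply HA | apply HB]; lia. }
    unfold lift_net, lift_height, ev, incr_plane. simpl. rewrite !Z.
    replace (pz (F i j) + (0 * px (F i j) + 0 * py (F i j) + 0)) with (pz (F i j)) by ring.
    destruct (F i j); reflexivity.
  - intros i j Hi Hj t _ eps He.
    assert (C : continuity (fun t => pz (lift_net m n F (A t) (B t) i j))).
    { assert (K : forall c, continuity (fun t => incr c F (A t) (B t) (Nat.min i (m - 1)) (Nat.min j (n - 1)))).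
      { intro c. apply (incr_continuity c F A B m n); try lia; intros; [apply HA | apply HB]; lia. }
      unfold lift_net, lift_height, ev, incr_plane. simpl.
      assert (K1 := K pa). assert (K2 := K pb). assert (K3 := K pc). cont_tac. }
    destruct (continuity_continuous01 _ C t eps He) as (d & d0 & Hd). exists d. split; [exact d0|].
    intros s _ Hs. specialize (Hd s Hs). simpl px. simpl py.
    rewrite !Rminus_diag, Rabs_R0, !Rplus_0_l. exact Hd.
  - intros t _. apply lift_net_is_net; auto.
  - intros t _ k l Hk Hl. eexists 0, _, _, _. apply lift_net_face; auto.
  - intros t _ i j H. apply lift_net_curvature; auto.
  (* A trivial deformation adds the same affine function over all faces. Across an edge with factor
     different from 1 the increments differ by a nonzero multiple of the difference of two distinct
     gradients. *)
  - intro T. destruct (T 1) as (phi & c1 & c2 & b & E); [unfold in01; lra|].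
    assert (X : forall k l, (k < m)%nat -> (l < n)%nat -> incr_plane F (A 1) (B 1) k l = mkpl c1 c2 (pz b)).
    { intros k l Hk Hl. apply (lift_net_trivial m n F (A 1) (B 1) phi c1 c2 b k l); auto. }
    destruct HT as [HT|HT].
    + assert (E1 : pa (incr_plane F (A 1) (B 1) 1 1) - pa (incr_plane F (A 1) (B 1) 1 0) =
        (A 1 1%nat 1%nat - 1) * (pa (face_plane F 1 1) - pa (face_plane F 1 0))) by (unfold incr_plane; cbn [pa pb pc incr]; ring).
      assert (E2 : pb (incr_plane F (A 1) (B 1) 1 1) - pb (incr_plane F (A 1) (B 1) 1 0) =
        (A 1 1%nat 1%nat - 1) * (pb (face_plane F 1 1) - pb (face_plane F 1 0))) by (unfold incr_plane; cbn [pa pb pc incr]; ring).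
      rewrite !X, Rminus_diag in E1 by lia. rewrite !X, Rminus_diag in E2 by lia.
      symmetry in E1, E2. apply Rmult_integral in E1, E2.
      destruct (nonparallel_gradients m n F 1 1 1 0 HF) as [N|N]; try lia; [|lra|lra].
      apply HP; try lia. discriminate.
    + destruct (incr_plane_steps m n F (A 1) (B 1) 0 1 HD (HC 1) ltac:(lia)) as (_ & E1 & E2).
      specialize (E1 ltac:(lia)). specialize (E2 ltac:(lia)).
      rewrite !X, Rminus_diag in E1 by lia. rewrite !X, Rminus_diag in E2 by lia.
      symmetry in E1, E2. apply Rmult_integral in E1, E2.
      destruct (nonparallel_gradients m n F 1 1 0 1 HF) as [N|N]; try lia; [|lra|lra].
      apply HP; try lia. discriminate.
Qed.

(** * Edge factors of deformations *)

Definition face_congruent (m n : nat) (F F' : net) : Prop :=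
  forall k l, (k < m)%nat -> (l < n)%nat -> exists phi c1 c2 b, forall r, (r < 4)%nat ->
    face_vertex F' k l r = iso_cong phi c1 c2 b (face_vertex F k l r).

(** The height difference as a surface over the original top view. It is flat over each face, and
    its plane there is the affine part of the congruence of that face. *)
Definition diff_net (F F' : net) : net :=
  fun i j => mkpt (px (F i j)) (py (F i j)) (pz (F' i j) - pz (F i j)).

Definition diff_plane (F F' : net) (k l : nat) : plane := face_plane (diff_net F F') k l.

Lemma rotation_unique C S C' S' x y x' y' b1 b2 b1' b2' : x <> x' \/ y <> y' ->
  C * x - S * y + b1 = C' * x - S' * y + b1' -> S * x + C * y + b2 = S' * x + C' * y + b2' ->
  C * x' - S * y' + b1 = C' * x' - S' * y' + b1' -> S * x' + C * y' + b2 = S' * x' + C' * y' + b2' ->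
  C = C' /\ S = S' /\ b1 = b1' /\ b2 = b2'.
Proof.
  intros H E1 E2 E3 E4.
  assert (N : 0 < (x - x') ^ 2 + (y - y') ^ 2) by (apply sum_sq_pos; destruct H; [left | right]; lra).
  destruct (det2_basis (C - C') (S - S') (y - y') (x - x') (- (x - x')) (y - y')) as [H1 H2].
  - lra.
  - lra.
  - lra.
  - assert (EC : C = C') by lra. assert (ES : S = S') by lra. subst C' S'.
    repeat split; lra.
Qed.

Lemma rigid_top_step F F' phi b X Y phi' c1 c2 b' d1 d2 e :
  (px X <> px Y \/ py X <> py Y) ->
  iso_cong phi d1 d2 (mkpt (px b) (py b) e) X = F' -> iso_cong phi' c1 c2 b' X = F' ->
  iso_cong phi d1 d2 (mkpt (px b) (py b) e) Y = F -> iso_cong phi' c1 c2 b' Y = F ->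
  forall Z, iso_cong phi' c1 c2 b' Z = iso_cong phi c1 c2 (mkpt (px b) (py b) (pz b')) Z.
Proof.
  intros H E1 E2 E3 E4 Z. rewrite <- E2 in E1. rewrite <- E4 in E3. unfold iso_cong in *.
  injection E1 as A1 A2 _. injection E3 as B1 B2 _.
  destruct (rotation_unique _ _ _ _ _ _ _ _ _ _ _ _ H A1 A2 B1 B2) as (-> & -> & -> & ->). reflexivity.
Qed.

(** Adjacent faces share an edge whose top view has two distinct end points; these determine the
    planar rotation and translation, so the top views of all faces move together. *)
Lemma rigid_top m n F F' : nonisotropic_faces m n F -> (1 <= m)%nat -> (1 <= n)%nat ->
  face_congruent m n F F' ->
  exists phi b, forall k l, (k < m)%nat -> (l < n)%nat -> exists c1 c2 d, forall r, (r < 4)%nat ->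
    face_vertex F' k l r = iso_cong phi c1 c2 (mkpt (px b) (py b) d) (face_vertex F k l r).
Proof.
  intros HF Hm Hn HC.
  destruct (HC O O) as (phi & c1 & c2 & b & H0); [lia | lia |].
  exists phi, b.
  set (P := fun k l => exists c1 c2 d, forall r, (r < 4)%nat ->
    face_vertex F' k l r = iso_cong phi c1 c2 (mkpt (px b) (py b) d) (face_vertex F k l r)).
  assert (R : forall k l, (S k < m)%nat -> (l < n)%nat -> P k l -> P (S k) l).
  { intros k l Hk Hl (d1 & d2 & e & H). destruct (HC (S k) l Hk Hl) as (phi' & c1' & c2' & b' & H').
    exists c1', c2', (pz b'). intros r Hr. rewrite H' by assumption.
    apply (rigid_top_step (F' (S k) (S l)) (F' (S k) l) phi b (F (S k) l) (F (S k) (S l)) phi' c1' c2' b' d1 d2 e).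
    - apply face_top_edges. apply HF; assumption.
    - symmetry. apply (H 1%nat). lia.
    - symmetry. apply (H' 0%nat). lia.
    - symmetry. apply (H 2%nat). lia.
    - symmetry. apply (H' 3%nat). lia. }
  assert (U : forall k l, (k < m)%nat -> (S l < n)%nat -> P k l -> P k (S l)).
  { intros k l Hk Hl (d1 & d2 & e & H). destruct (HC k (S l) Hk Hl) as (phi' & c1' & c2' & b' & H').
    exists c1', c2', (pz b'). intros r Hr. rewrite H' by assumption.
    apply (rigid_top_step (F' (S k) (S l)) (F' k (S l)) phi b (F k (S l)) (F (S k) (S l)) phi' c1' c2' b' d1 d2 e).
    - apply face_top_edges. apply HF; assumption.
    - symmetry. apply (H 3%nat). lia.
    - symmetry. apply (H' 0%nat). lia.
    - symmetry. apply (H 2%nat). lia.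
    - symmetry. apply (H' 1%nat). lia. }
  intros k l Hk Hl. change (P k l). induction l as [|l IH].
  - induction k as [|k IH].
    + exists c1, c2, (pz b). intros r Hr. rewrite H0 by assumption. destruct b; reflexivity.
    + apply R; [lia | lia |]. apply IH. lia.
  - apply U; [lia | lia |]. apply IH. lia.
Qed.

Lemma diff_plane_of_cong m n F F' k l phi c1 c2 b : nonisotropic_faces m n F -> (k < m)%nat -> (l < n)%nat ->
  (forall r, (r < 4)%nat -> face_vertex F' k l r = iso_cong phi c1 c2 b (face_vertex F k l r)) ->
  diff_plane F F' k l = mkpl c1 c2 (pz b).
Proof.
  intros HF Hk Hl H. destruct (HF k l Hk Hl) as [Hz _].
  assert (H0 := H 0%nat ltac:(lia)). assert (H1 := H 1%nat ltac:(lia)). assert (H3 := H 3%nat ltac:(lia)).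
  cbn [face_vertex] in H0, H1, H3.
  apply plane_through_unique; [ | | | exact Hz];
    unfold on_plane, diff_net; cbn [px py pz pa pb pc]; rewrite ?H0, ?H1, ?H3; unfold iso_cong; cbn [pz]; ring.
Qed.

Lemma rigid_top_diff m n F F' : nonisotropic_faces m n F -> (1 <= m)%nat -> (1 <= n)%nat ->
  face_congruent m n F F' ->
  exists phi b, forall k l, (k < m)%nat -> (l < n)%nat -> forall r, (r < 4)%nat ->
    face_vertex F' k l r = iso_cong phi (pa (diff_plane F F' k l)) (pb (diff_plane F F' k l))
      (mkpt (px b) (py b) (pc (diff_plane F F' k l))) (face_vertex F k l r).
Proof.
  intros HF Hm Hn HC. destruct (rigid_top m n F F' HF Hm Hn HC) as (phi & b & H).
  exists phi, b. intros k l Hk Hl. destruct (H k l Hk Hl) as (c1 & c2 & d & E).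
  rewrite (diff_plane_of_cong m n F F' k l phi c1 c2 _ HF Hk Hl E). cbn [pa pb pc pz]. exact E.
Qed.

Lemma diff_plane_vertex m n F F' k l : nonisotropic_faces m n F -> face_congruent m n F F' ->
  (k < m)%nat -> (l < n)%nat -> forall i j, (i = k \/ i = S k) -> (j = l \/ j = S l) ->
  ev (diff_plane F F' k l) (px (F i j)) (py (F i j)) = pz (F' i j) - pz (F i j).
Proof.
  intros HF HC Hk Hl i j Hi Hj. destruct (HC k l Hk Hl) as (phi & c1 & c2 & b & H).
  rewrite (diff_plane_of_cong m n F F' k l phi c1 c2 b HF Hk Hl H).
  assert (E : F' i j = iso_cong phi c1 c2 b (F i j)).
  { destruct Hi as [->| ->], Hj as [->| ->];
      [apply (H 0%nat) | apply (H 3%nat) | apply (H 1%nat) | apply (H 2%nat)]; lia. }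
  rewrite E. unfold ev, iso_cong. cbn [pa pb pc pz]. ring.
Qed.

Lemma cong_face_plane m n F F' k l phi b : nonisotropic_faces m n F -> is_net m n F' ->
  (k < m)%nat -> (l < n)%nat -> 
  (forall r, (r < 4)%nat -> face_vertex F' k l r = iso_cong phi (pa (diff_plane F F' k l)) (pb (diff_plane F F' k l))
      (mkpt (px b) (py b) (pc (diff_plane F F' k l))) (face_vertex F k l r)) ->
  let g := pa (face_plane F k l) + pa (diff_plane F F' k l) in
  let h := pb (face_plane F k l) + pb (diff_plane F F' k l) in
  pa (face_plane F' k l) = cos phi * g - sin phi * h /\ pb (face_plane F' k l) = sin phi * g + cos phi * h.
Proof.
  intros HF HN Hk Hl H g h. destruct (HF k l Hk Hl) as [_ G].
  assert (CS : cos phi ^ 2 + sin phi ^ 2 = 1) by (assert (Z := sin2_cos2 phi); unfold Rsqr in Z; lra).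
  destruct (face_plane_unique (mkpl (cos phi * g - sin phi * h) (sin phi * g + cos phi * h)
    (pc (face_plane F k l) + pc (diff_plane F F' k l) - (cos phi * g - sin phi * h) * px b
      - (sin phi * g + cos phi * h) * py b)) F' k l) as [E _].
  - apply HN; assumption.
  - intros r Hr. specialize (H r Hr). specialize (G r Hr). rewrite H.
    unfold on_plane, iso_cong, g, h in *.
    set (X := face_vertex F k l r) in *. set (P := face_plane F k l) in *. set (Q := diff_plane F F' k l) in *.
    clearbody X P Q. cbn [px py pz pa pb pc]. rewrite G.
    transitivity ((cos phi ^ 2 + sin phi ^ 2) * ((pa P + pa Q) * px X + (pb P + pb Q) * py X) + pc P + pc Q);
      [rewrite CS; ring | ring].
  - rewrite E. split; reflexivity.
Qed.

Definition plane_sum (P Q : plane) : plane := mkpl (pa P + pa Q) (pb P + pb Q) (pc P + pc Q).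

Lemma curvature_diff m n F F' k l : nonisotropic_faces m n F -> is_net m n F' -> face_congruent m n F F' ->
  (S k < m)%nat -> (S l < n)%nat ->
  let f i j := plane_sum (face_plane F i j) (diff_plane F F' i j) in
  curvature F' (S k) (S l) = / 2 *
    (turn (f k l) (f (S k) l) (f (S k) (S l)) + turn (f (S k) (S l)) (f k (S l)) (f k l)).
Proof.
  intros HF HN HC Hk Hl f.
  destruct (rigid_top_diff m n F F' HF ltac:(lia) ltac:(lia) HC) as (phi & b & H).
  assert (CS : cos phi ^ 2 + sin phi ^ 2 = 1) by (assert (Z := sin2_cos2 phi); unfold Rsqr in Z; lra).
  rewrite curvature_turn. destruct (around_plane_S F' k l) as (-> & -> & -> & ->). f_equal.
  assert (E : forall i j, (i < m)%nat -> (j < n)%nat ->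
    pa (face_plane F' i j) = cos phi * pa (f i j) - sin phi * pb (f i j) /\
    pb (face_plane F' i j) = sin phi * pa (f i j) + cos phi * pb (f i j)).
  { intros i j Hi Hj. apply (cong_face_plane m n F F' i j phi b HF HN Hi Hj (H i j Hi Hj)). }
  assert (T : forall i j i' j' i'' j'', (i < m)%nat -> (j < n)%nat -> (i' < m)%nat -> (j' < n)%nat ->
    (i'' < m)%nat -> (j'' < n)%nat ->
    turn (face_plane F' i j) (face_plane F' i' j') (face_plane F' i'' j'') = turn (f i j) (f i' j') (f i'' j'')).
  { intros. unfold turn. destruct (E i j) as [-> ->]; [assumption | assumption |].
    destruct (E i' j') as [-> ->]; [assumption | assumption |].
    destruct (E i'' j'') as [-> ->]; [assumption | assumption |].
    set (X := f i j). set (Y := f i' j'). set (Z := f i'' j'').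
    transitivity ((cos phi ^ 2 + sin phi ^ 2) *
      ((pa Y - pa X) * (pb Z - pb Y) - (pb Y - pb X) * (pa Z - pa Y))); [ring | rewrite CS; ring]. }
  rewrite !T by lia. reflexivity.
Qed.

(** Written as an orthogonal projection, with a denominator independent of [D] and [D'], so that
    continuity along a deformation is immediate. *)
Definition edge_factor (P P' D D' : plane) : R :=
  1 + ((pa D' - pa D) * (pa P' - pa P) + (pb D' - pb D) * (pb P' - pb P))
      / ((pa P' - pa P) ^ 2 + (pb P' - pb P) ^ 2).

(** Both differences of planes vanish at the two ends of the common edge. Their gradients are
    therefore orthogonal to its top view, hence parallel. *)
Lemma edge_factor_spec P P' D D' x y x' y' :
  (pa P <> pa P' \/ pb P <> pb P') -> (x <> x' \/ y <> y') ->
  ev P x y = ev P' x y -> ev P x' y' = ev P' x' y' -> ev D x y = ev D' x y -> ev D x' y' = ev D' x' y' ->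
  pa D' - pa D = (edge_factor P P' D D' - 1) * (pa P' - pa P) /\
  pb D' - pb D = (edge_factor P P' D D' - 1) * (pb P' - pb P).
Proof.
  intros HP HX E1 E2 E3 E4. unfold ev in *.
  destruct (kappa_of_orth (pa P' - pa P) (pb P' - pb P) (x' - x) (y' - y)) as (k & K1 & K2);
    [destruct HX; [left | right]; lra | lra |].
  destruct (kappa_of_orth (pa D' - pa D) (pb D' - pb D) (x' - x) (y' - y)) as (l & L1 & L2);
    [destruct HX; [left | right]; lra | lra |].
  assert (N : 0 < (x' - x) ^ 2 + (y' - y) ^ 2) by (apply sum_sq_pos; destruct HX; [left | right]; lra).
  assert (k0 : k <> 0) by (intro Z; rewrite Z in K1, K2; destruct HP; lra).
  assert (E : edge_factor P P' D D' - 1 = l / k).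
  { unfold edge_factor. rewrite K1, K2, L1, L2.
    transitivity (l * k * ((x' - x) ^ 2 + (y' - y) ^ 2) / (k ^ 2 * ((x' - x) ^ 2 + (y' - y) ^ 2))).
    - match goal with |- 1 + ?u / ?v - 1 = ?u' / ?v' => replace u' with u by ring; replace v' with v by ring end. ring.
    - field. lra. }
  rewrite E, K1, K2, L1, L2. split; field; assumption.
Qed.

(** The face index [j - 1] is truncated, so these are meaningful for [1 <= j], resp. [1 <= i]. *)
Definition factor_h (F F' : net) (i j : nat) : R :=
  edge_factor (face_plane F i (j - 1)) (face_plane F i j) (diff_plane F F' i (j - 1)) (diff_plane F F' i j).
Definition factor_v (F F' : net) (i j : nat) : R :=
  edge_factor (face_plane F (i - 1) j) (face_plane F i j) (diff_plane F F' (i - 1) j) (diff_plane F F' i j).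

Lemma face_plane_vertex m n F k l i j : nonisotropic_faces m n F -> (k < m)%nat -> (l < n)%nat ->
  (i = k \/ i = S k) -> (j = l \/ j = S l) -> ev (face_plane F k l) (px (F i j)) (py (F i j)) = pz (F i j).
Proof.
  intros HF Hk Hl I J. apply on_plane_ev. destruct (HF k l Hk Hl) as [_ G].
  destruct I as [->| ->], J as [->| ->];
    [apply (G 0%nat) | apply (G 3%nat) | apply (G 1%nat) | apply (G 2%nat)]; lia.
Qed.

Lemma factor_h_spec m n F F' k l : nonisotropic_faces m n F -> pairwise_nonparallel m n F ->
  face_congruent m n F F' -> (k < m)%nat -> (S l < n)%nat ->
  pa (diff_plane F F' k (S l)) - pa (diff_plane F F' k l) =
    (factor_h F F' k (S l) - 1) * (pa (face_plane F k (S l)) - pa (face_plane F k l)) /\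
  pb (diff_plane F F' k (S l)) - pb (diff_plane F F' k l) =
    (factor_h F F' k (S l) - 1) * (pb (face_plane F k (S l)) - pb (face_plane F k l)).
Proof.
  intros HF HP HC Hk Hl. unfold factor_h. replace (S l - 1)%nat with l by lia.
  apply (edge_factor_spec _ _ _ _ (px (F k (S l))) (py (F k (S l))) (px (F (S k) (S l))) (py (F (S k) (S l)))).
  1: apply (nonparallel_gradients m n); try assumption; try lia; apply HP; try lia; intro E; injection E; lia.
  1: apply face_top_edges, HF; assumption.
  all: rewrite ?(face_plane_vertex m n), ?(diff_plane_vertex m n) by (assumption || lia || auto); reflexivity.
Qed.

Lemma factor_v_spec m n F F' k l : nonisotropic_faces m n F -> pairwise_nonparallel m n F ->
  face_congruent m n F F' -> (S k < m)%nat -> (l < n)%nat ->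
  pa (diff_plane F F' (S k) l) - pa (diff_plane F F' k l) =
    (factor_v F F' (S k) l - 1) * (pa (face_plane F (S k) l) - pa (face_plane F k l)) /\
  pb (diff_plane F F' (S k) l) - pb (diff_plane F F' k l) =
    (factor_v F F' (S k) l - 1) * (pb (face_plane F (S k) l) - pb (face_plane F k l)).
Proof.
  intros HF HP HC Hk Hl. unfold factor_v. replace (S k - 1)%nat with k by lia.
  apply (edge_factor_spec _ _ _ _ (px (F (S k) l)) (py (F (S k) l)) (px (F (S k) (S l))) (py (F (S k) (S l)))).
  1: apply (nonparallel_gradients m n); try assumption; try lia; apply HP; try lia; intro E; injection E; lia.
  1: apply face_top_edges, HF; assumption.
  all: rewrite ?(face_plane_vertex m n), ?(diff_plane_vertex m n) by (assumption || lia || auto); reflexivity.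
Qed.

(** The coordinates [u] and [s] of [closed_quad_factors], recovered from two of the four factors. *)
Definition dev (F F' : net) (i j : nat) : R :=
  (factor_h F F' i j - factor_v F F' i j) / (net_p F i j + net_q F i j).
Definition dev_ch (F F' : net) (i j : nat) : R :=
  (net_q F i j * factor_h F F' i j + net_p F i j * factor_v F F' i j) / (net_p F i j + net_q F i j).

Lemma deformed_factors m n F F' i j : dual_convex m n F -> pairwise_nonparallel m n F -> is_net m n F' ->
  face_congruent m n F F' -> non_boundary m n i j -> curvature F' i j = curvature F i j ->
  let s := dev_ch F F' i j in let u := dev F F' i j in let p := net_p F i j in let q := net_q F i j in
  s ^ 2 - u ^ 2 = 1 /\ factor_v F F' i (j - 1) = s - u / q /\ factor_h F F' i j = s + p * u /\
  factor_v F F' i j = s - q * u /\ factor_h F F' (i - 1) j = s + u / p.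
Proof.
  intros HD HP HN HC Hij Hcur. assert (HF := dual_convex_faces m n F HD).
  destruct i as [|k]; [unfold non_boundary in Hij; lia|]. destruct j as [|l]; [unfold non_boundary in Hij; lia|].
  assert (Hk : (S k < m)%nat) by (unfold non_boundary in Hij; lia).
  assert (Hl : (S l < n)%nat) by (unfold non_boundary in Hij; lia).
  rewrite (curvature_diff m n F F' k l HF HN HC Hk Hl), curvature_turn in Hcur.
  destruct (around_plane_S F k l) as (R0 & R1 & R2 & R3). rewrite R0, R1, R2, R3 in Hcur. clear R0 R1 R2 R3.
  unfold dev_ch, dev. destruct (net_pq_S F k l) as [-> ->].
  destruct (factor_v_spec m n F F' k l HF HP HC Hk ltac:(lia)) as [A1 B1].
  destruct (factor_h_spec m n F F' (S k) l HF HP HC Hk Hl) as [A2 B2].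
  destruct (factor_v_spec m n F F' k (S l) HF HP HC Hk Hl) as [A3 B3].
  destruct (factor_h_spec m n F F' k l HF HP HC ltac:(lia) Hl) as [A4 B4].
  replace (S k - 1)%nat with k by lia. replace (S l - 1)%nat with l by lia.
  set (x1 := factor_v F F' (S k) l) in *. set (x2 := factor_h F F' (S k) (S l)) in *.
  set (x3 := factor_v F F' (S k) (S l)) in *. set (x4 := factor_h F F' k (S l)) in *.
  apply (closed_quad_factors (face_plane F k l) (face_plane F (S k) l) (face_plane F (S k) (S l)) (face_plane F k (S l))).
  - apply (vertex_planes_S m n); assumption.
  - lra.
  - lra.
  - apply Rmult_eq_reg_l in Hcur; [|lra]. etransitivity; [|exact Hcur].
    f_equal; symmetry; apply turn_scale; unfold plane_sum; cbn [pa pb]; lra.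
Qed.

(** Unit factors give adjacent differences the same gradient, and a common vertex the same constant.
    So all differences are one affine function, which combines with the common motion of the top
    view. *)
Lemma trivial_of_factors m n F F' : dual_convex m n F -> pairwise_nonparallel m n F -> face_congruent m n F F' ->
  (forall i j, (i < m)%nat -> (1 <= j < n)%nat -> factor_h F F' i j = 1) ->
  (forall i j, (1 <= i < m)%nat -> (j < n)%nat -> factor_v F F' i j = 1) ->
  exists phi c1 c2 b, forall i j, (i <= m)%nat -> (j <= n)%nat -> F' i j = iso_cong phi c1 c2 b (F i j).
Proof.
  intros HD HP HC Hh Hv. assert (HF := dual_convex_faces m n F HD).
  assert (Hm : (2 <= m)%nat) by apply HD. assert (Hn : (2 <= n)%nat) by apply HD.
  assert (X : forall D D' x y, pa D' - pa D = 0 -> pb D' - pb D = 0 -> ev D x y = ev D' x y -> D' = D).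
  { intros [a b c] [a' b' c'] x y E1 E2 E3. unfold ev in E3. cbn [pa pb pc] in *.
    assert (a' = a) by lra. assert (b' = b) by lra. subst. f_equal. lra. }
  assert (E : forall k l, (k < m)%nat -> (l < n)%nat -> diff_plane F F' k l = diff_plane F F' 0 0).
  { intros k l Hk. induction l as [|l IH]; intro Hl.
    - induction k as [|k IHk]; [reflexivity|]. rewrite <- IHk by lia.
      destruct (factor_v_spec m n F F' k 0 HF HP HC Hk Hl) as [A B]. rewrite Hv in A, B by lia.
      apply X with (px (F (S k) O)) (py (F (S k) O)); [lra | lra |].
      rewrite !(diff_plane_vertex m n) by (assumption || lia || auto). reflexivity.
    - rewrite <- IH by lia.
      destruct (factor_h_spec m n F F' k l HF HP HC Hk Hl) as [A B]. rewrite Hh in A, B by lia.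
      apply X with (px (F k (S l))) (py (F k (S l))); [lra | lra |].
      rewrite !(diff_plane_vertex m n) by (assumption || lia || auto). reflexivity. }
  destruct (rigid_top_diff m n F F' HF ltac:(lia) ltac:(lia) HC) as (phi & b & H).
  exists phi, (pa (diff_plane F F' 0 0)), (pb (diff_plane F F' 0 0)), (mkpt (px b) (py b) (pc (diff_plane F F' 0 0))).
  intros i j Hi Hj.
  assert (G : exists k l r, (k < m)%nat /\ (l < n)%nat /\ (r < 4)%nat /\
     face_vertex F k l r = F i j /\ face_vertex F' k l r = F' i j).
  { destruct (Nat.eq_dec i m) as [->|Ni], (Nat.eq_dec j n) as [->|Nj].
    - exists (m - 1)%nat, (n - 1)%nat, 2%nat. cbn [face_vertex].
      replace (S (m - 1)) with m by lia. replace (S (n - 1)) with n by lia. repeat split; lia.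
    - exists (m - 1)%nat, j, 1%nat. cbn [face_vertex]. replace (S (m - 1)) with m by lia. repeat split; lia.
    - exists i, (n - 1)%nat, 3%nat. cbn [face_vertex]. replace (S (n - 1)) with n by lia. repeat split; lia.
    - exists i, j, 0%nat. cbn [face_vertex]. repeat split; lia. }
  destruct G as (k & l & r & Hk & Hl & Hr & <- & <-).
  rewrite (H k l Hk Hl r Hr), (E k l Hk Hl). reflexivity.
Qed.

(** * From a deformation to arbitrarily small configurations *)

Definition clamp (t : R) : R := Rmax 0 (Rmin t 1).

Lemma clamp_in01 t : in01 (clamp t).
Proof. unfold in01, clamp, Rmax, Rmin. destruct (Rle_dec t 1); destruct (Rle_dec 0 _); lra. Qed.

Lemma clamp_id t : in01 t -> clamp t = t.
Proof. unfold in01, clamp, Rmax, Rmin. intro H. destruct (Rle_dec t 1); destruct (Rle_dec 0 _); lra. Qed.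

Lemma clamp_lipschitz s t : Rabs (clamp s - clamp t) <= Rabs (s - t).
Proof.
  unfold clamp, Rmax, Rmin, Rabs.
  destruct (Rle_dec s 1), (Rle_dec t 1); repeat destruct (Rle_dec 0 _); repeat destruct (Rcase_abs _); lra.
Qed.

(** Extending the path by constants beyond the unit interval allows continuity and the intermediate
    value theorem to be used on the whole line. *)
Lemma continuity_of_01 f : continuous01 f -> continuity (fun t => pz (f (clamp t))).
Proof.
  intros H t eps He. destruct (H (clamp t) (clamp_in01 t) eps He) as (d & d0 & Hd).
  exists d. split; [exact d0|]. intros s [_ Hs]. simpl in *. unfold Rdist in *.
  specialize (Hd (clamp s) (clamp_in01 s)).
  assert (L := clamp_lipschitz s t). assert (D := Hd ltac:(lra)).
  assert (A1 := Rabs_pos (px (f (clamp s)) - px (f (clamp t)))).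
  assert (A2 := Rabs_pos (py (f (clamp s)) - py (f (clamp t)))). lra.
Qed.

Lemma diff_plane_continuity m n F (G : R -> net) :
  (forall i j, (i <= m)%nat -> (j <= n)%nat -> continuity (fun t => pz (G t i j))) ->
  forall k l, (k < m)%nat -> (l < n)%nat ->
  continuity (fun t => pa (diff_plane F (G t) k l)) /\ continuity (fun t => pb (diff_plane F (G t) k l)).
Proof.
  intros H k l Hk Hl.
  assert (C1 := H k l ltac:(lia) ltac:(lia)). assert (C2 := H (S k) l ltac:(lia) ltac:(lia)).
  assert (C3 := H k (S l) ltac:(lia) ltac:(lia)).
  unfold diff_plane, face_plane, plane_through, cross, vsub, diff_net. cbn [px py pz pa pb pc].
  unfold Rdiv. split; cont_tac.
Qed.

Lemma factor_continuity m n F (G : R -> net) :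
  (forall i j, (i <= m)%nat -> (j <= n)%nat -> continuity (fun t => pz (G t i j))) ->
  forall i j, (i < m)%nat -> (j < n)%nat ->
  continuity (fun t => factor_h F (G t) i j) /\ continuity (fun t => factor_v F (G t) i j).
Proof.
  intros H i j Hi Hj.
  destruct (diff_plane_continuity m n F G H i j Hi Hj) as [A1 A2].
  destruct (diff_plane_continuity m n F G H i (j - 1) Hi ltac:(lia)) as [B1 B2].
  destruct (diff_plane_continuity m n F G H (i - 1) j ltac:(lia) Hj) as [C1 C2].
  unfold factor_h, factor_v, edge_factor, Rdiv. split; cont_tac.
Qed.

Lemma continuous_nonzero_pos f : continuity f -> 0 < f 0 -> (forall t, f t <> 0) -> forall t, 0 < f t.
Proof.
  intros H H0 Hne t. apply Rnot_le_lt. intro L.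
  assert (P : f 0 * f t <= 0) by nra.
  destruct (Rle_dec 0 t) as [T|T].
  - destruct (IVT_cor f 0 t H T P) as (z & _ & Z). exact (Hne z Z).
  - rewrite Rmult_comm in P. destruct (IVT_cor f t 0 H ltac:(lra) P) as (z & _ & Z). exact (Hne z Z).
Qed.

Lemma common_threshold K (P : nat -> R -> Prop) : (forall k d d', d' <= d -> P k d -> P k d') ->
  (forall k, (k <= K)%nat -> exists d, 0 < d /\ P k d) ->
  exists d, 0 < d /\ forall k, (k <= K)%nat -> P k d.
Proof.
  intro HP. induction K as [|K IH]; intro H.
  - destruct (H O (le_n O)) as (d & d0 & Hd). exists d. split; [assumption|].
    intros k Hk. replace k with O by lia. assumption.
  - destruct IH as (d & d0 & Hd); [intros; apply H; lia|].
    destruct (H (S K) (le_n _)) as (e & e0 & He).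
    exists (Rmin d e). split; [apply Rmin_pos; assumption|]. intros k Hk.
    destruct (Nat.eq_dec k (S K)) as [->|N]; [apply HP with e | apply HP with d];
      [apply Rmin_r | assumption | apply Rmin_l | apply Hd; lia].
Qed.

Lemma grid_lower_bound M N (f : nat -> nat -> R) : (forall i j, inside M N i j -> 0 < f i j) ->
  exists d, 0 < d /\ forall i j, inside M N i j -> d <= f i j.
Proof.
  intro H.
  destruct (common_threshold M (fun i d => forall j, inside M N i j -> d <= f i j)) as (d & d0 & Hd).
  - intros i d d' L Hi j Hj. specialize (Hi j Hj). lra.
  - intros i _. destruct (common_threshold N (fun j d => inside M N i j -> d <= f i j)) as (d & d0 & Hd).
    + intros j d d' L Hi Hj. specialize (Hi Hj). lra.
    + intros j _. destruct (classic (inside M N i j)) as [L|L].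
      * exists (f i j). split; [apply H, L | lra].
      * exists 1. split; [lra | contradiction].
    + exists d. split; [assumption|]. intros j Hj. apply Hd; unfold inside in *; [lia | assumption].
  - exists d. split; [assumption|]. intros i j Hij. apply Hd; unfold inside in *; [lia | assumption].
Qed.

Lemma sum_nonneg f K : (forall k, (k <= K)%nat -> 0 <= f k) ->
  0 <= sum_f_R0 f K /\ forall k, (k <= K)%nat -> f k <= sum_f_R0 f K.
Proof.
  induction K as [|K IH]; intro H; simpl.
  - split; [apply H; lia|]. intros k Hk. replace k with O by lia. lra.
  - destruct IH as [I1 I2]; [intros; apply H; lia|]. assert (P := H (S K) (le_n _)).
    split; [lra|]. intros k Hk. destruct (Nat.eq_dec k (S K)) as [->|N]; [lra|].
    assert (Q := I2 k ltac:(lia)). lra.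
Qed.

Lemma sum_continuity (f : R -> nat -> R) K : (forall k, (k <= K)%nat -> continuity (fun t => f t k)) ->
  continuity (fun t => sum_f_R0 (f t) K).
Proof.
  induction K as [|K IH]; intro H; simpl; [apply H; lia|].
  apply (continuity_plus (fun t => sum_f_R0 (f t) K) (fun t => f t (S K))); [apply IH; intros | ]; apply H; lia.
Qed.

Definition grid_sum (M N : nat) (tau : nat -> nat -> R) : R :=
  sum_f_R0 (fun i => sum_f_R0 (fun j => Rabs (tau (S i) (S j))) (N - 1)) (M - 1).

Lemma grid_sum_ge M N tau i j : inside M N i j -> Rabs (tau i j) <= grid_sum M N tau.
Proof.
  intro H. destruct i as [|i], j as [|j]; try (unfold inside in H; lia).
  assert (A : forall i, 0 <= sum_f_R0 (fun j => Rabs (tau (S i) (S j))) (N - 1) /\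
     forall j, (j <= N - 1)%nat -> Rabs (tau (S i) (S j)) <= sum_f_R0 (fun j => Rabs (tau (S i) (S j))) (N - 1))
    by (intro; apply (sum_nonneg (fun j => Rabs (tau (S _) (S j)))); intros; apply Rabs_pos).
  apply Rle_trans with (sum_f_R0 (fun j => Rabs (tau (S i) (S j))) (N - 1)).
  - apply A. unfold inside in H; lia.
  - apply (sum_nonneg (fun i => sum_f_R0 (fun j => Rabs (tau (S i) (S j))) (N - 1))); [intros; apply A | unfold inside in H; lia].
Qed.

Lemma grid_sum_zero M N tau : (1 <= M)%nat -> (1 <= N)%nat ->
  (forall i j, inside M N i j -> tau i j = 0) -> grid_sum M N tau = 0.
Proof.
  intros HM HN H. unfold grid_sum.
  assert (Z : forall (f : nat -> R) K, (forall k, (k <= K)%nat -> f k = 0) -> sum_f_R0 f K = 0).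
  { intros f K E. induction K as [|K IH]; simpl; [apply E; lia|]. rewrite IH, E by (intros; apply E || idtac; lia). ring. }
  apply Z. intros i Hi. apply Z. intros j Hj. rewrite H, Rabs_R0 by (unfold inside; lia). reflexivity.
Qed.

Lemma grid_sum_continuity M N (tau : R -> nat -> nat -> R) : (1 <= M)%nat -> (1 <= N)%nat ->
  (forall i j, inside M N i j -> continuity (fun t => tau t i j)) -> continuity (fun t => grid_sum M N (tau t)).
Proof.
  intros HM HN H. unfold grid_sum.
  apply (sum_continuity (fun t i => sum_f_R0 (fun j => Rabs (tau t (S i) (S j))) (N - 1))). intros i Hi.
  apply (sum_continuity (fun t j => Rabs (tau t (S i) (S j)))). intros j Hj.
  apply (continuity_comp (fun t => tau t (S i) (S j)) Rabs); [|exact Rcontinuity_abs].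
  apply H. unfold inside; lia.
Qed.

(** The range in which [hb_inj] applies to all four edges of each quadrilateral. *)
Definition small_config (M N : nat) (p q tau : nat -> nat -> R) : Prop :=
  forall i j, inside M N i j -> Rabs (tau i j) < p i j /\ Rabs (tau i j) < / p i j /\
    Rabs (tau i j) < q i j /\ Rabs (tau i j) < / q i j.

(** A vertex at rest gives its edges the factor 1; by injectivity the neighbour across each edge is
    at rest too, and this spreads over the grid. *)
Lemma grid_config_all_zero M N p q tau i0 j0 : grid_pos M N p q -> grid_config M N p q tau ->
  small_config M N p q tau -> inside M N i0 j0 -> tau i0 j0 = 0 -> forall i j, inside M N i j -> tau i j = 0.
Proof.
  intros HP [C1 C2] HS H0 E0.
  assert (Z : forall p x, Rabs x < Rabs p -> hb p x = 1 -> x = 0).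
  { intros r x Hx E. apply (hb_inj r); [assumption | rewrite Rabs_R0; pose proof (Rabs_pos x); lra | rewrite hb_0; exact E]. }
  assert (A : forall i j, inside M N i j -> inside M N (S i) j -> (tau i j = 0 <-> tau (S i) j = 0)).
  { intros i j H1 H2. assert (E := C1 i j H1 H2). destruct (HP _ _ H1) as [P1 _]. destruct (HP _ _ H2) as [P2 _].
    destruct (HS _ _ H1) as (S1 & _). destruct (HS _ _ H2) as (_ & S2 & _).
    assert (I2 : 0 < / p (S i) j) by (apply Rinv_0_lt_compat; assumption).
    split; intro T.
    - rewrite T, hb_0 in E. apply (Z (/ p (S i) j)); [rewrite (Rabs_pos_eq (/ p (S i) j)) by lra; assumption | symmetry; exact E].
    - rewrite T, hb_0 in E. apply (Z (p i j)); [rewrite (Rabs_pos_eq (p i j)) by lra; assumption | exact E]. }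
  assert (B : forall i j, inside M N i j -> inside M N i (S j) -> (tau i j = 0 <-> tau i (S j) = 0)).
  { intros i j H1 H2. assert (E := C2 i j H1 H2). destruct (HP _ _ H1) as [_ Q1]. destruct (HP _ _ H2) as [_ Q2].
    destruct (HS _ _ H1) as (_ & _ & S1 & _). destruct (HS _ _ H2) as (_ & _ & _ & S2).
    assert (I2 : 0 < / q i (S j)) by (apply Rinv_0_lt_compat; assumption).
    split; intro T.
    - rewrite T, hb_0 in E. apply (Z (- / q i (S j))); [rewrite Rabs_Ropp, (Rabs_pos_eq (/ q i (S j))) by lra; assumption | symmetry; exact E].
    - rewrite T, hb_0 in E. apply (Z (- q i j)); [rewrite Rabs_Ropp, (Rabs_pos_eq (q i j)) by lra; assumption | exact E]. }
  intros i j H.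
  assert (R : tau i j0 = 0).
  { apply (nat_spread (fun i => tau i j0 = 0) 1 M i0); try (unfold inside in *; lia); [exact E0|].
    intros k L1 L2. apply A; unfold inside in *; lia. }
  apply (nat_spread (fun j => tau i j = 0) 1 N j0); try (unfold inside in *; lia); [exact R|].
  intros k L1 L2. apply B; unfold inside in *; lia.
Qed.

(** The sum of the absolute values takes every small positive value. At such a moment the
    configuration is small but not entirely at rest, so by [grid_config_all_zero] no vertex is. *)
Lemma path_accum M N p q (tau : R -> nat -> nat -> R) t1 : (1 <= M)%nat -> (1 <= N)%nat -> grid_pos M N p q ->
  (forall t, grid_config M N p q (tau t)) ->
  (forall i j, inside M N i j -> continuity (fun t => tau t i j)) ->
  (forall i j, inside M N i j -> tau 0 i j = 0) ->
  (exists i j, inside M N i j /\ tau t1 i j <> 0) -> grid_accum M N p q.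
Proof.
  intros HM HN HP HC Hcont H0 (i1 & j1 & L1 & N1) eps He.
  set (w := fun t => grid_sum M N (tau t)).
  assert (W : continuity w) by (apply grid_sum_continuity; assumption).
  assert (W0 : w 0 = 0) by (apply grid_sum_zero; assumption).
  assert (W1 : 0 < w t1).
  { assert (G := grid_sum_ge M N (tau t1) i1 j1 L1). assert (A := Rabs_pos_lt _ N1). unfold w. lra. }
  destruct (grid_lower_bound M N (fun i j => Rmin (Rmin (p i j) (/ p i j)) (Rmin (q i j) (/ q i j)))) as (d & d0 & Hd).
  { intros i j L. destruct (HP i j L). repeat apply Rmin_pos; try assumption; apply Rinv_0_lt_compat; assumption. }
  (* Below the value reached at [t1], so that it is attained; the half makes it strictly smaller
     than [eps] and the injectivity bound [d]. *)
  set (v := Rmin (w t1) (Rmin eps d / 2)).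
  assert (v0 : 0 < v) by (unfold v; apply Rmin_pos; [assumption|]; assert (0 < Rmin eps d) by (apply Rmin_pos; assumption); lra).
  assert (v1 : v <= w t1) by apply Rmin_l.
  assert (v2 : v < eps /\ v < d).
  { assert (A := Rmin_r (w t1) (Rmin eps d / 2)). assert (B := Rmin_l eps d). assert (C := Rmin_r eps d).
    assert (0 < Rmin eps d) by (apply Rmin_pos; assumption). fold v in A. lra. }
  assert (T : exists t, w t = v).
  { assert (Wv : continuity (fun t => w t - v)) by cont_tac.
    destruct (Rle_dec 0 t1) as [L|L].
    - destruct (IVT_cor (fun t => w t - v) 0 t1 Wv L) as (t & _ & E); [rewrite W0; nra | exists t; lra].
    - destruct (IVT_cor (fun t => w t - v) t1 0 Wv ltac:(lra)) as (t & _ & E); [rewrite W0; nra | exists t; lra]. }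
  destruct T as [t Et]. exists (tau t). split; [apply HC|].
  assert (S : forall i j, inside M N i j -> Rabs (tau t i j) <= v).
  { intros i j L. rewrite <- Et. apply grid_sum_ge, L. }
  assert (SC : small_config M N p q (tau t)).
  { intros i j L. specialize (S i j L). specialize (Hd i j L). cbv beta in Hd.
    assert (A1 := Rmin_l (Rmin (p i j) (/ p i j)) (Rmin (q i j) (/ q i j))).
    assert (A2 := Rmin_r (Rmin (p i j) (/ p i j)) (Rmin (q i j) (/ q i j))).
    assert (A3 := Rmin_l (p i j) (/ p i j)). assert (A4 := Rmin_r (p i j) (/ p i j)).
    assert (A5 := Rmin_l (q i j) (/ q i j)). assert (A6 := Rmin_r (q i j) (/ q i j)). lra. }
  intros i j L. split; [|specialize (S i j L); lra].
  intro Z. assert (A := grid_config_all_zero M N p q (tau t) i j HP (HC t) SC L Z).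
  apply (Rgt_not_eq _ _ v0). rewrite <- Et. apply grid_sum_zero; assumption.
Qed.

Lemma flexible_accum m n F : dual_convex m n F -> pairwise_nonparallel m n F -> flexible m n F ->
  grid_accum (m - 1) (n - 1) (net_p F) (net_q F).
Proof.
  intros HD HP (G & (HG0 & HGc & HGn & HGf & HGk) & HT). assert (HF := dual_convex_faces m n F HD).
  assert (Hm : (2 <= m)%nat) by apply HD. assert (Hn : (2 <= n)%nat) by apply HD.
  set (G' := fun t => G (clamp t)).
  assert (C : forall i j, (i <= m)%nat -> (j <= n)%nat -> continuity (fun t => pz (G' t i j))).
  { intros i j Hi Hj. apply (continuity_of_01 (fun t => G t i j)). apply HGc; assumption. }
  assert (FC : forall t, face_congruent m n F (G' t)) by (intro t; exact (HGf (clamp t) (clamp_in01 t))).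
  assert (DF : forall t i j, non_boundary m n i j ->
    let s := dev_ch F (G' t) i j in let u := dev F (G' t) i j in let p := net_p F i j in let q := net_q F i j in
    s ^ 2 - u ^ 2 = 1 /\ factor_v F (G' t) i (j - 1) = s - u / q /\ factor_h F (G' t) i j = s + p * u /\
    factor_v F (G' t) i j = s - q * u /\ factor_h F (G' t) (i - 1) j = s + u / p).
  { intros t i j H. apply (deformed_factors m n); try assumption; [apply HGn, clamp_in01 | apply FC | apply HGk; [apply clamp_in01 | assumption]]. }
  assert (D0 : forall k l, (k < m)%nat -> (l < n)%nat -> diff_plane F (G' 0) k l = mkpl 0 0 0).
  { intros k l Hk Hl. apply (diff_plane_of_cong m n F (G' 0) k l 0 0 0 (mkpt 0 0 0)); try assumption.
    assert (E : forall i j, (i <= m)%nat -> (j <= n)%nat -> G' 0 i j = iso_cong 0 0 0 (mkpt 0 0 0) (F i j)).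
    { intros i j Hi Hj. unfold G'. rewrite clamp_id by (unfold in01; lra). rewrite HG0 by assumption.
      unfold iso_cong. rewrite cos_0, sin_0. destruct (F i j) as [x y z]. cbn [px py pz]. f_equal; ring. }
    intros r Hr. destruct r as [|[|[|[|r]]]]; cbn [face_vertex]; [ | | | | lia]; apply E; lia. }
  assert (F0 : forall i j, (i < m)%nat -> (j < n)%nat -> factor_h F (G' 0) i j = 1 /\ factor_v F (G' 0) i j = 1).
  { intros i j Hi Hj. unfold factor_h, factor_v, edge_factor. rewrite !D0 by lia. cbn [pa pb]. unfold Rdiv.
    split; ring. }
  assert (CF := fun i j Hi Hj => factor_continuity m n F G' C i j Hi Hj).
  assert (Cs : forall i j, non_boundary m n i j -> continuity (fun t => dev_ch F (G' t) i j)).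
  { intros i j H. destruct (CF i j) as [A B]; try (unfold non_boundary in H; lia).
    unfold dev_ch, Rdiv. cont_tac. }
  (* The path stays on the branch [s > 0] of the hyperbola: it starts at [s = 1] and [s] never
     vanishes since [s ^ 2 = 1 + u ^ 2]. *)
  assert (Spos : forall i j, non_boundary m n i j -> forall t, 0 < dev_ch F (G' t) i j).
  { intros i j H. apply (continuous_nonzero_pos (fun t => dev_ch F (G' t) i j)); [apply Cs, H | |].
    - destruct (F0 i j) as [A B]; try (unfold non_boundary in H; lia).
      unfold dev_ch. rewrite A, B. destruct (net_pq_pos m n F i j HD H).
      replace ((net_q F i j * 1 + net_p F i j * 1) / (net_p F i j + net_q F i j)) with 1 by (field; lra). lra.
    - intros t Z. destruct (DF t i j H) as (E & _). rewrite Z in E.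
      assert (P := pow2_ge_0 (dev F (G' t) i j)). lra. }
  assert (HB : forall t i j, non_boundary m n i j ->
    let u := dev F (G' t) i j in
    factor_v F (G' t) i (j - 1) = hb (- / net_q F i j) u /\ factor_h F (G' t) i j = hb (net_p F i j) u /\
    factor_v F (G' t) i j = hb (- net_q F i j) u /\ factor_h F (G' t) (i - 1) j = hb (/ net_p F i j) u).
  { intros t i j H u. destruct (DF t i j H) as (E & E1 & E2 & E3 & E4).
    rewrite E1, E2, E3, E4. unfold hb. fold u. fold u in E.
    rewrite <- (ch_unique (dev_ch F (G' t) i j) u); [|apply Rlt_le, Spos, H | exact E].
    unfold Rdiv. repeat split; ring. }
  assert (NT : exists t, ~ exists phi c1 c2 b, forall i j, (i <= m)%nat -> (j <= n)%nat -> G' t i j = iso_cong phi c1 c2 b (F i j)).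
  { apply NNPP. intro NE. apply HT. intros t Ht. apply NNPP. intro NX. apply NE. exists t.
    unfold G'. rewrite clamp_id by exact Ht. exact NX. }
  destruct NT as [t1 NT].
  apply (path_accum _ _ _ _ (fun t => dev F (G' t)) t1); try lia.
  - intros i j H. apply (net_pq_pos m n); [assumption | apply non_boundary_inside, H].
  - intro t. split; intros i j H1 H2; apply non_boundary_inside in H1, H2.
    + destruct (HB t i j H1) as (_ & A & _ & _). destruct (HB t (S i) j H2) as (_ & _ & _ & B).
      replace (S i - 1)%nat with i in B by lia. congruence.
    + destruct (HB t i j H1) as (_ & _ & A & _). destruct (HB t i (S j) H2) as (B & _).
      replace (S j - 1)%nat with j in B by lia. congruence.
  - intros i j H. apply non_boundary_inside in H.
    destruct (CF i j) as [A B]; try (unfold non_boundary in H; lia).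
    unfold dev, Rdiv. cont_tac.
  - intros i j H. apply non_boundary_inside in H.
    destruct (F0 i j) as [A B]; try (unfold non_boundary in H; lia).
    unfold dev. rewrite A, B. unfold Rdiv. ring.
  (* If all parameters vanished at [t1], every factor would be [hb _ 0 = 1] and the net at [t1]
     would be congruent to the original one. *)
  - apply NNPP. intro NE. apply NT.
    assert (Z : forall i j, non_boundary m n i j -> dev F (G' t1) i j = 0).
    { intros i j H. apply NNPP. intro NZ. apply NE. exists i, j. split; [apply non_boundary_inside, H | exact NZ]. }
    apply (trivial_of_factors m n); try assumption; [apply FC | |].
    + intros i j Hi Hj. destruct i as [|i].
      * assert (NB : non_boundary m n 1 j) by (unfold non_boundary; lia).
        destruct (HB t1 1%nat j NB) as (_ & _ & _ & E). rewrite (Z 1%nat j NB), hb_0 in E. exact E.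
      * assert (NB : non_boundary m n (S i) j) by (unfold non_boundary; lia).
        destruct (HB t1 (S i) j NB) as (_ & E & _). rewrite (Z (S i) j NB), hb_0 in E. exact E.
    + intros i j Hi Hj. destruct j as [|j].
      * assert (NB : non_boundary m n i 1) by (unfold non_boundary; lia).
        destruct (HB t1 i 1%nat NB) as (E & _). rewrite (Z i 1%nat NB), hb_0 in E. exact E.
      * assert (NB : non_boundary m n i (S j)) by (unfold non_boundary; lia).
        destruct (HB t1 i (S j) NB) as (_ & _ & E & _). rewrite (Z i (S j) NB), hb_0 in E. exact E.
Qed.

Theorem theorem1 (m n : nat) (F : net) :
  dual_convex m n F ->
  (forall k l k' l', (k < m)%nat -> (l < n)%nat -> (k' < m)%nat -> (l' < n)%nat ->
     (k, l) <> (k', l') -> ~ is_zero (cross (face_normal F k l) (face_normal F k' l'))) ->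
  (flexible m n F <->
   (* (i) *)
   ((forall k, (k + 3 <= m)%nat ->
       exists a b c, (a <> 0 \/ b <> 0) /\
         forall l, (l < n)%nat -> forall X,
           on_plane (face_plane F k l) X -> on_plane (face_plane F (k + 2) l) X ->
           in_iso_plane a b c X)
    \/
    (forall l, (l + 3 <= n)%nat ->
       exists a b c, (a <> 0 \/ b <> 0) /\
         forall k, (k < m)%nat -> forall X,
           on_plane (face_plane F k l) X -> on_plane (face_plane F k (l + 2)) X ->
           in_iso_plane a b c X))
   \/
   (* (ii) *)
   ((forall i j, non_boundary m n i j -> non_boundary m n (S i) j ->
       exists r, opp_ratio_at F i j 2 r /\ opp_ratio_at F (S i) j 0 r) /\
    (forall i j, non_boundary m n i j -> non_boundary m n i (S j) ->
       exists r, opp_ratio_at F i j 3 r /\ opp_ratio_at F i (S j) 1 r))).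
Proof.
  intros HD HP. fold (pairwise_nonparallel m n F) in HP.
  rewrite (isotropic_columns_spec m n F HD HP), (isotropic_rows_spec m n F HD HP), (equal_opp_ratios_spec m n F HD).
  assert (Hpos : grid_pos (m - 1) (n - 1) (net_p F) (net_q F)).
  { intros i j H. apply (net_pq_pos m n); [assumption | apply non_boundary_inside, H]. }
  assert (Hm : (2 <= m)%nat) by apply HD. assert (Hn : (2 <= n)%nat) by apply HD.
  split.
  - intro HX. destruct (grid_classification _ _ _ _ Hpos (flexible_accum m n F HD HP HX)) as [H|[H|H]]; auto.
  - intro H. destruct (grid_solution_exists (m - 1) (n - 1) (net_p F) (net_q F)) as (A & B & HAB);
      [lia | lia | exact Hpos | destruct H as [[H|H]|H]; auto |].
    exact (solution_flexible m n F A B HD HP HAB).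
Qed.
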